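(* Assume that the entries of $E$ are independent $N(0,\sigma^2)$ random variables and that $\lambda_p(M)>0$, where $M=X'X$. Let $q=r(X)$, $r=r(A)$, let $\theta>0$ be arbitrary, set $$\tau=(1+\theta)\,d_1(X)\,\sigma(\sqrt n+\sqrt q),$$ and let $\widetilde A$ be a minimizer of $\|Y-XB\|_F^2+2\tau\|B\|_1$ over all $p\times n$ matrices $B$. Then there is a constant $C(\theta)$ depending only on $\theta$ such that, with probability at least $1-\exp(-\theta^2(n+q)/2)$, $$\|X\widetilde A-XA\|_F^2\le C(\theta)\min_{k\le r}\left(\sum_{j=k+1}^rd_j^2(XA)+c_0(M)\,k\,\sigma^2(n+q)\right)$$ and, for every $k\le r$, $$\|\widetilde A-A\|_F^2\le C(\theta)\left(c_0(M)\sum_{j=k+1}^rd_j^2(A)+\frac{c_0(M)}{\lambda_p(M)}\,k\,\sigma^2(n+q)\right).$$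
   Context: Multivariate response regression model: $Y=XA+E$, where $Y$ is the $m\times n$ response matrix, $X$ is a fixed (nonrandom) $m\times p$ matrix, $A$ is an unknown fixed $p\times n$ matrix, and $E$ is a random $m\times n$ matrix. A prime denotes transpose, $r(C)$ is the rank of $C$, $\|C\|_F$ the Frobenius norm, $d_1(C)\ge d_2(C)\ge\cdots$ the singular values of $C$ in decreasing order, and $\|C\|_1=\sum_jd_j(C)$ the nuclear norm. $\lambda_1(M)\ge\cdots\ge\lambda_p(M)$ are the eigenvalues of the $p\times p$ matrix $M=X'X$ and $c_0(M)=\lambda_1(M)/\lambda_p(M)$ is its condition number. $k$ ranges over nonnegative integers. *)

(* Defs.v *)
From HB Require Import structures.
From mathcomp Require Import all_boot all_order all_algebra.
From mathcomp Require Import polyrcf.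
From mathcomp Require Import all_classical all_reals all_analysis.

Set Implicit Arguments.
Unset Strict Implicit.
Unset Printing Implicit Defensive.

Import Order.TTheory GRing.Theory Num.Theory.

Local Open Scope classical_set_scope.
Local Open Scope ring_scope.

(* All real eigenvalues of [M], in nonincreasing order and repeated according
   to their algebraic multiplicity ([rootsR] lists the distinct real roots in
   increasing order).  When [M] is symmetric of order p this list has exactly
   p entries. *)
Definition eigvals (R : rcfType) (p : nat) (M : 'M[R]_p) : seq R :=
  flatten [seq nseq (mup x (char_poly M)) x | x <- rev (rootsR (char_poly M))].

(* Indices of eigenvalues and of singular values start at 1; an index beyond
   the end of the list gives 0. *)
Definition eigval (R : rcfType) (p : nat) (M : 'M[R]_p) (j : nat) : R :=
  (eigvals M)`_j.-1.

Definition singval (R : rcfType) (m n : nat) (C : 'M[R]_(m, n)) (j : nat) : R :=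
  Num.sqrt (eigval (C^T *m C) j).

(* [C^T *m C] has order n, so all nonzero singular values have index <= n. *)
Definition nuclear_norm (R : rcfType) (m n : nat) (C : 'M[R]_(m, n)) : R :=
  \sum_(1 <= j < n.+1) singval C j.

Definition frobenius_norm (R : rcfType) (m n : nat) (C : 'M[R]_(m, n)) : R :=
  Num.sqrt (\sum_(i < m) \sum_(j < n) C i j ^+ 2).

Definition condition_number (R : rcfType) (p : nat) (M : 'M[R]_p) : R :=
  eigval M 1 / eigval M p.

Definition mutually_independent (d : measure_display) (T : measurableType d)
    (R : realType) (P : probability T R) (I : finType)
    (Z : I -> {RV P >-> R}) : Prop :=
  forall (J : {set I}) (B : I -> set R), (forall i, measurable (B i)) ->
    P (\bigcap_(i in [set` J]) (Z i @^-1` B i)) =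
    (\prod_(i in J) P (Z i @^-1` B i))%E.

(* The law of [Z] is N(mu, sigma^2); the second parameter of [normal_prob] is
   the standard deviation.  The two set functions are compared on Borel sets
   only. *)
Definition has_normal_law (d : measure_display) (T : measurableType d)
    (R : realType) (P : probability T R) (Z : {RV P >-> R})
    (mu sigma : R) : Prop :=
  forall B : set R, measurable B -> distribution P Z B = normal_prob mu sigma B.

Definition random_matrix (d : measure_display) (T : measurableType d)
    (R : realType) (P : probability T R) (m n : nat)
    (E : 'I_m -> 'I_n -> {RV P >-> R}) (w : T) : 'M[R]_(m, n) :=
  \matrix_(i, j) E i j w.

Definition nuclear_objective (R : rcfType) (m n p : nat) (Y : 'M[R]_(m, n))
    (X : 'M[R]_(m, p)) (tau : R) (B : 'M[R]_(p, n)) : R :=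
  frobenius_norm (Y - X *m B) ^+ 2 + 2 * tau * nuclear_norm B.

(* Main.v *)
(* Put N = X'E / tau and Delta = Atilde - A.  If N has operator norm at most 1,
   compare the objective at Atilde with its value at a truncation B of A of rank
   k.  Let W be the subgradient of the nuclear norm at B which coincides with N
   off the row and column spaces of B.  Then ||N - W||_F <= 3 sqrt k, and
   convexity gives
     ||X Delta||^2 <= ||X(A - B)||^2 + 6 tau sqrt k ||Atilde - B||,
   whence both bounds, since lambda_p ||D||^2 <= ||XD||^2 <= lambda_1 ||D||^2.
   The truncation follows the right singular vectors of XA for the first bound
   and those of A for the second.

   The operator norm of N is controlled by the supremum of (Xa)'Ev over vectors
   with |Xa| = |v| = 1.  For finitely many pairs (a, v), adding an independent
   standard normal variable to this process equates its variances with those of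
   the decoupled process <b, g> + <v, h>, where |b| = |Xa|, and its covariances
   are larger.  Slepian's comparison, applied to (sum_i exp(beta x_i))^alpha
   with alpha * beta = lambda fixed and alpha -> 0, bounds the exponential moment
   of the supremum by that of |g| + |h|, up to a factor exp(-lambda^2/2), and
   Chernoff's inequality gives exactly the stated probability; a countable dense
   family of pairs suffices.  Slepian's inequality follows by writing both
   Gaussian vectors as sums of 2^j independent copies scaled by 2^(-j/2):
   exchanging one copy costs a factor 1 + O(2^(-3j/2)). *)

Require Import Defs.
From HB Require Import structures.
From mathcomp Require Import all_boot all_order all_algebra.
From mathcomp Require Import ring lra.
From mathcomp Require Import all_classical all_reals all_analysis.
From mathcomp Require Import measurable_realfun.
From mathcomp Require Import fingroup perm complex polyrcf.

Set SsrOldRewriteGoalsOrder.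
Set Implicit Arguments.
Unset Strict Implicit.
Unset Printing Implicit Defensive.

Import Order.TTheory GRing.Theory Num.Theory.
Import numFieldNormedType.Exports.

Local Open Scope classical_set_scope.
Local Open Scope ring_scope.

(** * Integrals against normal laws on the line *)

Section gauss1.
Context {R : realType}.
Notation mu := (@lebesgue_measure R).

(** A bound on the expected supremum alone would leave its deviation to be controlled; comparing
    exponential moments settles both at once. With lambda = theta (sqrt n + sqrt q), the added
    normal direction contributes exp(lambda^2 / 2) on the noise side, while |g| and |h| contribute
    at most exp(lambda sqrt q + lambda^2 / 2) and exp(lambda sqrt n + lambda^2 / 2). At the level (1
    + theta)(sqrt n + sqrt q) the exponent left over is - lambda^2 / 2, and lambda^2 >= theta^2 (n +
    q). Sending alpha to 0 removes the factor K^alpha due to K pairs, so the bound survives the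
    passage to infinitely many pairs. A Gaussian vector occurs only as a list of directions, and its
    law as a composition of one-dimensional averaging operators. These commute and preserve
    log-Lipschitz functions, so exchanging independent copies becomes algebra of operators, and the
    lists are compared through their sums [cov_of]. The entries of E, known only through
    independence of events, are tied to these operators by an inequality, obtained by cutting the
    line into small cells. *)

Lemma ge0_integral_normal_prob (m s : R) (f : R -> R) :
  measurable_fun [set: R] f -> (forall x, 0 <= f x) ->
  (\int[normal_prob m s]_x (f x)%:E =
   \int[mu]_x (f x * normal_pdf m s x)%:E)%E.
Proof.
move=> mf f0.
have dom := normal_prob_dominates m s.
have mpdf : measurable_fun [set: R] (fun x => (normal_pdf m s x)%:E).
  by apply/measurable_EFinP; exact: measurable_normal_pdf.
rewrite -(Radon_Nikodym_SigmaFinite.change_of_variables dom) //; last exact/measurable_EFinP.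
have mRN : measurable_fun [set: R]
    (Radon_Nikodym_SigmaFinite.f (normal_prob m s) mu).
  exact: measurable_int (Radon_Nikodym_SigmaFinite.f_integrable dom).
transitivity (\int[mu]_x ((f x)%:E * (normal_pdf m s x)%:E))%E; last first.
  by apply: eq_integral => x _; rewrite EFinM.
apply: ge0_ae_eq_integral => //.
- by apply: emeasurable_funM => //; exact/measurable_EFinP.
- by apply: emeasurable_funM => //; exact/measurable_EFinP.
- move=> x _; apply: mule_ge0; first by rewrite lee_fin.
  exact: Radon_Nikodym_SigmaFinite.f_ge0.
- by move=> x _; apply: mule_ge0; rewrite lee_fin ?normal_pdf_ge0.
- apply: ae_eqe_mul2l.
  apply: integral_ae_eq => //.
    exact: Radon_Nikodym_SigmaFinite.f_integrable.
  move=> A _ mA; rewrite -Radon_Nikodym_SigmaFinite.f_integral//.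
Qed.

Lemma ge0_integral_affine (m s : R) (G : R -> R) : 0 < s ->
  continuous G -> (forall x, 0 <= G x) ->
  (\int[mu]_x (G x)%:E = \int[mu]_x (G (m + s * x) * s)%:E)%E.
Proof.
move=> s0 cG G0.
pose F := (fun x : R^o => m + s * x : R^o).
have dF (x : R^o) : is_derive x (1 : R^o) F s.
  rewrite /F; apply: is_derive_eq; rewrite ?scaler0 ?scale0r ?add0r ?addr0 ?mulr0 ?mul0r ?add0r.
  by rewrite mul1r; exact: mulr1.
have F'E : (F^`())%classic = cst s.
  by apply/funext => x; rewrite derive1E; apply: derive_val.
rewrite (@increasing_ge0_integration_by_substitutionT _ F G) //.
- by apply: eq_integral => x _; rewrite F'E.
- by move=> x y xy; rewrite /F ltrD2l ltr_pM2l.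
- by rewrite F'E => x; exact: cvg_cst.
- by rewrite F'E; exact: is_cvg_cst.
- by rewrite F'E; exact: is_cvg_cst.
- apply/cvgrNyPle => A; exists ((A - m) / s); split; first exact: num_real.
  by move=> x; rewrite ltr_pdivlMr// => h; rewrite /F/=; lra.
- apply/cvgryPge => A; exists ((A - m) / s); split; first exact: num_real.
  by move=> x; rewrite ltr_pdivrMr// => h; rewrite /F/=; lra.
Qed.

Definition gmu : probability _ R := normal_prob (0 : R) 1.

Lemma ge0_integral_normal_affine (m s : R) (f : R -> R) : 0 < s ->
  continuous f -> (forall x, 0 <= f x) ->
  (\int[normal_prob m s]_x (f x)%:E = \int[gmu]_x (f (m + s * x))%:E)%E.
Proof.
move=> s0 cf f0.
have s1 : s != 0 by rewrite gt_eqF.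
have c2 : continuous (fun x : R => f (m + s * x)).
  move=> x; apply: continuous_comp; last exact: cf.
  by apply: cvgD; [exact: cvg_cst|apply: cvgM; [exact: cvg_cst|exact: cvg_id]].
rewrite (ge0_integral_normal_prob m s (continuous_measurable_fun cf) f0).
rewrite (ge0_integral_normal_prob 0 1 (continuous_measurable_fun c2)) => [|x]; last exact: f0.
rewrite (@ge0_integral_affine m s)//; last 2 first.
- by move=> x; apply: cvgM; [exact: cf|exact: continuous_normal_pdf].
- by move=> x; rewrite mulr_ge0// normal_pdf_ge0.
apply: eq_integral => x _; congr EFin; rewrite -mulrA; congr (_ * _).
rewrite !normal_pdfE ?oner_eq0// /normal_peak /normal_fun.
rewrite mulrAC.
have -> : (- (m + s * x - m) ^+ 2 / (s ^+ 2 *+ 2)) = (- (x - 0) ^+ 2 / (1 ^+ 2 *+ 2)).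
  by field.
congr (_ * _).
rewrite expr1n mul1r -mulrnAr sqrtrM ?sqr_ge0// sqrtr_sqr gtr0_norm//.
by rewrite invfM mulrAC mulVf// mul1r.
Qed.
End gauss1.

(** * Log-Lipschitz functions *)

Section logLip.
Context {R : realType}.
Notation mu := (@lebesgue_measure R).

Definition l1norm (N : nat) (x : 'rV[R]_N) : R := \sum_i `|x ord0 i|.

Lemma l1norm_ge0 N (x : 'rV[R]_N) : 0 <= l1norm x.
Proof. by apply: sumr_ge0. Qed.

Lemma l1normZ N a (x : 'rV[R]_N) : l1norm (a *: x) = `|a| * l1norm x.
Proof. by rewrite /l1norm big_distrr; apply: eq_bigr => i _; rewrite mxE normrM. Qed.

Lemma l1normN N (x : 'rV[R]_N) : l1norm (- x) = l1norm x.
Proof. by rewrite -scaleN1r l1normZ normrN1 mul1r. Qed.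

Lemma l1norm_rat N (x : 'rV[R]_N) e : 0 < e ->
  exists q : 'rV[rat]_N, l1norm (x - map_mx ratr q) <= e.
Proof.
move=> e0.
have h i : exists q : rat, `|x ord0 i - ratr q| <= e / N.+1%:R.
  have d0 : 0 < e / N.+1%:R by rewrite divr_gt0.
  have /rat_in_itvoo[q] : x ord0 i - e / N.+1%:R < x ord0 i by rewrite gtrBl.
  rewrite in_itv/= => /andP[q1 q2]; exists q.
  rewrite ger0_norm; first by move: q1; rewrite ltrBlDr -ltrBlDl => /ltW.
  by rewrite subr_ge0 ltW.
have [q hq] := choice h.
exists (\row_i q i); rewrite /l1norm.
apply: (@le_trans _ _ (\sum_(i < N) e / N.+1%:R)).
  by apply: ler_sum => i _; rewrite !mxE.
rewrite sumr_const card_ord -[_ *+ N]mulr_natr -mulrA ler_piMr ?(ltW e0)//.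
by rewrite ler_pdivrMl// mulr1 ler_nat.
Qed.

(* Members of this class are continuous and integrable along Gaussian
   directions, and the class is stable under Gaussian smoothing, so no
   integrability side condition survives below. *)
Definition logLip (N : nat) (L : R) (f : 'rV[R]_N -> R) :=
  forall x, 0 <= f x /\ forall d, f (x + d) <= expR (L * l1norm d) * f x.

Variable N : nat.
Implicit Types (f g : 'rV[R]_N -> R) (x c d : 'rV[R]_N).

Lemma logLip_ge0 L f x : logLip L f -> 0 <= f x.
Proof. by move=> /(_ x)[]. Qed.

Lemma logLip_le L f x y : logLip L f -> f y <= expR (L * l1norm (y - x)) * f x.
Proof. by move=> /(_ x)[_ /(_ (y - x))]; rewrite addrC subrK. Qed.

Lemma logLip_weaken L L' f : L <= L' -> logLip L f -> logLip L' f.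
Proof.
move=> LL' h x; have [f0 hf] := h x; split=> // d.
apply: (le_trans (hf d)); rewrite ler_wpM2r// ler_expR ler_wpM2r//.
exact: l1norm_ge0.
Qed.

Lemma logLip_D L f g : logLip L f -> logLip L g -> logLip L (fun x => f x + g x).
Proof.
move=> hf hg x; have [f0 hf1] := hf x; have [g0 hg1] := hg x.
by split=> [|d]; [rewrite addr_ge0|rewrite mulrDr lerD].
Qed.

Lemma logLip_Z L a f : 0 <= a -> logLip L f -> logLip L (fun x => a * f x).
Proof.
move=> a0 hf x; have [f0 hf1] := hf x.
by split=> [|d]; [rewrite mulr_ge0|rewrite mulrCA ler_wpM2l].
Qed.

(** The function is the infimum, over rational points q, of the measurable bounds expR (L * l1norm
    (z w - q)) * f q, so each strict sublevel set is a countable union of measurable sets. *)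
Lemma logLip_measurable (dd : measure_display) (T : measurableType dd) L f (z : T -> 'rV[R]_N) :
  0 <= L -> logLip L f -> (forall i, measurable_fun [set: T] (fun w => z w ord0 i)) ->
  measurable_fun [set: T] (fun w => f (z w)).
Proof.
move=> L0 hf mz.
have mn q : measurable_fun [set: T] (fun w => expR (L * l1norm (z w - q)) * f q).
  apply: measurable_funM; last exact: measurable_cst.
  apply: measurableT_comp; first exact: measurable_expR.
  apply: measurable_funM; first exact: measurable_cst.
  apply: measurable_sum => i; apply: measurableT_comp => //.
  have -> : (fun w => (z w - q) ord0 i) = (fun w => z w ord0 i - q ord0 i).
    by apply/funext => w; rewrite !mxE.
  by apply: measurable_funB.
apply: (measurability _ (RGenInftyO.measurableE R)) => _ [_ [a ->] <-].
rewrite setTI.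
rewrite (_ : _ @^-1` _ = \bigcup_(q : 'rV[rat]_N)
   [set w | expR (L * l1norm (z w - map_mx ratr q)) * f (map_mx ratr q) < a]).
  apply: countable_bigcupT_measurable => [|q]; first exact: countableP.
  rewrite (_ : [set w | _] = [set: T] `&`
    (fun w => expR (L * l1norm (z w - map_mx ratr q)) * f (map_mx ratr q)) @^-1` `]-oo, a[).
    exact: mn.
  by apply/seteqP; split=> w /=; rewrite in_itv/=; [move=> ?; split|case].
apply/seteqP; split=> w /=; rewrite in_itv/=; last first.
  by move=> [q _] /=; apply: le_lt_trans; exact: logLip_le.
move=> fa.
(* [h e] applies the log-Lipschitz inequality twice, from z w to q and back, for q at distance at
   most e. It tends to f (z w) < a as e decreases to 0. *)
pose h (e : R) := expR (L * e) * (expR (L * e) * f (z w)).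
have h0 : h 0 < a by rewrite /h mulr0 expR0 !mul1r.
have ch : h x @[x --> 0^'+] --> h 0.
  apply: cvg_at_right_filter.
  have cL : expR (L * x) @[x --> 0] --> expR (L * 0 : R).
    apply: continuous_cvg; first exact: continuous_expR.
    by apply: cvgM; [exact: cvg_cst|exact: cvg_id].
  by apply: cvgM => //; apply: cvgM => //; exact: cvg_cst.
have : \forall x \near 0^'+, h x < a.
  by apply: (cvgr_lt (h 0)).
move=> hn.
have : \forall x \near 0^'+, (0 < x) /\ h x < a.
  by near=> x; split; near: x => //; exact: nbhs_right_gt.
move=> /filter_ex[e [e0 he]].
have [q hq] := l1norm_rat (z w) e0.
exists q => //=; apply: le_lt_trans he; rewrite /h.
have hE : expR (L * l1norm (z w - map_mx ratr q)) <= expR (L * e).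
  by rewrite ler_expR ler_wpM2l.
rewrite ler_pM ?expR_ge0 ?(logLip_ge0 _ hf)//.
apply: (le_trans (logLip_le (z w) _ hf)); rewrite ler_wpM2r//.
  exact: logLip_ge0 hf.
by rewrite -opprB l1normN.
Unshelve. all: by end_near. Qed.

Lemma continuous_logLip (K : R) (g : R -> R) : 0 <= K ->
  (forall y, 0 <= g y) -> (forall y z, g z <= expR (K * `|z - y|) * g y) ->
  continuous g.
Proof.
move=> K0 g0 hg y.
have cK (s : R) : (expR (s * `|z - y|) * g y) @[z --> y] --> g y.
  rewrite -[X in _ --> X]mul1r; apply: cvgM; last exact: cvg_cst.
  have -> : 1 = expR (s * `|y - y|) by rewrite subrr normr0 mulr0 expR0.
  apply: continuous_cvg; first exact: continuous_expR.
  apply: cvgM; first exact: cvg_cst.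
  by apply: cvg_norm; apply: cvgB; [exact: cvg_id|exact: cvg_cst].
apply: (@squeeze_cvgr _ _ _ _ (fun z => expR ((- K) * `|z - y|) * g y)
    (fun z => expR (K * `|z - y|) * g y)); [|exact: cK..].
near=> z; rewrite hg andbT mulNr expRN mulrC ler_pdivrMr ?expR_gt0//.
by rewrite mulrC -[`|z - y|]distrC.
Unshelve. all: by end_near. Qed.

End logLip.

(** * Gaussian averaging along one direction *)

Section gauss.
Context {R : realType}.
Notation mu := (@lebesgue_measure R).
Local Notation gmu := (@gmu R).

Lemma std_normal_pdfE (y : R) :
  normal_pdf 0 1 y = normal_peak 1 * expR (- y ^+ 2 / 2).
Proof.
rewrite normal_pdfE ?oner_eq0// /normal_fun subr0 expr1n.
by rewrite -[1 *+ 2]/(2%:R).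
Qed.

Lemma measurable_affine_expR (g : R -> R) : measurable_fun [set: R] g ->
  measurable_fun [set: R] (fun y => expR (g y)).
Proof. by move=> mg; apply: measurableT_comp => //; exact: measurable_expR. Qed.

Lemma gauss_mgf (t : R) :
  (\int[gmu]_y (expR (t * y))%:E = (expR (t ^+ 2 / 2))%:E)%E.
Proof.
rewrite ge0_integral_normal_prob; last 2 first.
- apply: measurable_affine_expR; exact: measurable_funM.
- by move=> x; exact: expR_ge0.
transitivity (\int[mu]_y ((expR (t ^+ 2 / 2))%:E * (normal_pdf t 1 y)%:E))%E.
  apply: eq_integral => y _; rewrite -EFinM; congr EFin.
  rewrite std_normal_pdfE normal_pdfE ?oner_eq0// /normal_fun expr1n.
  rewrite mulrCA [RHS]mulrCA -!expRD; congr (_ * expR _).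
  by rewrite -[1 *+ 2]/(2%:R : R); field.
rewrite ge0_integralZl//.
- by rewrite integral_normal_pdf mule1.
- by apply/measurable_EFinP; exact: measurable_normal_pdf.
- by move=> y _; rewrite lee_fin normal_pdf_ge0.
Qed.

Lemma gauss_sqr_mgf (a : R) : a < 1 ->
  (\int[gmu]_y (expR (a * y ^+ 2 / 2))%:E = ((Num.sqrt (1 - a))^-1)%:E)%E.
Proof.
move=> a1; have a1' : 0 < 1 - a by rewrite subr_gt0.
have sq0 : 0 < Num.sqrt (1 - a) by rewrite sqrtr_gt0.
(* Tilting by exp(a y^2 / 2) turns the standard density into [s] times the centred normal density
   with standard deviation [s]. *)
set s := (Num.sqrt (1 - a))^-1.
have s0 : 0 < s by rewrite invr_gt0.
have s2 : s ^+ 2 = (1 - a)^-1 by rewrite /s exprVn sqr_sqrtr// ltW.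
rewrite ge0_integral_normal_prob; last 2 first.
- apply: measurable_affine_expR; apply: measurable_funM => //.
  by apply: measurable_funM => //; exact: measurable_funX.
- by move=> x; exact: expR_ge0.
transitivity (\int[mu]_y (s%:E * (normal_pdf 0 s y)%:E))%E.
  apply: eq_integral => y _; rewrite -EFinM; congr EFin.
  rewrite std_normal_pdfE normal_pdfE ?gt_eqF// /normal_fun.
  rewrite mulrCA [RHS]mulrA -!expRD; congr (_ * expR _).
    rewrite /normal_peak -[in RHS]mulrnAr sqrtrM ?sqr_ge0// sqrtr_sqr gtr0_norm//.
    by rewrite invfM mulrA mulfV ?gt_eqF// mul1r expr1n mul1r.
  by rewrite s2; field; rewrite gt_eqF.
rewrite ge0_integralZl//.
- by rewrite integral_normal_pdf mule1.
- by apply/measurable_EFinP; exact: measurable_normal_pdf.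
- by move=> y _; rewrite lee_fin normal_pdf_ge0.
- by rewrite lee_fin ltW.
Qed.

Lemma gauss_integrable_exp (K : R) :
  gmu.-integrable [set: R] (fun y => (expR (K * y))%:E).
Proof.
apply/integrableP; split.
  apply/measurable_EFinP; apply: measurable_affine_expR.
  exact: measurable_funM.
under eq_integral do rewrite gee0_abs ?lee_fin ?expR_ge0//.
by rewrite gauss_mgf ltry.
Qed.

Lemma gauss_integrable_le (K C : R) (g : R -> R) : 0 <= K ->
  measurable_fun [set: R] g -> (forall y, `|g y| <= C * expR (K * `|y|)) ->
  gmu.-integrable [set: R] (fun y => (g y)%:E).
Proof.
move=> K0 mg hg.
have C0 : 0 <= C.
  by have := hg 0; rewrite normr0 mulr0 expR0 mulr1; apply: le_trans.
have ig : gmu.-integrable [set: R]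
    ((fun y : R => C%:E * (expR (K * y))%:E) \+
     (fun y : R => C%:E * (expR (- K * y))%:E))%E.
  by apply: integrableD => //; apply: integrableZl => //;
    exact: gauss_integrable_exp.
apply: le_integrable ig => //.
- exact/measurable_EFinP.
- move=> y _ /=; rewrite lee_fin.
  rewrite (le_trans (hg y))// [leRHS]ger0_norm; last first.
    by rewrite addr_ge0// mulr_ge0// expR_ge0.
  rewrite -mulrDr ler_wpM2l//; have [y0|y0] := leP (0 : R) y.
    by rewrite ger0_norm// lerDl expR_ge0.
  by rewrite ltr0_norm// mulrN mulNr lerDr expR_ge0.
Qed.

Variable N : nat.
Implicit Types (f g : 'rV[R]_N -> R) (x c d : 'rV[R]_N).

Definition gsmooth c f x : R := \int[gmu]_y f (x + y *: c).

Lemma measurable_line x c i :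
  measurable_fun [set: R] (fun y => (x + y *: c) ord0 i).
Proof.
rewrite (_ : (fun y => _) = (fun y => x ord0 i + y * c ord0 i)).
  by apply: measurable_funD => //; exact: measurable_funM.
by apply/funext => y; rewrite !mxE.
Qed.

Lemma logLip_line_measurable L f x c : 0 <= L -> logLip L f ->
  measurable_fun [set: R] (fun y => f (x + y *: c)).
Proof.
by move=> L0 hf; apply: (logLip_measurable L0 hf) => i; exact: measurable_line.
Qed.

Lemma logLip_line_integrable L f x c : 0 <= L -> logLip L f ->
  gmu.-integrable [set: R] (fun y => (f (x + y *: c))%:E).
Proof.
move=> L0 hf; apply: (@gauss_integrable_le (L * l1norm c) (f x)).
- by rewrite mulr_ge0// l1norm_ge0.
- exact: logLip_line_measurable hf.
- move=> y; rewrite ger0_norm; last exact: logLip_ge0 hf.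
  have [_ /(_ (y *: c))] := hf x.
  by rewrite l1normZ mulrC (mulrC `|y|) mulrA.
Qed.

Lemma logLip_line_continuous L f x c : 0 <= L -> logLip L f ->
  continuous (fun y : R => f (x + y *: c)).
Proof.
move=> L0 hf; apply: (@continuous_logLip _ (L * l1norm c)).
- by rewrite mulr_ge0// l1norm_ge0.
- by move=> y; exact: logLip_ge0 hf.
- move=> y z; have := logLip_le (x + y *: c) (x + z *: c) hf.
  by rewrite opprD addrACA subrr add0r -scalerBl l1normZ (mulrC `|_|) mulrA.
Qed.

Lemma EFin_gsmooth L f x c : 0 <= L -> logLip L f ->
  ((gsmooth c f x)%:E = \int[gmu]_y (f (x + y *: c))%:E)%E.
Proof.
move=> L0 hf; rewrite /gsmooth /Rintegral fineK//.
apply: integrable_fin_num => //; exact: logLip_line_integrable hf.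
Qed.

Lemma gsmooth_logLip L f c : 0 <= L -> logLip L f -> logLip L (gsmooth c f).
Proof.
move=> L0 hf x; split=> [|d].
  by apply: Rintegral_ge0 => y _; exact: logLip_ge0 hf.
rewrite /gsmooth -RintegralZl//; last exact: logLip_line_integrable hf.
apply: le_Rintegral => //; first exact: logLip_line_integrable hf.
  exact: (integrableZl measurableT (expR (L * l1norm d))
    (logLip_line_integrable x c L0 hf)).
move=> y _; rewrite addrAC.
by have [_] := hf (x + y *: c); exact.
Qed.

Lemma gsmoothD L f g c x : 0 <= L -> logLip L f -> logLip L g ->
  gsmooth c (fun z => f z + g z) x = gsmooth c f x + gsmooth c g x.
Proof.
move=> L0 hf hg; rewrite /gsmooth RintegralD//.
- exact: logLip_line_integrable hf.
- exact: logLip_line_integrable hg.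
Qed.

Lemma gsmoothZ L f a c x : 0 <= L -> logLip L f ->
  gsmooth c (fun z => a * f z) x = a * gsmooth c f x.
Proof.
by move=> L0 hf; rewrite /gsmooth RintegralZl//; exact: logLip_line_integrable hf.
Qed.

Lemma gsmooth_le L f g c x : 0 <= L -> logLip L f -> logLip L g ->
  (forall z, f z <= g z) -> gsmooth c f x <= gsmooth c g x.
Proof.
move=> L0 hf hg fg; apply: le_Rintegral => //.
- exact: logLip_line_integrable hf.
- exact: logLip_line_integrable hg.
Qed.

Lemma gsmoothC L f c d x : 0 <= L -> logLip L f ->
  gsmooth c (gsmooth d f) x = gsmooth d (gsmooth c f) x.
Proof.
move=> L0 hf; apply: (congr1 (@fine R)).
transitivity (\int[gmu]_y \int[gmu]_z (f (x + y *: c + z *: d))%:E)%E.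
  by apply: eq_integral => y _; rewrite (EFin_gsmooth _ _ L0 hf).
transitivity (\int[gmu]_z \int[gmu]_y (f (x + y *: c + z *: d))%:E)%E.
  apply: (@fubini_tonelli _ _ _ _ _ gmu gmu
    (fun p : R * R => (f (x + p.1 *: c + p.2 *: d))%:E)).
  - apply/measurable_EFinP; apply: (logLip_measurable L0 hf) => i.
    rewrite (_ : (fun y => _) =
      (fun p : R * R => x ord0 i + p.1 * c ord0 i + p.2 * d ord0 i)).
      by apply: measurable_funD; [apply: measurable_funD => //|];
        apply: measurable_funM.
    by apply/funext => y; rewrite !mxE.
  - by move=> p; rewrite lee_fin; exact: logLip_ge0 hf.
apply: eq_integral => z _; rewrite (EFin_gsmooth _ _ L0 hf).
by apply: eq_integral => y _; rewrite addrAC.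
Qed.

(** Stability of the normal law. Substituting w = a y + b z in the inner integral and exchanging the
    integrals leaves, for fixed w, the integral over y of a conditional density, which is 1. *)
Lemma gauss_convolution (a b : R) (h : R -> R) :
  0 < b -> a ^+ 2 + b ^+ 2 = 1 -> continuous h -> (forall w, 0 <= h w) ->
  (\int[gmu]_y \int[gmu]_z (h (a * y + b * z))%:E = \int[gmu]_w (h w)%:E)%E.
Proof.
move=> b0 ab ch h0.
have b1 : b != 0 by rewrite gt_eqF.
have mh : measurable_fun [set: R] h by exact: continuous_measurable_fun.
pose k (y w : R) := h w * normal_peak b * expR (- (w - a * y) ^+ 2 / (b ^+ 2 *+ 2)).
have mk : measurable_fun [set: R * R] (fun p => k p.1 p.2).
  apply: measurable_funM.
    by apply: measurable_funM => //; exact: measurableT_comp.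
  apply: measurableT_comp; first exact: measurable_expR.
  apply: measurable_funM => //; apply: measurableT_comp => //.
  apply: measurable_funX; apply: measurable_funB => //; exact: measurable_funM.
have k0 y w : 0 <= k y w.
  by rewrite /k !mulr_ge0 ?expR_ge0 ?normal_peak_ge0.
have mp : measurable_fun [set: R] (normal_pdf (0 : R) 1).
  exact: measurable_normal_pdf.
have mk1 y : measurable_fun [set: R] (fun w => (k y w)%:E).
  by apply/measurable_EFinP; apply: (measurable_fun_pair2 y mk).
have mk2 w : measurable_fun [set: R] (k ^~ w).
  by apply: (measurable_fun_pair1 w mk).
transitivity (\int[gmu]_y \int[mu]_w (k y w)%:E)%E.
  apply: eq_integral => y _.
  rewrite -(ge0_integral_normal_affine (a * y) b0 ch h0).
  rewrite ge0_integral_normal_prob//; apply: eq_integral => w _.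
  by rewrite normal_pdfE// /k mulrA.
rewrite (@fubini_tonelli _ _ _ _ _ gmu mu (fun p => (k p.1 p.2)%:E)); last 2 first.
- exact/measurable_EFinP.
- by move=> p; rewrite lee_fin.
rewrite ge0_integral_normal_prob//; apply: eq_integral => w _.
rewrite ge0_integral_normal_prob//=.
transitivity (\int[mu]_y ((h w * normal_pdf 0 1 w)%:E * (normal_pdf (a * w) b y)%:E))%E.
  apply: eq_integral => y _; rewrite -EFinM; congr EFin.
  have b2 : b ^+ 2 = 1 - a ^+ 2 by rewrite -ab addrC addKr.
  have b3 : 1 - a ^+ 2 != 0 by rewrite -b2 sqrf_eq0.
  (* The joint density of (y, w) factored in the other order: w is standard normal and, given w, y
     has law N(a w, b^2). *)
  have E : expR (- (w - a * y) ^+ 2 / (b ^+ 2 *+ 2)) * expR (- y ^+ 2 / 2) =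
           expR (- w ^+ 2 / 2) * expR (- (y - a * w) ^+ 2 / (b ^+ 2 *+ 2)).
    by rewrite -!expRD b2; congr expR; field; rewrite b3.
  rewrite /k !std_normal_pdfE normal_pdfE// /normal_fun.
  transitivity (h w * normal_peak b * normal_peak 1 *
    (expR (- (w - a * y) ^+ 2 / (b ^+ 2 *+ 2)) * expR (- y ^+ 2 / 2))).
    by ring.
  by rewrite E; ring.
rewrite ge0_integralZl//.
- by rewrite integral_normal_pdf mule1.
- by apply/measurable_EFinP; exact: measurable_normal_pdf.
- by move=> y _; rewrite lee_fin normal_pdf_ge0.
- by rewrite lee_fin mulr_ge0// normal_pdf_ge0.
Qed.

Lemma gsmooth_half L f c x : 0 <= L -> logLip L f ->
  gsmooth ((Num.sqrt 2)^-1 *: c) (gsmooth ((Num.sqrt 2)^-1 *: c) f) x = gsmooth c f x.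
Proof.
move=> L0 hf; set s := (Num.sqrt 2)^-1; apply: (congr1 (@fine R)).
have s0 : 0 < s by rewrite invr_gt0 sqrtr_gt0.
have s1 : s ^+ 2 + s ^+ 2 = 1.
  by rewrite /s exprVn sqr_sqrtr//; lra.
rewrite -(gauss_convolution s0 s1 (@logLip_line_continuous L f x c L0 hf)); last first.
  by move=> y; exact: logLip_ge0 hf.
apply: eq_integral => y _; rewrite (EFin_gsmooth _ _ L0 hf).
apply: eq_integral => z _.
by rewrite scalerDl addrA !scalerA [y * s]mulrC [z * s]mulrC.
Qed.

End gauss.

(** * Elementary inequalities for powers, exponentials and logarithms *)

Section scalar.
Context {R : realType}.
Implicit Types (x y z a b s : R).

Lemma derive_ge0_le (f g : R -> R) a b : a <= b ->
  (forall x : R, a <= x -> x <= b -> is_derive x (1 : R) f (g x)) ->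
  (forall x, a <= x -> x <= b -> 0 <= g x) -> f a <= f b.
Proof.
move=> ab df g0.
apply: (@ger0_derive1_ndecr R f a b) => //.
- by move=> x; rewrite in_itv/= => /andP[/ltW ax /ltW xb]; have [] := df x ax xb.
- move=> x; rewrite in_itv/= => /andP[/ltW ax /ltW xb].
  by rewrite derive1E; have [_ ->] := df x ax xb; exact: g0.
- apply: derivable_within_continuous => x; rewrite in_itv/= => /andP[ax xb].
  by have [] := df x ax xb.
Qed.

Lemma ln_le_subr1 x : 0 < x -> ln x <= x - 1.
Proof. by move=> x0; have := expR_ge1Dx (ln x); rewrite lnK ?posrE//; lra. Qed.

(** With m = 1 + a (z - 1), the numbers z / m and 1 / m have mean 1 for the weights a and 1 - a;
    averaging ln t <= t - 1 over them gives a ln z <= ln m. *)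
Lemma powR_le_bernoulli z a : 0 < z -> 0 <= a <= 1 -> z `^ a <= 1 + a * (z - 1).
Proof.
move=> z0 /andP[a0 a1]; set m := 1 + _.
have m0 : 0 < m by rewrite /m; nra.
rewrite /powR gt_eqF// -[leRHS]lnK ?posrE// ler_expR.
have h1 := ln_le_subr1 (divr_gt0 z0 m0).
have m1 : 0 < m^-1 by rewrite invr_gt0.
have h2 := ln_le_subr1 m1.
rewrite ln_div ?posrE// in h1; rewrite lnV ?posrE// in h2.
have e : a * (z / m) + (1 - a) * m^-1 = 1.
  rewrite mulrA -mulrDl; rewrite (_ : a * z + (1 - a) = m) ?mulfV ?gt_eqF//.
  by rewrite /m; ring.
have : a * (ln z - ln m) + (1 - a) * - ln m <= a * (z / m - 1) + (1 - a) * (m^-1 - 1).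
  by apply: lerD; apply: ler_wpM2l => //; rewrite subr_ge0.
lra.
Qed.

(** Bernoulli's inequality for the exponent 1 - a bounds the inverse of the power by 1 + u with u =
    (1 - a)(z - 1), and (1 - u)(1 + u) <= 1. *)
Lemma powR_subr1_ge z a : 0 < z -> 0 <= a <= 1 ->
  1 - (1 - a) * (z - 1) <= z `^ (a - 1).
Proof.
move=> z0 /andP[a0 a1].
have b01 : 0 <= 1 - a <= 1 by apply/andP; split; lra.
have h := powR_le_bernoulli z0 b01.
have -> : a - 1 = - (1 - a) by ring.
rewrite powRN; have p0 : 0 < z `^ (1 - a) by rewrite powR_gt0.
rewrite -[leRHS]mul1r ler_pdivlMr//.
case: (lerP 0 (1 - (1 - a) * (z - 1))) => h1; last first.
  by apply: (@le_trans _ _ 0) => //; rewrite mulr_le0_ge0// ltW.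
apply: (le_trans (ler_wpM2l h1 h)).
by have := sqr_ge0 ((1 - a) * (z - 1)); lra.
Qed.

Lemma powR_subr1_le z a : 0 < z -> 0 <= a <= 1 ->
  z `^ (a - 1) <= 1 - (1 - a) * (z - 1) + (1 - a) * (z - 1) ^+ 2 / z.
Proof.
move=> z0 a01; have h := powR_le_bernoulli z0 a01.
rewrite powRB; last by rewrite (gt_eqF z0) implybT.
rewrite powRr1 ?(ltW z0)// ler_pdivrMr//; apply: (le_trans h).
rewrite mulrDl divfK ?gt_eqF// le_eqVlt; apply/orP; left; apply/eqP; ring.
Qed.

Let Q a s := 1 + a * s - a * (1 - a) / 2 * s ^+ 2.

Let dQ a c z : 0 < z -> is_derive z (1 : R)
  (fun z => z `^ a - Q a (z - 1) + c * (z - 1) ^+ 3)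
  (a * z `^ (a - 1) - (a - a * (1 - a) * (z - 1)) + 3 * c * (z - 1) ^+ 2).
Proof.
move=> z0; rewrite /Q; have := is_derive1_powR a z0 => d1.
by apply: is_derive_eq; rewrite /GRing.scale/=; field.
Qed.

(** The derivative of the remainder lies between 0 and a (1 - a)(z - 1)^2 / z, so the remainder has
    the sign of z - 1, and for z >= 1/2 its derivative is dominated by 24 (z - 1)^2, the derivative
    of 8 (z - 1)^3. *)
Lemma powR_taylor z a : 0 < z -> 0 <= a <= 1 ->
  `|z `^ a - (1 + a * (z - 1) - a * (1 - a) / 2 * (z - 1) ^+ 2)| <=
    8 * `|z - 1| ^+ 3.
Proof.
move=> z0 /[dup] a01 /andP[a0 a1]; rewrite -/(Q a (z - 1)).
have Q1 : 1 `^ a - Q a (1 - 1) = 0 by rewrite powR1 /Q; field.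
have aa : 0 <= a * (1 - a) <= 1 by apply/andP; split; nra.
have [z1|z1] := leP 1 z.
  have lo : 0 <= z `^ a - Q a (z - 1).
    have := @derive_ge0_le _ _ _ _ z1
      (fun x h _ => @dQ a 0 x (lt_le_trans ltr01 h)).
    rewrite Q1 !mul0r !addr0; apply => x x1 _; rewrite mulr0 mul0r addr0.
    have := @powR_subr1_ge x a (lt_le_trans ltr01 x1) a01; nra.
  rewrite ger0_norm// ger0_norm ?subr_ge0//.
  have := @derive_ge0_le (fun x => - (x `^ a - Q a (x - 1) + - 8 * (x - 1) ^+ 3)) _ _ _ z1
      (fun x h _ => is_deriveN (@dQ a (- 8) x (lt_le_trans ltr01 h))).
  rewrite Q1 subrr expr0n/= mulr0 addr0 oppr0.
  have mono : forall x : R, 1 <= x -> x <= z ->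
   0 <= - (a * x `^ (a - 1) - (a - a * (1 - a) * (x - 1)) + 3 * -8 * (x - 1) ^+ 2).
    move=> x x1 _; have x0 := lt_le_trans ltr01 x1.
    have := @powR_subr1_le x a x0 a01.
    have : (x - 1) ^+ 2 / x <= (x - 1) ^+ 2.
      by rewrite ler_pdivrMr// ler_peMr// sqr_ge0.
    rewrite -mulrA; set u := (x - 1) ^+ 2 / x; have := sqr_ge0 (x - 1).
    set t := (x - 1) ^+ 2; set P := x `^ _ => t0 ut hP.
    have : a * P <= a * (1 - (1 - a) * (x - 1) + (1 - a) * u) by rewrite ler_wpM2l.
    have : a * (1 - a) * u <= t.
      apply: (@le_trans _ _ (a * (1 - a) * t)).
        by rewrite ler_wpM2l//; case/andP: aa.
      by rewrite ler_piMl//; case/andP: aa.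
    nra.
  by move=> /(_ mono); lra.
have up : z `^ a - Q a (z - 1) <= 0.
  have := @derive_ge0_le _ _ _ _ (ltW z1)
    (fun x h _ => @dQ a 0 x (lt_le_trans z0 h)).
  rewrite Q1 !mul0r !addr0; apply => x zx x1; rewrite mulr0 mul0r addr0.
  have := @powR_subr1_ge x a (lt_le_trans z0 zx) a01; nra.
rewrite ler0_norm// ltr0_norm ?subr_lt0//.
(* Close to 0 the factor 1 / z is unbounded, but there |z - 1|^3 >= 1/8: the constant 8 makes the
   right side at least 1, while the left side is at most the Taylor polynomial, hence at most 1. *)
have [h2|h2] := leP (2^-1) z; last first.
  have zz := powR_ge0 z a.
  have : 1 / 8 <= (- (z - 1)) ^+ 3.
    have -> : 1 / 8 = (2^-1) ^+ 3 :> R by field.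
    by rewrite lerXn2r ?nnegrE//; lra.
  rewrite {1}/Q; case/andP: aa => aa0 aa1.
  have := sqr_ge0 (z - 1); nra.
have := @derive_ge0_le (fun x => - (x `^ a - Q a (x - 1) + - 8 * (x - 1) ^+ 3)) _ _ _ (ltW z1)
    (fun x h _ => is_deriveN (@dQ a (- 8) x (lt_le_trans z0 h))).
rewrite Q1 subrr expr0n/= mulr0 addr0 oppr0.
have mono : forall x : R, z <= x -> x <= 1 ->
   0 <= - (a * x `^ (a - 1) - (a - a * (1 - a) * (x - 1)) + 3 * -8 * (x - 1) ^+ 2).
  move=> x zx _; have x0 := lt_le_trans z0 zx.
  have := @powR_subr1_le x a x0 a01.
  have : (x - 1) ^+ 2 / x <= (x - 1) ^+ 2 * 2.
    have : 2^-1 <= x by exact: le_trans h2 zx.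
    by rewrite ler_pdivrMr// -mulrA ler_peMr ?sqr_ge0//; lra.
  rewrite -mulrA; set u := (x - 1) ^+ 2 / x; have := sqr_ge0 (x - 1).
  set t := (x - 1) ^+ 2; set P := x `^ _ => t0 ut hP.
  have : a * P <= a * (1 - (1 - a) * (x - 1) + (1 - a) * u) by rewrite ler_wpM2l.
  have : a * (1 - a) * u <= t * 2.
    apply: (@le_trans _ _ (a * (1 - a) * (t * 2))).
      by rewrite ler_wpM2l//; case/andP: aa.
    by rewrite ler_piMl//; [lra|case/andP: aa].
  nra.
by move=> /(_ mono); rewrite exprNn; lra.
Qed.

(** Rearranged from (1 - x)(1 + x) exp(x) <= 1 + x, which follows from 1 - x <= exp(- x). *)
Lemma expR_le_quad x : 0 <= x -> expR x <= 1 + x + x ^+ 2 * expR x.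
Proof.
move=> x0; have h := expR_ge1Dx (- x); have e0 := expR_gt0 x.
have : (1 - x) * (1 + x) <= expR (- x) * (1 + x) by rewrite ler_wpM2r//; lra.
rewrite expRN => h1.
have : ((1 - x) * (1 + x)) * expR x <= (expR x)^-1 * (1 + x) * expR x.
  by rewrite ler_wpM2r// ltW.
have -> : (expR x)^-1 * (1 + x) * expR x = 1 + x by field; rewrite gt_eqF.
nra.
Qed.

(** This is what the optimised bound on the exponential moment of a chi variable reduces to.
    Equality holds at 1, and the difference has derivative (1 - u)(1 + u^2) with u = 1 / x. *)
Lemma ln_le_chi x : 1 <= x -> ln x <= x - 2^-1 - x^-1 + 2^-1 * x^-1 ^+ 2.
Proof.
move=> x1.
have := @derive_ge0_le (fun x => x - 2^-1 - x^-1 + 2^-1 * x^-1 ^+ 2 - ln x)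
  (fun x => 1 + x^-1 ^+ 2 - x^-1 ^+ 3 - x^-1) 1 x x1.
have d : forall y : R, 1 <= y -> y <= x -> is_derive y (1 : R)
  (fun x => x - 2^-1 - x^-1 + 2^-1 * x^-1 ^+ 2 - ln x)
  (1 + y^-1 ^+ 2 - y^-1 ^+ 3 - y^-1).
  move=> y y1 _; have y0 : 0 < y by exact: lt_le_trans y1.
  have dl := is_derive1_ln y0.
  have yn : y != 0 by rewrite gt_eqF.
  have dv : is_derive (y : R) (1 : R) (fun x : R => x^-1) (- y ^- 2 *: 1).
    exact: is_deriveV.
  apply: is_derive_eq; rewrite /GRing.scale/=; field.
  exact: yn.
move=> /(_ d).
have p : forall y : R, 1 <= y -> y <= x -> 0 <= 1 + y^-1 ^+ 2 - y^-1 ^+ 3 - y^-1.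
  move=> y y1 _; have y0 : 0 < y by exact: lt_le_trans y1.
  have : y^-1 <= 1 by rewrite invf_le1.
  have : 0 < y^-1 by rewrite invr_gt0.
  set u := y^-1 => u0 u1.
  have -> : 1 + u ^+ 2 - u ^+ 3 - u = (1 - u) * (1 + u ^+ 2) by ring.
  by rewrite mulr_ge0 ?subr_ge0// addr_ge0// sqr_ge0.
move=> /(_ p); rewrite ln1 invr1 expr1n; lra.
Qed.

End scalar.

(** * Averaging along lists of directions *)

Section ops.
Context {R : realType} (N : nat).
Local Notation gmu := (@gmu R).
Implicit Types (f g h : 'rV[R]_N -> R) (x b c d : 'rV[R]_N).

Definition dot b x : R := \sum_i b ord0 i * x ord0 i.

Lemma dotDr b x y : dot b (x + y) = dot b x + dot b y.
Proof.
by rewrite /dot -big_split; apply: eq_bigr => i _; rewrite mxE mulrDr.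
Qed.

Lemma dotZr b a x : dot b (a *: x) = a * dot b x.
Proof.
by rewrite /dot big_distrr; apply: eq_bigr => i _; rewrite mxE mulrCA.
Qed.

Lemma norm_le_l1norm x i : `|x ord0 i| <= l1norm x.
Proof. by rewrite /l1norm (bigD1 i)//= lerDl sumr_ge0. Qed.

Lemma dot_le b x : dot b x <= l1norm b * l1norm x.
Proof.
rewrite /l1norm big_distrl/=; apply: ler_sum => i _.
by rewrite (le_trans (ler_norm _))// normrM ler_wpM2l// norm_le_l1norm.
Qed.

Lemma logLip_exp b : logLip (l1norm b) (fun x => expR (dot b x)).
Proof.
move=> x; split=> [|d]; first exact: expR_ge0.
by rewrite dotDr addrC expRD ler_wpM2r ?expR_ge0// ler_expR dot_le.
Qed.

Lemma logLip_cst L a : 0 <= L -> 0 <= a -> logLip L (fun _ : 'rV[R]_N => a).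
Proof.
move=> L0 a0 x; split=> // d; rewrite ler_peMl//.
by rewrite -expR0 ler_expR mulr_ge0// l1norm_ge0.
Qed.

(* The expectation of [f (x + \sum_(c <- cs) g_c *: c)] for independent standard
   normal variables [g_c]. *)
Definition gsmooths (cs : seq 'rV[R]_N) f := foldr (@gsmooth R N) f cs.

Lemma gsmooths_logLip L f cs : 0 <= L -> logLip L f -> logLip L (gsmooths cs f).
Proof. by move=> L0 hf; elim: cs => //= c cs IH; exact: gsmooth_logLip. Qed.

Lemma gsmooths_le L f g cs x : 0 <= L -> logLip L f -> logLip L g ->
  (forall z, f z <= g z) -> gsmooths cs f x <= gsmooths cs g x.
Proof.
move=> L0 hf hg fg; elim: cs x => //= c cs IH x.
by apply: (gsmooth_le _ _ L0) => //; apply: gsmooths_logLip.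
Qed.

Lemma gsmoothsZ L f a cs : 0 <= L -> 0 <= a -> logLip L f ->
  gsmooths cs (fun z => a * f z) = (fun z => a * gsmooths cs f z).
Proof.
move=> L0 a0 hf; elim: cs => //= c cs ->.
by apply/funext => x; rewrite (gsmoothZ _ _ _ L0)//; exact: gsmooths_logLip.
Qed.

Lemma gsmooth_gsmooths L f c cs : 0 <= L -> logLip L f ->
  gsmooth c (gsmooths cs f) = gsmooths cs (gsmooth c f).
Proof.
move=> L0 hf; elim: cs => //= d cs <-.
by apply/funext => x; rewrite (gsmoothC _ _ _ L0)//; exact: gsmooths_logLip.
Qed.

Lemma gsmoothsC L f cs ds : 0 <= L -> logLip L f ->
  gsmooths cs (gsmooths ds f) = gsmooths ds (gsmooths cs f).
Proof.
move=> L0 hf; elim: cs => //= c cs ->.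
by apply: (gsmooth_gsmooths _ _ L0); exact: gsmooths_logLip.
Qed.

Lemma gsmooths_half L f cs : 0 <= L -> logLip L f ->
  gsmooths (map ( *:%R (Num.sqrt 2)^-1) cs) (gsmooths (map ( *:%R (Num.sqrt 2)^-1) cs) f)
  = gsmooths cs f.
Proof.
move=> L0 hf; elim: cs => //= c cs IH.
set s := _^-1; rewrite -/s in IH.
rewrite -(gsmooth_gsmooths _ _ L0); last exact: gsmooths_logLip.
rewrite IH; apply/funext => x; rewrite (gsmooth_half _ _ L0)//; exact: gsmooths_logLip.
Qed.

(** Log-Lipschitz functions form only a cone. Their differences form a vector space on which
    averaging is linear and monotone, as required by test polynomials with negative coefficients. *)
Definition logLip_diff f := exists2 L, 0 <= L &
  exists g h, [/\ logLip L g, logLip L h & f = (fun x => g x - h x)].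

Lemma gsmoothB L g h c x : 0 <= L -> logLip L g -> logLip L h ->
  gsmooth c (fun z => g z - h z) x = gsmooth c g x - gsmooth c h x.
Proof.
move=> L0 hf hg; rewrite /gsmooth RintegralB//.
- exact: logLip_line_integrable hf.
- exact: logLip_line_integrable hg.
Qed.

Lemma gsmoothsB L g h cs : 0 <= L -> logLip L g -> logLip L h ->
  gsmooths cs (fun z => g z - h z) = fun x => gsmooths cs g x - gsmooths cs h x.
Proof.
move=> L0 hg hh; elim: cs => //= c cs ->; apply/funext => x.
by apply: (gsmoothB _ _ L0); exact: gsmooths_logLip.
Qed.

Lemma gsmoothsD L g h cs : 0 <= L -> logLip L g -> logLip L h ->
  gsmooths cs (fun z => g z + h z) = fun x => gsmooths cs g x + gsmooths cs h x.
Proof.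
move=> L0 hg hh; elim: cs => //= c cs ->; apply/funext => x.
by apply: (gsmoothD _ _ L0); exact: gsmooths_logLip.
Qed.

Lemma logLip_diff_logLip L f : 0 <= L -> logLip L f -> logLip_diff f.
Proof.
move=> L0 hf; exists L => //; exists f, (fun _ => 0).
split; [exact: hf|exact: logLip_cst|].
by apply/funext => x; rewrite subr0.
Qed.

Lemma logLip_diffD f g : logLip_diff f -> logLip_diff g ->
  logLip_diff (fun x => f x + g x) /\
  forall cs, gsmooths cs (fun x => f x + g x) = fun x => gsmooths cs f x + gsmooths cs g x.
Proof.
move=> [L L0 [f1 [f2 [hf1 hf2 ->]]]] [K K0 [g1 [g2 [hg1 hg2 ->]]]].
have M0 : 0 <= Num.max L K by rewrite le_max L0.
have LM : L <= Num.max L K by rewrite le_max lexx.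
have KM : K <= Num.max L K by rewrite le_max lexx orbT.
move/(logLip_weaken LM) in hf1; move/(logLip_weaken LM) in hf2.
move/(logLip_weaken KM) in hg1; move/(logLip_weaken KM) in hg2.
have h1 := logLip_D hf1 hg1; have h2 := logLip_D hf2 hg2.
have E : (fun x => f1 x - f2 x + (g1 x - g2 x)) =
         (fun x => f1 x + g1 x - (f2 x + g2 x)).
  by apply/funext => x; ring.
split.
  exists (Num.max L K) => //.
  by exists (fun x => f1 x + g1 x), (fun x => f2 x + g2 x).
move=> cs; rewrite E (gsmoothsB _ M0)// (gsmoothsD _ M0)// (gsmoothsD _ M0)//.
rewrite (gsmoothsB _ M0)// (gsmoothsB _ M0)//; apply/funext => x; ring.
Qed.

Lemma logLip_diffN f : logLip_diff f -> logLip_diff (fun x => - f x) /\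
  forall cs, gsmooths cs (fun x => - f x) = fun x => - gsmooths cs f x.
Proof.
move=> [L L0 [f1 [f2 [hf1 hf2 ->]]]].
have E : (fun x => - (f1 x - f2 x)) = (fun x => f2 x - f1 x).
  by apply/funext => x; ring.
split; first by exists L => //; exists f2, f1.
move=> cs; rewrite E (gsmoothsB _ L0)// (gsmoothsB _ L0)//; apply/funext => x; ring.
Qed.

Lemma logLip_diffZ a f : logLip_diff f -> logLip_diff (fun x => a * f x) /\
  forall cs, gsmooths cs (fun x => a * f x) = fun x => a * gsmooths cs f x.
Proof.
wlog a0 : a / 0 <= a => [hw|] hf.
  have [/hw/(_ hf)//|/ltW a0] := leP 0 a.
  have na0 : 0 <= - a by rewrite oppr_ge0.
  have [h1 h2] := hw _ na0 hf; have [h3 h4] := logLip_diffN h1.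
  have E : (fun x => a * f x) = (fun x => - (- a * f x)).
    by apply/funext => x; ring.
  rewrite E; split=> // cs; rewrite h4 h2; apply/funext => x; ring.
move: hf => [L L0 [f1 [f2 [hf1 hf2 ->]]]].
have h1 := logLip_Z a0 hf1; have h2 := logLip_Z a0 hf2.
have E : (fun x => a * (f1 x - f2 x)) = (fun x => a * f1 x - a * f2 x).
  by apply/funext => x; ring.
split.
  by exists L => //; exists (fun x => a * f1 x), (fun x => a * f2 x).
move=> cs; rewrite E (gsmoothsB _ L0)// (gsmoothsB _ L0)// (gsmoothsZ _ L0)// (gsmoothsZ _ L0)//.
by apply/funext => x; ring.
Qed.

Lemma logLip_diff_cst a : logLip_diff (fun=> a) /\ forall cs, gsmooths cs (fun=> a) = fun=> a.
Proof.
have g1 cs : gsmooths cs (fun=> 1) = fun=> 1.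
  elim: cs => //= c cs ->; apply/funext => x.
  rewrite /gsmooth Rintegral_cst//; set u := fine _.
  have -> : u = 1 by rewrite /u [X in fine X](@probability_setT _ _ _ gmu).
  by rewrite mulr1.
have [h1 h2] := @logLip_diffZ a (fun=> 1) (logLip_diff_logLip (lexx 0) (logLip_cst (lexx 0) ler01)).
have E : (fun=> a) = (fun=> a * 1) :> ('rV[R]_N -> R).
  by apply/funext => x; rewrite mulr1.
by rewrite E; split=> // cs; rewrite h2 g1.
Qed.

Lemma logLip_diff_sum (I : Type) (r : seq I) (F : I -> 'rV[R]_N -> R) :
  (forall i, logLip_diff (F i)) -> logLip_diff (fun x => \sum_(i <- r) F i x) /\
  forall cs, gsmooths cs (fun x => \sum_(i <- r) F i x) =
    fun x => \sum_(i <- r) gsmooths cs (F i) x.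
Proof.
move=> hF; elim: r => [|i r [h1 h2]].
  have E : (fun x => \sum_(i <- [::]) F i x) = fun=> 0.
    by apply/funext => x; rewrite big_nil.
  rewrite E; have [h1 h2] := logLip_diff_cst 0; split=> // cs.
  by rewrite h2; apply/funext => x; rewrite big_nil.
have E : (fun x => \sum_(j <- i :: r) F j x) =
  fun x => F i x + \sum_(j <- r) F j x.
  by apply/funext => x; rewrite big_cons.
rewrite E; have [h3 h4] := logLip_diffD (hF i) h1; split=> // cs.
by rewrite h4 h2; apply/funext => x; rewrite big_cons.
Qed.

Lemma gsmooths_logLip_diff_le f g cs x : logLip_diff f -> logLip_diff g -> (forall z, f z <= g z) ->
  gsmooths cs f x <= gsmooths cs g x.
Proof.
move=> [L L0 [f1 [f2 [hf1 hf2 ->]]]] [K K0 [g1 [g2 [hg1 hg2 ->]]]] fg.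
have M0 : 0 <= Num.max L K by rewrite le_max L0.
have LM : L <= Num.max L K by rewrite le_max lexx.
have KM : K <= Num.max L K by rewrite le_max lexx orbT.
move/(logLip_weaken LM) in hf1; move/(logLip_weaken LM) in hf2.
move/(logLip_weaken KM) in hg1; move/(logLip_weaken KM) in hg2.
rewrite (gsmoothsB _ M0)// (gsmoothsB _ M0)// lerBlDr addrAC lerBrDr.
have := @gsmooths_le _ _ _ cs x M0 (logLip_D hf1 hg2) (logLip_D hg1 hf2).
rewrite (gsmoothsD _ M0)// (gsmoothsD _ M0)//; apply => z.
by have := fg z; lra.
Qed.

Lemma gsmooths_exp cs b : gsmooths cs (fun x => expR (dot b x)) =
  fun x => expR ((\sum_(c <- cs) dot b c ^+ 2) / 2) * expR (dot b x).
Proof.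
elim: cs => [|c cs IH] /=.
  by apply/funext => x; rewrite big_nil mul0r expR0 mul1r.
rewrite IH; apply/funext => x.
rewrite (gsmoothZ _ _ _ (l1norm_ge0 b)); last exact: logLip_exp.
rewrite big_cons mulrDl [in RHS]addrC [in RHS]expRD -mulrA; congr (_ * _).
rewrite /gsmooth; transitivity (\int[gmu]_y (expR (dot b x) * expR (dot b c * y)))%R.
  by congr fine; apply: eq_integral => y _; rewrite dotDr dotZr expRD [y * _]mulrC.
rewrite RintegralZl//; last exact: gauss_integrable_exp.
by rewrite mulrC; congr (_ * _); rewrite /Rintegral gauss_mgf.
Qed.

Lemma logLip_diff_exp b : logLip_diff (fun x => expR (dot b x)).
Proof. exact: logLip_diff_logLip (l1norm_ge0 b) (logLip_exp b). Qed.

End ops.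

(** * Slepian's comparison for the soft maximum *)

Section slepian.
Context {R : realType} (N : nat).
Implicit Types (f g : 'rV[R]_N -> R) (x b c : 'rV[R]_N) (cs : seq 'rV[R]_N).

(** Pairing membership with the averaged value gives a relation closed under linear combinations, so
    a test polynomial is averaged by following its syntax. *)
Definition smooths_to cs x f (v : R) := logLip_diff f /\ gsmooths cs f x = v.

Lemma smooths_to_D cs x f g v w : smooths_to cs x f v -> smooths_to cs x g w ->
  smooths_to cs x (fun z => f z + g z) (v + w).
Proof. by move=> [hf <-] [hg <-]; have [h1 h2] := logLip_diffD hf hg; split=> //; rewrite h2. Qed.

Lemma smooths_to_N cs x f v : smooths_to cs x f v -> smooths_to cs x (fun z => - f z) (- v).
Proof. by move=> [hf <-]; have [h1 h2] := logLip_diffN hf; split=> //; rewrite h2. Qed.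

Lemma smooths_to_Z cs x f a v : smooths_to cs x f v -> smooths_to cs x (fun z => a * f z) (a * v).
Proof. by move=> [hf <-]; have [h1 h2] := logLip_diffZ a hf; split=> //; rewrite h2. Qed.

Lemma smooths_to_cst cs x a : smooths_to cs x (fun=> a) a.
Proof. by have [h1 h2] := @logLip_diff_cst R N a; split=> //; rewrite h2. Qed.

Lemma smooths_to_sum cs x (I : Type) (r : seq I) (F : I -> 'rV[R]_N -> R) v :
  (forall i, smooths_to cs x (F i) (v i)) ->
  smooths_to cs x (fun z => \sum_(i <- r) F i z) (\sum_(i <- r) v i).
Proof.
move=> h; have [h1 h2] := logLip_diff_sum r (fun i => (h i).1).
by split=> //; rewrite h2; apply: eq_bigr => i _; exact: (h i).2.
Qed.

Lemma smooths_to_exp cs x b :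
  smooths_to cs x (fun z => expR (dot b (z - x))) (expR ((\sum_(c <- cs) dot b c ^+ 2) / 2)).
Proof.
have E : (fun z => expR (dot b (z - x))) =
    (fun z => expR (- dot b x) * expR (dot b z)).
  apply/funext => z; rewrite -expRD; congr expR.
  by rewrite dotDr -scaleN1r dotZr mulN1r addrC.
rewrite E; have [h1 h2] := logLip_diffZ (expR (- dot b x)) (logLip_diff_exp b).
split=> //; rewrite h2 gsmooths_exp mulrCA -expRD addNr expR0 mulr1 //.
Qed.

(* Covariances of the coordinates of [\sum_(c <- cs) g_c *: c]. *)
Definition cov_of cs (i j : 'I_N) : R := \sum_(c <- cs) c ord0 i * c ord0 j.

Lemma dotZl a b x : dot (a *: b) x = a * dot b x.
Proof. by rewrite /dot big_distrr; apply: eq_bigr => j _; rewrite mxE -mulrA. Qed.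

Lemma dotDl b b' x : dot (b + b') x = dot b x + dot b' x.
Proof. by rewrite /dot -big_split; apply: eq_bigr => l _; rewrite mxE mulrDl. Qed.

Variable beta : R.
Let bv i : 'rV[R]_N := beta *: delta_mx ord0 i.

Lemma dot_delta i z : dot (bv i) z = beta * z ord0 i.
Proof.
rewrite /dot (bigD1 i)//= big1 => [|j ji]; last first.
  by rewrite !mxE eqxx (negbTE ji) mulr0 mul0r.
by rewrite !mxE !eqxx mulr1 addr0.
Qed.

(** The factor gained by the i-th summand of [sum_exp] when x moves to z. Its powers and pairwise
    products are exponentials of linear forms, so their Gaussian means are explicit. *)
Let r x i (z : 'rV[R]_N) := expR (beta * (z ord0 i - x ord0 i)).

Lemma smooths_to_rX cs x i k :
  smooths_to cs x (fun z => r x i z ^+ k)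
    (expR (k%:R ^+ 2 * (beta ^+ 2 * cov_of cs i i / 2))).
Proof.
have E : (fun z => r x i z ^+ k) = (fun z => expR (dot (k%:R *: bv i) (z - x))).
  apply/funext => z; rewrite /r -expRM_natl; congr expR.
  by rewrite dotZl dot_delta !mxE.
rewrite E; have := smooths_to_exp cs x (k%:R *: bv i).
congr smooths_to; congr expR; rewrite /cov_of !mulrA; congr (_ / _).
rewrite big_distrr/=; apply: eq_bigr => c _.
rewrite dotZl dot_delta; ring.
Qed.

Lemma smooths_to_rr cs x i j :
  smooths_to cs x (fun z => r x i z * r x j z)
   (expR (beta ^+ 2 * (cov_of cs i i + cov_of cs j j + 2 * cov_of cs i j) / 2)).
Proof.
have -> : (fun z => r x i z * r x j z) =
    (fun z => expR (dot (bv i + bv j) (z - x))).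
  apply/funext => z; rewrite /r -expRD; congr expR.
  by rewrite dotDl !dot_delta !mxE.
have := smooths_to_exp cs x (bv i + bv j).
congr smooths_to; congr expR; congr (_ / _).
rewrite /cov_of [2 * _]big_distrr/= -!big_split/= big_distrr/=.
apply: eq_bigr => c _; rewrite dotDl !dot_delta; ring.
Qed.

Lemma jensen_sqr (p t : 'I_N -> R) : (forall i, 0 <= p i) -> \sum_i p i = 1 ->
  (\sum_i p i * t i) ^+ 2 <= \sum_i p i * t i ^+ 2.
Proof.
move=> p0 p1; set T := \sum_i p i * t i.
have : 0 <= \sum_i p i * (t i - T) ^+ 2.
  by apply: sumr_ge0 => i _; rewrite mulr_ge0// sqr_ge0.
have E (u : R) : \sum_i p i * (t i - u) ^+ 2 =
    \sum_i p i * t i ^+ 2 - 2 * u * (\sum_i p i * t i) + u ^+ 2 * \sum_i p i.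
  rewrite !big_distrr/= -sumrN -!big_split/=; apply: eq_bigr => i _; ring.
rewrite E -/T p1; lra.
Qed.

(* The test polynomial bracketing [Z `^ a] for [Z = \sum_i p i * r i]. *)
Let PT (a s e : R) (p m1 m2 m3 m4 : 'I_N -> R) (m11 : 'I_N -> 'I_N -> R) : R :=
  1 + a * (\sum_i p i * m1 i - 1)
  - a * (1 - a) / 2 *
    (\sum_i \sum_j (p i * p j) * m11 i j - 2 * (\sum_i p i * m1 i) + 1)
  + s * (e * (\sum_i p i * (m2 i - 2 * m1 i + 1))
         + e^-1 * (\sum_i p i * (m4 i - 4 * m3 i + 6 * m2 i - 4 * m1 i + 1))).

(** [PT] is affine in its moment arguments, so the same expression serves before and after
    averaging. The factors 1, 4, 9, 16 are the squares k^2 in the mean exp(k^2 w) of the k-th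
    power. *)
Let smooths_to_PT cs x a s e p :
  let w i := beta ^+ 2 * cov_of cs i i / 2 in
  smooths_to cs x
   (fun z => PT a s e p (fun i => r x i z ^+ 1) (fun i => r x i z ^+ 2)
      (fun i => r x i z ^+ 3) (fun i => r x i z ^+ 4)
      (fun i j => r x i z * r x j z))
   (PT a s e p (fun i => expR (w i)) (fun i => expR (4 * w i))
      (fun i => expR (9 * w i)) (fun i => expR (16 * w i))
      (fun i j => expR
        (beta ^+ 2 * (cov_of cs i i + cov_of cs j j + 2 * cov_of cs i j) / 2))).
Proof.
move=> w.
have h1 i : smooths_to cs x (fun z => r x i z ^+ 1) (expR (w i)).
  by have := smooths_to_rX cs x i 1; rewrite expr1n mul1r.
have h2 i : smooths_to cs x (fun z => r x i z ^+ 2) (expR (4 * w i)).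
  by have := smooths_to_rX cs x i 2; rewrite (_ : 2%:R ^+ 2 = 4)//; ring.
have h3 i : smooths_to cs x (fun z => r x i z ^+ 3) (expR (9 * w i)).
  by have := smooths_to_rX cs x i 3; rewrite (_ : 3%:R ^+ 2 = 9)//; ring.
have h4 i : smooths_to cs x (fun z => r x i z ^+ 4) (expR (16 * w i)).
  by have := smooths_to_rX cs x i 4; rewrite (_ : 4%:R ^+ 2 = 16)//; ring.
rewrite /PT.
have s1 : smooths_to cs x (fun z => \sum_i p i * r x i z ^+ 1) (\sum_i p i * expR (w i)).
  by apply: smooths_to_sum => i; apply: smooths_to_Z.
apply: smooths_to_D; first apply: smooths_to_D; first apply: smooths_to_D.
- exact: smooths_to_cst.
- by apply: smooths_to_Z; apply: smooths_to_D => //; exact: smooths_to_cst.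
- apply: smooths_to_N; apply: smooths_to_Z; apply: smooths_to_D; last exact: smooths_to_cst.
  apply: smooths_to_D; last by apply: smooths_to_N; apply: smooths_to_Z.
  by apply: smooths_to_sum => i; apply: smooths_to_sum => j; apply: smooths_to_Z; exact: smooths_to_rr.
- apply: smooths_to_Z; apply: smooths_to_D; apply: smooths_to_Z; apply: smooths_to_sum => i; apply: smooths_to_Z.
    apply: smooths_to_D; last exact: smooths_to_cst.
    by apply: smooths_to_D => //; apply: smooths_to_N; exact: smooths_to_Z.
  apply: smooths_to_D; last exact: smooths_to_cst.
  apply: smooths_to_D; last by apply: smooths_to_N; exact: smooths_to_Z.
  apply: smooths_to_D; last exact: smooths_to_Z.
  by apply: smooths_to_D => //; apply: smooths_to_N; exact: smooths_to_Z.
Qed.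

Let PT_bound (a e : R) (p t : 'I_N -> R) : 0 <= a <= 1 -> 0 < e ->
  (forall i, 0 <= p i) -> \sum_i p i = 1 -> (forall i, 0 < t i) ->
  let P s := PT a s e p (fun i => t i ^+ 1) (fun i => t i ^+ 2)
      (fun i => t i ^+ 3) (fun i => t i ^+ 4) (fun i j => t i * t j) in
  P (- 4) <= (\sum_i p i * t i) `^ a /\ (\sum_i p i * t i) `^ a <= P 4.
Proof.
move=> a01 e0 p0 p1 t0 P.
set Z := \sum_i p i * t i.
have Z0 : 0 < Z.
  rewrite lt_neqAle sumr_ge0 ?andbT; last first.
    by move=> i _; rewrite mulr_ge0// ltW.
  apply/negP => /eqP/esym Z0.
  have : \sum_i p i = 0.
    apply: big1 => i _.
    have /eqP := @psumr_eq0P _ _ predT (fun j => p j * t j) (fun j _ => mulr_ge0 (p0 j) (ltW (t0 j))) Z0 i isT.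
    by rewrite mulf_eq0 (gt_eqF (t0 i)) orbF => /eqP.
  by rewrite p1 => /eqP; rewrite oner_eq0.
pose s := Z - 1.
have sE : s = \sum_i p i * (t i - 1).
  rewrite /s /Z -[in LHS]p1 -sumrB; apply: eq_bigr => i _; ring.
have E2 : \sum_i p i * (t i ^+ 2 - 2 * t i ^+ 1 + 1) = \sum_i p i * (t i - 1) ^+ 2.
  by apply: eq_bigr => i _; ring.
have E4 : \sum_i p i * (t i ^+ 4 - 4 * t i ^+ 3 + 6 * t i ^+ 2 - 4 * t i ^+ 1 + 1)
    = \sum_i p i * (t i - 1) ^+ 4.
  by apply: eq_bigr => i _; ring.
have ZZ : \sum_i \sum_j p i * p j * (t i * t j) = Z ^+ 2.
  rewrite /Z expr2 big_distrl/=; apply: eq_bigr => i _.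
  by rewrite big_distrr/=; apply: eq_bigr => j _; ring.
have J2 : s ^+ 2 <= \sum_i p i * (t i - 1) ^+ 2.
  by rewrite sE; exact: jensen_sqr.
have J4 : s ^+ 4 <= \sum_i p i * (t i - 1) ^+ 4.
  have -> : s ^+ 4 = (s ^+ 2) ^+ 2 by ring.
  apply: (@le_trans _ _ ((\sum_i p i * (t i - 1) ^+ 2) ^+ 2)).
    by rewrite lerXn2r ?nnegrE ?sqr_ge0// (le_trans (sqr_ge0 s) J2).
  apply: (le_trans (jensen_sqr _ p0 p1)); apply: ler_sum => i _.
  by rewrite ler_wpM2l// le_eqVlt; apply/orP; left; apply/eqP; ring.
have PE S : P S = 1 + a * s - a * (1 - a) / 2 * s ^+ 2
   + S * (e * (\sum_i p i * (t i - 1) ^+ 2) + e^-1 * (\sum_i p i * (t i - 1) ^+ 4)).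
  rewrite /P /PT E2 E4 ZZ /s.
  have -> : \sum_i p i * t i ^+ 1 = Z by [].
  ring.
(* The cubic Taylor error is not a polynomial in the ratios. Expanding (e - |s|)^2 >= 0 trades it
   for even powers, and 8 |s|^3 becomes 4 (e s^2 + s^4 / e), whence the two coefficients 4 and - 4.
   Both terms are of order e^3 when s is of order e. *)
have s3 : 2 * `|s| ^+ 3 <= e * s ^+ 2 + e^-1 * s ^+ 4.
  have e1 : 0 < e^-1 by rewrite invr_gt0.
  have := mulr_ge0 (ltW e1) (mulr_ge0 (sqr_ge0 s) (sqr_ge0 (e - `|s|))).
  have -> : s ^+ 4 = (`|s| ^+ 2) ^+ 2 by rewrite real_normK ?num_real//; ring.
  have -> : s ^+ 2 = `|s| ^+ 2 by rewrite real_normK ?num_real.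
  set u := `|s|.
  have -> : e^-1 * (u ^+ 2 * (e - u) ^+ 2) =
     e * u ^+ 2 + e^-1 * (u ^+ 2) ^+ 2 - 2 * u ^+ 3.
    by field; rewrite gt_eqF.
  lra.
have := powR_taylor Z0 a01; rewrite -/s ler_norml !PE => /andP[h1 h2].
have h3 : e * s ^+ 2 <= e * \sum_i p i * (t i - 1) ^+ 2.
  by rewrite ler_wpM2l// ltW.
have h4 : e^-1 * s ^+ 4 <= e^-1 * \sum_i p i * (t i - 1) ^+ 4.
  by rewrite ler_wpM2l// invr_ge0 ltW.
by split; lra.
Qed.


Definition moment_cst : R := 400 * expR 16.

Lemma moment_cst_ge0 : 0 <= moment_cst.
Proof. by apply: mulr_ge0; [exact: ler0n|exact: expR_ge0]. Qed.

(** These are the means of (r - 1)^2 and (r - 1)^4. In the second one the constant and linear terms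
    in w cancel, and the quadratic remainders add up to (256 + 6 * 16) exp(16) w^2, below
    [moment_cst]. *)
Lemma gauss_moment_bounds (w : R) : 0 <= w <= 1 ->
  expR (4 * w) - 2 * expR w + 1 <= moment_cst * w /\
  expR (16 * w) - 4 * expR (9 * w) + 6 * expR (4 * w) - 4 * expR w + 1
    <= moment_cst * w ^+ 2.
Proof.
move=> /andP[w0 w1].
have k1 : 1 <= expR (16 : R) by rewrite -expR0 ler_expR.
have q (c : R) : 0 <= c -> c <= 16 -> expR (c * w) <= 1 + c * w + (c * w) ^+ 2 * expR 16.
  move=> c0 c1; apply: (le_trans (expR_le_quad (mulr_ge0 c0 w0))).
  rewrite lerD2l ler_wpM2l ?sqr_ge0// ler_expR.
  by rewrite -[leRHS]mulr1 ler_pM.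
have l (c : R) : 1 + c * w <= expR (c * w) by exact: expR_ge1Dx.
have q4 := q 4 ltac:(lra) ltac:(lra).
have q16 := q 16 ltac:(lra) ltac:(lra).
have l1 := expR_ge1Dx w; have l9 := l 9.
have w2 : w ^+ 2 <= w by rewrite expr2 ler_piMr.
have w20 := sqr_ge0 w.
have kw : w ^+ 2 * expR 16 <= w * expR 16 by rewrite ler_wpM2r// expR_ge0.
have kw2 : w <= w * expR 16 by rewrite ler_peMr.
have kw3 : 0 <= w ^+ 2 * expR 16 by rewrite mulr_ge0// expR_ge0.
have e4 : (4 * w) ^+ 2 * expR 16 = 16 * (w ^+ 2 * expR 16) by ring.
have e16 : (16 * w) ^+ 2 * expR 16 = 256 * (w ^+ 2 * expR 16) by ring.
rewrite e4 in q4; rewrite e16 in q16.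
rewrite /moment_cst -!mulrA ![expR 16 * _]mulrC; split; lra.
Qed.

Hypothesis N0 : (0 < N)%N.
Hypothesis beta0 : 0 <= beta.
Variable a : R.
Hypothesis a01 : 0 <= a <= 1.

(* With [beta = l / a], the function [soft_max] lies between [expR (l * M)] and
   [N%:R `^ a * expR (l * M)], where M is the largest coordinate of x. *)
Definition sum_exp x : R := \sum_i expR (beta * x ord0 i).
Definition soft_max x : R := sum_exp x `^ a.

Lemma sum_exp_gt0 x : 0 < sum_exp x.
Proof.
rewrite /sum_exp (bigD1 (Ordinal N0))//= ltr_wpDr ?expR_gt0//.
by apply: sumr_ge0 => i _; exact: expR_ge0.
Qed.

Lemma soft_max_gt0 x : 0 < soft_max x.
Proof. by rewrite powR_gt0// sum_exp_gt0. Qed.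

Lemma logLip_soft_max : logLip (beta * a) soft_max.
Proof.
move=> x; split=> [|d]; first exact: powR_ge0.
have a0 : 0 <= a by case/andP: a01.
have h : sum_exp (x + d) <= expR (beta * l1norm d) * sum_exp x.
  rewrite /sum_exp big_distrr; apply: ler_sum => i _; rewrite mxE mulrDr addrC expRD.
  rewrite ler_wpM2r ?expR_ge0// ler_expR ler_wpM2l//.
  by rewrite (le_trans (ler_norm _))// norm_le_l1norm.
apply: (le_trans (ge0_ler_powR a0 _ _ h)).
- by rewrite nnegrE ltW// sum_exp_gt0.
- by rewrite nnegrE mulr_ge0 ?expR_ge0// ltW// sum_exp_gt0.
- rewrite powRM ?expR_ge0//; last by rewrite ltW// sum_exp_gt0.
  by rewrite -expRM mulrAC.
Qed.

Lemma logLip_soft_max_ge0 : 0 <= beta * a.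
Proof. by rewrite mulr_ge0//; case/andP: a01. Qed.

(** Gibbs weights at x: relative to its value at x, [soft_max] is the power a of the mean of the
    ratios [r] under these weights. *)
Let p x i := expR (beta * x ord0 i) / sum_exp x.

Let p_ge0 x i : 0 <= p x i.
Proof. by rewrite divr_ge0 ?expR_ge0// ltW// sum_exp_gt0. Qed.

Let p_sum1 x : \sum_i p x i = 1.
Proof. by rewrite /p -mulr_suml divff// gt_eqF// sum_exp_gt0. Qed.

Let soft_max_ratio x z : soft_max z = soft_max x * (\sum_i p x i * r x i z) `^ a.
Proof.
have S0 := sum_exp_gt0 x.
have q0 : 0 <= \sum_i p x i * r x i z.
  by apply: sumr_ge0 => i _; rewrite mulr_ge0 ?expR_ge0.
rewrite /soft_max -powRM//; last by rewrite ltW.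
congr (_ `^ a); rewrite /sum_exp big_distrr/=; apply: eq_bigr => i _.
rewrite /p -/(sum_exp x) mulrA mulrCA divff ?gt_eqF// mulr1 /r -expRD.
by congr expR; ring.
Qed.

Lemma cov_of_le cs i j : cov_of cs i j <= (cov_of cs i i + cov_of cs j j) / 2.
Proof.
rewrite ler_pdivlMr// /cov_of mulr_suml -big_split/=; apply: ler_sum => c _.
have := sqr_ge0 (c ord0 i - c ord0 j); nra.
Qed.

(* For increments of size e the second-order expansion of [soft_max] is exact up
   to [e ^+ 3], while an interpolation needs only [e ^- 2] such steps. *)
Lemma gauss_step (cX cY : seq 'rV[R]_N) (W e : R) x :
  (forall i, cov_of cX i i = cov_of cY i i) ->
  (forall i j, cov_of cY i j <= cov_of cX i j) ->
  0 < e -> 0 <= W -> e ^+ 2 * W <= 1 ->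
  (forall i, beta ^+ 2 * cov_of cY i i / 2 <= e ^+ 2 * W) ->
  let D := 8 * moment_cst * (W + W ^+ 2) * e ^+ 3 in
  gsmooths cX soft_max x <= gsmooths cY soft_max x + D * soft_max x /\
  (1 - moment_cst * W * e ^+ 2 - D) * soft_max x <= gsmooths cY soft_max x.
Proof.
move=> covE cov_le e0 W0 eW wW D.
have F0 := soft_max_gt0 x.
pose w i := beta ^+ 2 * cov_of cY i i / 2.
have w0 i : 0 <= w i.
  rewrite /w !mulr_ge0 ?sqr_ge0 ?invr_ge0//.
  by apply: sumr_ge0 => c _; rewrite -expr2 sqr_ge0.
pose uu cs i j := expR (beta ^+ 2 * (cov_of cs i i + cov_of cs j j + 2 * cov_of cs i j) / 2).
pose V cs S := PT a S e (p x) (fun i => expR (w i)) (fun i => expR (4 * w i))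
      (fun i => expR (9 * w i)) (fun i => expR (16 * w i)) (uu cs).
have tF : logLip_diff soft_max by exact: logLip_diff_logLip logLip_soft_max_ge0 logLip_soft_max.
have hV cs S : (forall i, cov_of cs i i = cov_of cY i i) -> smooths_to cs x
   (fun z => soft_max x * PT a S e (p x) (fun i => r x i z ^+ 1) (fun i => r x i z ^+ 2)
      (fun i => r x i z ^+ 3) (fun i => r x i z ^+ 4)
      (fun i j => r x i z * r x j z)) (soft_max x * V cs S).
  move=> hcs; apply: smooths_to_Z; have := smooths_to_PT cs x a S e (p x); rewrite /V /w.
  by under [fun i => expR (_ * cov_of cs i i / 2)]eq_fun do rewrite hcs;
   under [fun i => expR (4 * _)]eq_fun do rewrite hcs;
   under [fun i => expR (9 * _)]eq_fun do rewrite hcs;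
   under [fun i => expR (16 * _)]eq_fun do rewrite hcs.
have bnd z := @PT_bound a e (p x) (fun i => r x i z) a01 e0 (p_ge0 x) (p_sum1 x)
  (fun i => expR_gt0 _).
have up : gsmooths cX soft_max x <= soft_max x * V cX 4.
  have [h1 h2] := hV cX 4 covE; rewrite -[leRHS]h2; apply: gsmooths_logLip_diff_le tF h1 _ => z.
  by rewrite (soft_max_ratio x z) ler_wpM2l ?(ltW F0)//; case: (bnd z).
have lo : soft_max x * V cY (- 4) <= gsmooths cY soft_max x.
  have [h1 h2] := hV cY (- 4) (fun=> erefl); rewrite -[leLHS]h2; apply: gsmooths_logLip_diff_le h1 tF _ => z.
  by rewrite (soft_max_ratio x z) ler_wpM2l ?(ltW F0)//; case: (bnd z).
set A2 := \sum_i p x i * (expR (4 * w i) - 2 * expR (w i) + 1).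
set A4 := \sum_i p x i * (expR (16 * w i) - 4 * expR (9 * w i) + 6 * expR (4 * w i)
   - 4 * expR (w i) + 1).
have k0 := moment_cst_ge0; set k := moment_cst in k0 D *.
have wle i : 0 <= w i <= 1 by rewrite w0 (le_trans (wW i)).
have hA2 : A2 <= k * W * e ^+ 2.
  rewrite -[leRHS]mul1r -(p_sum1 x) mulr_suml; apply: ler_sum => i _.
  rewrite ler_wpM2l//; apply: (le_trans (gauss_moment_bounds (wle i)).1).
  by rewrite -/k -mulrA ler_wpM2l// mulrC wW.
have hA4 : A4 <= k * W ^+ 2 * e ^+ 4.
  rewrite -[leRHS]mul1r -(p_sum1 x) mulr_suml; apply: ler_sum => i _.
  rewrite ler_wpM2l//; apply: (le_trans (gauss_moment_bounds (wle i)).2).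
  rewrite -/k -mulrA ler_wpM2l//.
  have -> : W ^+ 2 * e ^+ 4 = (e ^+ 2 * W) ^+ 2 by ring.
  by rewrite lerXn2r ?nnegrE ?(le_trans (w0 i) (wW i)) ?wW.
pose Q cs := \sum_i \sum_j (p x i * p x j) * uu cs i j.
(* The only place where the order of the covariances enters. The mixed moments have the coefficient
   - a (1 - a) / 2 in [PT], so larger covariances lower the value. *)
have hQ : Q cY <= Q cX.
  apply: ler_sum => i _; apply: ler_sum => j _.
  rewrite ler_wpM2l ?(mulr_ge0 (p_ge0 x i) (p_ge0 x j))// /uu ler_expR ler_wpM2r ?invr_ge0//.
  by rewrite ler_wpM2l ?sqr_ge0// !covE lerD2l ler_wpM2l.
set z1 := \sum_i p x i * expR (w i).
(* For the lower bound the whole second-order term must be small. The covariance is at most the mean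
   of the variances, so the mixed moments are dominated by the diagonal ones. *)
have hQ2 : Q cY <= \sum_i p x i * expR (4 * w i).
  have uub i j : uu cY i j <= (expR (4 * w i) + expR (4 * w j)) / 2.
    apply: (@le_trans _ _ (expR (2 * w i) * expR (2 * w j))).
      rewrite -expRD ler_expR /w.
      have := ler_wpM2l (sqr_ge0 beta) (cov_of_le cY i j); lra.
    have e4 t : expR (4 * t) = expR (2 * t) ^+ 2 :> R.
      by rewrite -expRM_natl; congr expR; ring.
    rewrite !e4 ler_pdivlMr//.
    have := sqr_ge0 (expR (2 * w i) - expR (2 * w j)); nra.
  apply: (@le_trans _ _ (\sum_i \sum_j (p x i * p x j) *
      ((expR (4 * w i) + expR (4 * w j)) / 2))).
    apply: ler_sum => i _; apply: ler_sum => j _.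
    by rewrite ler_wpM2l ?(mulr_ge0 (p_ge0 x i) (p_ge0 x j)).
  set t4 := \sum_i p x i * expR (4 * w i).
  have E i : \sum_j (p x i * p x j) * ((expR (4 * w i) + expR (4 * w j)) / 2) =
     p x i * expR (4 * w i) / 2 + p x i * (t4 / 2).
    transitivity (\sum_j (p x j * (p x i * expR (4 * w i) / 2) +
        p x i / 2 * (p x j * expR (4 * w j)))).
      by apply: eq_bigr => j _; field.
    by rewrite big_split/= -mulr_suml p_sum1 -mulr_sumr -/t4 mul1r; field.
  under eq_bigr do rewrite E.
  by rewrite big_split/= -2!mulr_suml p_sum1 -/t4; lra.
have A2E : A2 = \sum_i p x i * expR (4 * w i) - 2 * z1 + 1.
  transitivity (\sum_i p x i * expR (4 * w i) - 2 * z1 + \sum_i p x i); last first.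
    by rewrite p_sum1.
  rewrite /A2 /z1 mulr_sumr -sumrB -big_split/=.
  by apply: eq_bigr => i _; ring.
have z11 : 1 <= z1.
  rewrite -(p_sum1 x); apply: ler_sum => i _; rewrite ler_peMr//.
  by rewrite -expR0 ler_expR.
have VE cs S : V cs S = 1 + a * (z1 - 1) - a * (1 - a) / 2 * (Q cs - 2 * z1 + 1)
    + S * (e * A2 + e^-1 * A4) by [].
(* The upper polynomial for X and the lower one for Y carry the error bracket with weights 4 and -
   4, hence the 8. *)
have hD : 8 * (e * A2 + e^-1 * A4) <= D.
  have -> : D = 8 * (e * (k * W * e ^+ 2) + e^-1 * (k * W ^+ 2 * e ^+ 4)).
    rewrite /D /k; field; rewrite gt_eqF//.
  rewrite ler_wpM2l// lerD// ler_wpM2l// ?invr_ge0 ltW//.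
have [aa0 aa1] : 0 <= a * (1 - a) /\ a * (1 - a) <= 1.
  case/andP: a01 => a0 a1; split; first by rewrite mulr_ge0// subr_ge0.
  by rewrite (le_trans (ler_piMl _ a1))// ?subr_ge0// gerBl.
have a0 : 0 <= a by case/andP: a01.
split.
  apply: (le_trans up).
  have : V cX 4 <= V cY (- 4) + D.
    rewrite !VE; have := ler_wpM2l aa0 hQ; lra.
  move=> /(ler_wpM2l (ltW F0)); rewrite mulrDr => h; apply: (le_trans h).
  lra.
apply: le_trans lo; rewrite mulrC ler_wpM2l ?(ltW F0)// VE.
have q0 : Q cY - 2 * z1 + 1 <= A2 by rewrite A2E; lra.
have A20 : 0 <= A2.
  apply: sumr_ge0 => i _; rewrite mulr_ge0//.
  have -> : expR (4 * w i) = (expR (w i) ^+ 2) ^+ 2.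
    by rewrite -exprM -expRM_natl.
  have e1 : 1 <= expR (w i) by rewrite -expR0 ler_expR.
  set u := expR (w i) in e1 *.
  have -> : (u ^+ 2) ^+ 2 - 2 * u + 1 = (u - 1) * (u * u ^+ 2 + u ^+ 2 + (u - 1)).
    by ring.
  have u0 : 0 <= u by rewrite (le_trans _ e1).
  apply: mulr_ge0; first by rewrite subr_ge0.
  rewrite addr_ge0 ?subr_ge0//; apply: addr_ge0; first apply: mulr_ge0 => //.
    exact: sqr_ge0.
  exact: sqr_ge0.
have h1 : 0 <= a * (z1 - 1) by rewrite mulr_ge0// subr_ge0.
have h2 : a * (1 - a) * (Q cY - 2 * z1 + 1) <= A2.
  apply: (@le_trans _ _ (a * (1 - a) * A2)); first by rewrite ler_wpM2l.
  by rewrite ler_piMl.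
have D0 : 0 <= D.
  rewrite /D; apply: mulr_ge0; last by rewrite exprn_ge0// ltW.
  apply: mulr_ge0; last by rewrite addr_ge0// sqr_ge0.
  by apply: mulr_ge0.
lra.
Qed.

Let s2 : R := (Num.sqrt 2)^-1.

(** Halving the variance splits a Gaussian vector into two independent copies. Exchanging one copy
    costs K; since the averaging operators commute, the other can then be exchanged at the same
    cost, so each doubling squares K. *)
Lemma gsmooths_doubling j (cX cY : seq 'rV[R]_N) K : 0 <= K ->
  (forall x, gsmooths (map ( *:%R (s2 ^+ j)) cX) soft_max x <=
         K * gsmooths (map ( *:%R (s2 ^+ j)) cY) soft_max x) ->
  forall x, gsmooths cX soft_max x <= K ^+ (2 ^ j) * gsmooths cY soft_max x.
Proof.
have L0 := logLip_soft_max_ge0; have hF := logLip_soft_max.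
elim: j K => [|j IH] K K0 h x.
  have := h x; rewrite expr1 expr0.
  by rewrite !(eq_map (fun c => scale1r c)) !map_id.
have split cs : map ( *:%R (s2 ^+ j.+1)) cs = map ( *:%R s2) (map ( *:%R (s2 ^+ j)) cs).
  by rewrite -map_comp; apply: eq_map => c /=; rewrite scalerA exprS.
rewrite expnS mulnC exprM -exprM mulnC exprM; apply: IH => [|{}x].
  by rewrite exprn_ge0.
rewrite -(gsmooths_half _ L0 hF) -(gsmooths_half (map _ cY) L0 hF) -/s2.
rewrite -!split; set A := map _ cX; set B := map _ cY.
have LX : logLip (beta * a) (gsmooths A soft_max) by exact: gsmooths_logLip.
have LY : logLip (beta * a) (gsmooths B soft_max) by exact: gsmooths_logLip.
apply: (@le_trans _ _ (gsmooths A (fun z => K * gsmooths B soft_max z) x)).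
  by apply: (gsmooths_le _ _ L0 LX (logLip_Z K0 LY)) => z; exact: h.
rewrite (gsmoothsZ _ L0 K0 LY) (gsmoothsC _ _ L0 hF).
rewrite expr2 -mulrA ler_wpM2l//.
have -> : K * gsmooths B (gsmooths B soft_max) x = gsmooths B (fun z => K * gsmooths B soft_max z) x.
  by rewrite (gsmoothsZ _ L0 K0 LY).
by apply: (gsmooths_le _ _ L0 LX (logLip_Z K0 LY)) => z; exact: h.
Qed.

Lemma le_expR_mul (A B : R) : 0 <= B ->
  (forall t, 0 < t -> A <= expR t * B) -> A <= B.
Proof.
move=> B0 h; apply/ler_addgt0Pr => e e0.
have := h (ln (1 + e / (B + 1))).
have B1 : 0 < B + 1 by rewrite ltr_wpDl.
have d0 : 0 < e / (B + 1) by rewrite divr_gt0.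
rewrite lnK ?posrE ?addr_gt0// => /(_ _)/le_trans; apply.
  by rewrite ln_gt0// ltrDl.
rewrite mulrDl mul1r lerD2l mulrAC ler_pdivrMr// ler_wpM2l ?(ltW e0)//.
by rewrite lerDl.
Qed.

Theorem gauss_slepian (cX cY : seq 'rV[R]_N) x :
  (forall i, cov_of cX i i = cov_of cY i i) ->
  (forall i j, cov_of cY i j <= cov_of cX i j) ->
  gsmooths cX soft_max x <= gsmooths cY soft_max x.
Proof.
move=> covE cov_le; have L0 := logLip_soft_max_ge0; have hF := logLip_soft_max.
apply: le_expR_mul => [|t t0].
  by have := logLip_ge0 x (gsmooths_logLip cY L0 hF).
have ecov0 cs i : 0 <= cov_of cs i i.
  by apply: sumr_ge0 => c _; rewrite -expr2 sqr_ge0.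
pose W := \sum_i beta ^+ 2 * cov_of cY i i / 2.
have w0 i : 0 <= beta ^+ 2 * cov_of cY i i / 2.
  by rewrite !mulr_ge0 ?sqr_ge0 ?invr_ge0.
have W0 : 0 <= W by exact: sumr_ge0.
have kap0 := moment_cst_ge0.
pose c := 8 * moment_cst * (W + W ^+ 2).
have c0 : 0 <= c.
  apply: mulr_ge0; last by rewrite addr_ge0// sqr_ge0.
  by apply: mulr_ge0.
pose k := moment_cst * W.
have k0 : 0 <= k by apply: mulr_ge0.
have s2_gt0 : 0 < s2 by rewrite invr_gt0 sqrtr_gt0.
have s22 : s2 ^+ 2 = 2^-1 by rewrite /s2 exprVn sqr_sqrtr.
have s2_lt1 : s2 < 1.
  rewrite ltNge; apply/negP => h; have : 1 <= s2 ^+ 2 by rewrite expr_ge1// ltW.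
  by rewrite s22; lra.
have small (y : R) : 0 < y -> exists j, s2 ^+ j <= y.
  move=> y0; have /cvgrPdist_le/(_ _ y0) : (fun j => s2 ^+ j) @ \oo --> (0 : R).
    by apply: cvg_expr; rewrite gtr0_norm.
  move=> [j _ /(_ j (leqnn j))]; rewrite /= sub0r normrN => h; exists j.
  by rewrite (le_trans (ler_norm _)).
(* Every smallness requirement on the scale e is a summand of [M], so the single bound e * M <= 1
   yields all of them. *)
pose M := W + 2 * (k + c) + 2 * c / t + 1.
have t2 : 0 <= 2 * c / t by apply: divr_ge0; [exact: mulr_ge0|exact: ltW].
have M0 : 0 < M by rewrite /M; clearbody c k W; lra.
have [j hj] := small M^-1 ltac:(by rewrite invr_gt0).
set e := s2 ^+ j in hj.
have e0 : 0 < e by rewrite exprn_gt0.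
have eM : e * M <= 1 by rewrite -ler_pdivlMr// mul1r.
have e1 : e <= 1 by rewrite exprn_ile1// ltW.
have e2 : e ^+ 2 <= e by rewrite expr2 ler_piMl// ltW.
have e3 : e ^+ 3 <= e by rewrite exprS ler_piMr ?(ltW e0)// (le_trans e2).
have eW : e * W <= 1.
  by apply: le_trans eM; rewrite ler_wpM2l ?(ltW e0)// /M; lra.
have ekc : 2 * (e * (k + c)) <= 1.
  by apply: le_trans eM; rewrite mulrCA ler_wpM2l ?(ltW e0)// /M; lra.
have ect : 2 * c * e <= t.
  have : e * (2 * c / t) <= 1.
    by apply: le_trans eM; rewrite ler_wpM2l ?(ltW e0)// /M; lra.
  by rewrite mulrA ler_pdivrMr// mul1r [e * _]mulrC.
have scov cs i l : cov_of (map ( *:%R e) cs) i l = e ^+ 2 * cov_of cs i l.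
  rewrite /cov_of big_map big_distrr/=; apply: eq_bigr => d _; rewrite !mxE; ring.
have step y := @gauss_step (map ( *:%R e) cX) (map ( *:%R e) cY) W e y.
have ce0 : 0 <= c * e ^+ 3 by apply: mulr_ge0 => //; rewrite exprn_ge0// ltW.
have K0 : 0 <= 1 + 2 * (c * e ^+ 3).
  by apply: addr_ge0 => //; apply: mulr_ge0.
have := @gsmooths_doubling j cX cY _ K0.
have hyp y : gsmooths [seq s2 ^+ j *: i | i <- cX] soft_max y <=
    (1 + 2 * (c * e ^+ 3)) * gsmooths [seq s2 ^+ j *: i | i <- cY] soft_max y.
  rewrite -/e; have [] := step y.
  - by move=> i; rewrite !scov covE.
  - by move=> i l; rewrite !scov ler_wpM2l ?sqr_ge0.
  - exact: e0.
  - exact: W0.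
  - by apply: le_trans eW; rewrite ler_wpM2r.
  - move=> i; rewrite scov mulrCA -mulrA ler_wpM2l ?sqr_ge0//.
    by rewrite /W (bigD1 i)//= lerDl sumr_ge0.
  rewrite -/c -/k; set B := gsmooths [seq e *: i | i <- cY] soft_max y; have F0 := soft_max_gt0 y.
  move=> h1 h2.
  have ke : k * e ^+ 2 <= k * e by apply: ler_wpM2l.
  have ce : c * e ^+ 3 <= c * e by apply: ler_wpM2l.
  (* This turns the additive error, measured by [soft_max] at y, into a multiplicative one, measured
     by the average itself. Only multiplicative errors can be iterated. *)
  have half : soft_max y <= 2 * B.
    have : 1 / 2 * soft_max y <= (1 - k * e ^+ 2 - c * e ^+ 3) * soft_max y.
      by rewrite ler_wpM2r ?(ltW F0)//; lra.
    lra.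
  have := ler_wpM2l ce0 half; lra.
move=> /(_ hyp x)/le_trans; apply.
rewrite ler_wpM2r//; first exact: logLip_ge0 (gsmooths_logLip cY L0 hF).
apply: (@le_trans _ _ (expR (2 * (c * e ^+ 3)) ^+ (2 ^ j))).
  by rewrite lerXn2r ?nnegrE ?expR_ge0// expR_ge1Dx.
rewrite -expRM_natl ler_expR natrX.
(* There are 2^j = e^(-2) exchanges, each with an error in the exponent of order e^3; the total 2 c
   e is at most t. *)
have ee : 2 ^+ j * e ^+ 2 = 1.
  by rewrite /e -exprM mulnC exprM s22 -exprMn mulfV ?expr1n.
have -> : 2%:R ^+ j * (2 * (c * e ^+ 3)) = 2 * c * e * (2 ^+ j * e ^+ 2) by ring.
by rewrite ee mulr1.
Qed.

End slepian.

(** * Exponential moments of the decoupled process *)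

Section quad.
Context {R : realType}.

(** For a standard normal g in dimension q, l |g| <= l c / 2 + l |g|^2 / (2 c), and the exponential
    moment of the right side is the product displayed. The bound is that product at its minimiser
    c. *)
Lemma chi_mgf_opt (q : nat) (l : R) : (0 < q)%N -> 0 < l ->
  exists c, [/\ 0 < c, l < c & expR (l * c / 2) * (Num.sqrt (1 - l / c))^-1 ^+ q
    <= expR (l * Num.sqrt q%:R + l ^+ 2 / 2)].
Proof.
move=> q0 l0; set s := Num.sqrt q%:R.
have s0 : 0 < s by rewrite sqrtr_gt0 ltr0n.
have s2 : s ^+ 2 = q%:R by rewrite sqr_sqrtr.
pose m := l / s; have m0 : 0 < m by rewrite divr_gt0.
pose D := Num.sqrt (m ^+ 2 + 4).
have D2 : D ^+ 2 = m ^+ 2 + 4 by rewrite sqr_sqrtr// addr_ge0// sqr_ge0.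
have D0 : 0 <= D by exact: sqrtr_ge0.
have D1 : 2 <= D.
  by rewrite -(@ler_pXn2r _ 2) ?nnegrE// D2; have := sqr_ge0 m; lra.
(* Stationarity in c reads c^2 - l c = q. With c = s x and l = s m this is x^2 = m x + 1, and then 1
   - l / c = x^(-2). *)
pose x := (m + D) / 2.
have x1 : 1 <= x by rewrite /x; lra.
have x0 : 0 < x by exact: lt_le_trans x1.
have xn : x != 0 by rewrite gt_eqF.
have xm : x ^+ 2 = m * x + 1 by rewrite /x; lra.
have xmV : m = x - x^-1.
  apply: (mulIf xn); rewrite mulrBl mulVf//; lra.
have lE : l = s * (x - x^-1) by rewrite -xmV /m mulrC divfK ?gt_eqF.
have sn : s != 0 by rewrite gt_eqF.
have c0 : 0 < s * x by rewrite mulr_gt0.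
exists (s * x); split=> //.
  by rewrite lE ltr_pM2l// gtrBl invr_gt0.
have -> : 1 - l / (s * x) = x^-1 ^+ 2 by rewrite lE; field; rewrite xn.
rewrite sqrtr_sqr gtr0_norm ?invr_gt0// invrK.
have -> : x ^+ q = expR (q%:R * ln x) by rewrite expRM_natl lnK ?posrE.
rewrite -expRD ler_expR.
have h := ler_wpM2l (sqr_ge0 s) (ln_le_chi x1).
rewrite -s2.
have -> : l * (s * x) / 2 = s ^+ 2 * ((x ^+ 2 - 1) / 2) by rewrite lE; field.
have -> : l * s + l ^+ 2 / 2 = s ^+ 2 * ((x - x^-1) + (x ^+ 2 - 2 + x^-1 ^+ 2) / 2).
  by rewrite lE; field.
lra.
Qed.

Variable N : nat.
Implicit Types (x c : 'rV[R]_N).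

(** A pointwise bound by a product of functions of the single coefficients lets the Gaussian
    integrals be computed one direction at a time. *)
Lemma gsmooths_quad (f : 'rV[R]_N -> R) L (acs : seq (R * 'rV[R]_N)) (C : R) x :
  0 <= L -> logLip L f -> (forall t, t \in acs -> t.1 < 1) ->
  (forall ys : seq R, size ys = size acs ->
     f (x + \sum_(t <- zip acs ys) t.2 *: t.1.2) <=
     C * expR (\sum_(t <- zip acs ys) t.1.1 * t.2 ^+ 2 / 2)) ->
  gsmooths (map snd acs) f x <= C * \prod_(t <- acs) (Num.sqrt (1 - t.1))^-1.
Proof.
move=> L0 hf; elim: acs x C => [|[a c] acs IH] x C ha h /=.
  by have := h [::] erefl; rewrite !big_nil addr0 expR0.
have a1 : a < 1 by have := ha (a, c); apply; rewrite mem_head.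
set P := \prod_(t <- acs) (Num.sqrt (1 - t.1))^-1.
have step y : gsmooths (map snd acs) f (x + y *: c) <= C * expR (a * y ^+ 2 / 2) * P.
  apply: IH => [t tin|ys sz]; first by apply: ha; rewrite inE tin orbT.
  have := h (y :: ys); rewrite /= sz => /(_ erefl).
  by rewrite !big_cons/= addrA expRD mulrA.
have LT : logLip L (gsmooths (map snd acs) f) by exact: gsmooths_logLip.
rewrite big_cons/= -/P -lee_fin (EFin_gsmooth _ _ L0 LT).
have P0 : 0 <= P by apply: prodr_ge0 => t _; rewrite invr_ge0 sqrtr_ge0.
have CP0 : 0 <= C * P.
  have := step 0; rewrite expr0n/= mulr0 mul0r expR0 mulr1; apply: le_trans.
  exact: logLip_ge0 LT.
have me : measurable_fun [set: R] (fun y : R => (expR (a * y ^+ 2 / 2))%:E).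
  apply/measurable_EFinP; apply: measurable_affine_expR; apply: measurable_funM => //.
  by apply: measurable_funM => //; exact: measurable_funX.
apply: (@le_trans _ _ (\int[@gmu R]_y ((C * P)%:E * (expR (a * y ^+ 2 / 2))%:E))%E).
  apply: ge0_le_integral => //.
  - by move=> y _; rewrite lee_fin; exact: logLip_ge0 LT.
  - by apply/measurable_EFinP; exact: logLip_line_measurable LT.
  - by apply: emeasurable_funM.
  - by move=> y _; rewrite lee_fin mulrAC; exact: step.
rewrite ge0_integralZl//.
rewrite gauss_sqr_mgf// -EFinM lee_fin; rewrite le_eqVlt; apply/orP; left.
by apply/eqP; ring.
Qed.

Variables (beta a : R).
Hypothesis N0 : (0 < N)%N.
Hypothesis beta0 : 0 <= beta.
Hypothesis a01 : 0 <= a <= 1.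

Lemma soft_max_le x m : (forall i, x ord0 i <= m) ->
  soft_max beta a x <= N%:R `^ a * expR (beta * a * m).
Proof.
move=> h; have a0 : 0 <= a by case/andP: a01.
have hS : sum_exp beta x <= N%:R * expR (beta * m).
  apply: (@le_trans _ _ (\sum_(i < N) expR (beta * m))).
    by apply: ler_sum => i _; rewrite ler_expR ler_wpM2l.
  by rewrite sumr_const card_ord mulr_natl.
apply: (le_trans (ge0_ler_powR a0 _ _ hS)).
- by rewrite nnegrE ltW// sum_exp_gt0.
- by rewrite nnegrE mulr_ge0 ?expR_ge0.
- by rewrite powRM ?expR_ge0// -expRM mulrAC.
Qed.

Lemma soft_max_ge x i : expR (beta * a * x ord0 i) <= soft_max beta a x.
Proof.
have a0 : 0 <= a by case/andP: a01.
rewrite mulrAC expRM; apply: ge0_ler_powR => //.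
- by rewrite nnegrE expR_ge0.
- by rewrite nnegrE ltW// sum_exp_gt0.
- by rewrite /sum_exp (bigD1 i)//= lerDl sumr_ge0// => j _; exact: expR_ge0.
Qed.

(** Young's inequality l y c <= l^2 c^2 / (2 b) + b y^2 / 2 in each direction, with l = beta * a,
    bounds all coordinates by one quadratic form in the coefficients, hence also their maximum. *)
Lemma gsmooths_soft_max_quad (acs : seq (R * 'rV[R]_N)) (G : R) :
  (forall t, t \in acs -> 0 < t.1 < 1) ->
  (forall i, \sum_(t <- acs) (beta * a) ^+ 2 / (2 * t.1) * t.2 ord0 i ^+ 2 <= G) ->
  gsmooths (map snd acs) (soft_max beta a) 0 <=
    N%:R `^ a * expR G * \prod_(t <- acs) (Num.sqrt (1 - t.1))^-1.
Proof.
move=> ha hG.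
apply: (gsmooths_quad (logLip_soft_max_ge0 beta0 a01) (logLip_soft_max N0 beta0 a01)).
  by move=> t /ha/andP[].
move=> ys sz; rewrite add0r -mulrA -expRD.
have mz u : u \in zip acs ys -> u.1 \in acs.
  by move=> /(map_f fst); rewrite [map _ _]unzip1_zip ?sz.
set Q := \sum_(t <- zip acs ys) t.1.1 * t.2 ^+ 2 / 2.
have [l0|l0] := eqVneq (beta * a) 0.
  have := @soft_max_le (\sum_(t <- zip acs ys) t.2 *: t.1.2).
  set z := \sum_(t <- _) _ => hz.
  apply: (@le_trans _ _ (N%:R `^ a * expR (beta * a * (l1norm z)))).
    by apply: hz => i; rewrite (le_trans (ler_norm _))// norm_le_l1norm.
  rewrite l0 mul0r ler_wpM2l ?powR_ge0// ler_expR addr_ge0//.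
    have := hG (Ordinal N0); rewrite l0 expr0n/=; under eq_bigr do rewrite !mul0r.
    by rewrite big1.
  rewrite /Q big_seq; apply: sumr_ge0 => -[t y] /mz tin /=.
  by rewrite divr_ge0// mulr_ge0 ?sqr_ge0// ltW//; case/andP: (ha _ tin).
set l := beta * a in l0 *.
have lp : 0 < l by rewrite lt_neqAle eq_sym l0 logLip_soft_max_ge0.
have -> : G + Q = l * ((G + Q) / l) by rewrite mulrC divfK.
apply: soft_max_le => i; rewrite ler_pdivlMr// summxE.
apply: (@le_trans _ _ (\sum_(t <- acs) l ^+ 2 / (2 * t.1) * t.2 ord0 i ^+ 2 + Q)); last first.
  by rewrite lerD2r.
have -> : \sum_(t <- acs) l ^+ 2 / (2 * t.1) * t.2 ord0 i ^+ 2 =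
   \sum_(t <- zip acs ys) l ^+ 2 / (2 * t.1.1) * t.1.2 ord0 i ^+ 2.
  by rewrite -[acs in LHS](@unzip1_zip _ _ acs ys) ?sz// big_map.
rewrite /Q -big_split/= mulr_suml !big_seq; apply: ler_sum => -[[b c] y].
move=> /mz/ha/= /andP[b0 b1]; rewrite mxE.
have := sqr_ge0 (l * c ord0 i - b * y).
have -> : l ^+ 2 / (2 * b) * c ord0 i ^+ 2 + b * y ^+ 2 / 2 =
  y * c ord0 i * l + (l * c ord0 i - b * y) ^+ 2 / (2 * b).
  by field; rewrite gt_eqF.
by move=> h; rewrite lerDl divr_ge0// mulr_ge0// ltW.
Qed.

End quad.

(** * From independent normal variables to averaging operators *)

Section link.
Context {R : realType}.

Lemma countable_cells (h : R) : 0 < h ->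
  exists A : nat -> set R, exists r : nat -> R,
  [/\ forall n, measurable (A n), trivIset setT A, \bigcup_n A n = setT &
      forall n y, A n y -> `|y - r n| <= h].
Proof.
move=> h0; pose r n : R := oapp ratr 0 (unpickle n : option rat).
pose U n := [set y : R | `|y - r n| <= h].
exists (seqDU U), r; split.
- apply: seqDU_measurable => n.
  rewrite (_ : U n = `[r n - h, r n + h]%classic)//.
  by apply/seteqP; split=> y; rewrite /U/= in_itv/= ler_distl.
- exact: trivIset_seqDU.
- rewrite -seqDU_bigcup_eq; apply/seteqP; split=> // y _.
  have /rat_in_itvoo[q] : y - h < y by rewrite gtrBl.
  rewrite in_itv/= => /andP[q1 q2]; exists (pickle q) => //=.
  rewrite /U/= /r pickleK/= ger0_norm; last by rewrite subr_ge0 ltW.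
  by move: q1; rewrite ltrBlDr -ltrBlDl => /ltW.
- by move=> n y Any; have := @subset_seqDU _ U n y Any.
Qed.

Context (d : measure_display) (T : measurableType d) (P : probability T R).
Context (I : finType) (Z : I -> {RV P >-> R}) (N : nat) (c : I -> 'rV[R]_N).
Variable sigma : R.
Hypothesis sigma0 : 0 < sigma.
Hypothesis indep : mutually_independent Z.
Hypothesis law : forall i, has_normal_law (Z i) 0 sigma.
Implicit Types (J : {set I}) (B : I -> set R) (s : seq I).

Let ev J B := \bigcap_(i in [set` J]) (Z i @^-1` B i).

Let measurable_ev J B : (forall i, measurable (B i)) -> measurable (ev J B).
Proof.
move=> mB; apply: fin_bigcap_measurable; first exact: finite_finset.
move=> i _; rewrite -[X in measurable X]setTI; exact: measurable_funP.
Qed.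

Let W s w : 'rV[R]_N := \sum_(i <- s) Z i w *: c i.

Let measurable_W s x i : measurable_fun [set: T] (fun w => (x + W s w) ord0 i).
Proof.
rewrite (_ : (fun w => _) = (fun w => x ord0 i + \sum_(j <- s) Z j w * c j ord0 i)).
  apply: measurable_funD => //; apply: measurable_sum => j.
  by apply: measurable_funM => //; exact: measurable_funP.
by apply/funext => w; rewrite mxE summxE; congr (_ + _); apply: eq_bigr => j _; rewrite mxE.
Qed.

(** Independence is given on events only, so the variables are replaced one at a time: the line is
    cut into cells, the variable is frozen at the centre of its cell, and the cell joins the
    conditioning event [ev J B]. Freezing costs a factor that tends to 1 with the cell size. *)
Lemma integral_le_gsmooths L f s J B x : 0 <= L -> logLip L f -> uniq s ->
  (forall i, i \in s -> i \notin J) -> (forall i, measurable (B i)) ->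
  (\int[P]_(w in ev J B) (f (x + W s w))%:E <=
   P (ev J B) * (gsmooths [seq sigma *: c i | i <- s] f x)%:E)%E.
Proof.
move=> L0 hf; elim: s J B x => [|k s IH] J B x /=.
  move=> _ _ mB; rewrite (eq_integral (fun=> (f x)%:E)) => [|w _]; last first.
    by rewrite /W big_nil addr0.
  by rewrite (integral_cst P (measurable_ev J mB)) [X in (_ <= X)%E]muleC.
move=> /andP[ks us] sJ mB.
set D := ev J B; have mD : measurable D by exact: measurable_ev.
set H := gsmooths _ f; have hH : logLip L H by exact: gsmooths_logLip.
have kJ : k \notin J by apply: sJ; rewrite mem_head.
have F0 z : 0 <= f z by exact: logLip_ge0 hf.
have PD : P D = (fine (P D))%:E by rewrite fineK// fin_num_measure.
have PD0 : 0 <= fine (P D) by exact: fine_ge0.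
have main (h : R) : 0 < h ->
  (\int[P]_(w in D) (f (x + W (k :: s) w))%:E <=
   (expR (2 * (L * (h * l1norm (c k)))))%:E * (P D * (gsmooth (sigma *: c k) H x)%:E))%E.
  move=> h0; have [A [r [mA tA UA Ar]]] := countable_cells h0.
  (* Conditioning on [k |: J] with [B' n] adds the event that variable k lies in cell n; its
     probability splits off by independence. *)
  pose B' n i := if i == k then A n else B i.
  have mB' n i : measurable (B' n i) by rewrite /B'; case: ifP.
  pose Dn n := ev (k |: J) (B' n).
  have DnE n : Dn n = D `&` (Z k @^-1` A n).
    apply/seteqP; split=> w /=.
      move=> hw; split=> [i iJ|].
        have := hw i; rewrite /= in_setU1 iJ orbT => /(_ isT).
        by rewrite /B'; case: eqVneq => // ik; rewrite ik /= (negbTE kJ) in iJ.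
      by have := hw k; rewrite /= setU11 => /(_ isT); rewrite /B' eqxx.
    move=> [hD hA] i /=; rewrite in_setU1 => /orP[/eqP ->|iJ].
      by rewrite /B' eqxx.
    rewrite /B'; case: eqVneq => [ik|_]; last exact: hD.
    by rewrite ik (negbTE kJ) in iJ.
  have mDn n : measurable (Dn n) by exact: measurable_ev.
  have PDn n : (P (Dn n) = P D * normal_prob 0 sigma (A n))%E.
    rewrite /Dn (indep _ (mB' n)) big_setU1//= /D (indep _ mB) muleC; congr (_ * _)%E.
      apply: eq_bigr => i iJ; rewrite /B'; case: eqVneq => // ik.
      by rewrite ik (negbTE kJ) in iJ.
    by rewrite /B' eqxx -(law k (mA n)).
  have DU : D = \bigcup_n Dn n.
    under eq_bigcupr do rewrite DnE.
    by rewrite -setI_bigcupr -preimage_bigcup UA preimage_setT setIT.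
  have mf u y : measurable_fun [set: T] (fun w => (f (u + y + W s w))%:E).
    by apply/measurable_EFinP; apply: (logLip_measurable L0 hf) => i; exact: measurable_W.
  have mf' : measurable_fun [set: T] (fun w => (f (x + W (k :: s) w))%:E).
    by apply/measurable_EFinP; apply: (logLip_measurable L0 hf) => i; exact: measurable_W.
  have mH : measurable_fun [set: R] (fun y : R => (H (x + y *: c k))%:E).
    by apply/measurable_EFinP; exact: logLip_line_measurable hH.
  (* [E] is paid twice: once to freeze the variable at [r n], once to return from [r n] to the
     integration variable of the normal law. *)
  set E := expR (L * (h * l1norm (c k))).
  have E2 : expR (2 * (L * (h * l1norm (c k)))) = E * E.
    by rewrite -expRD; congr expR; ring.
  rewrite {1}DU ge0_integral_bigcup//; last 3 first.
  - by apply: measurable_funTS.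
  - by move=> w _; rewrite lee_fin.
  - move=> i j _ _ [w [/= hi hj]]; apply: tA => //.
    by exists (Z k w); move: hi hj; rewrite !DnE => -[_ ?] [_ ?].
  have dist n y : A n y -> L * l1norm ((y - r n) *: c k) <= L * (h * l1norm (c k)).
    by move=> Any; rewrite ler_wpM2l// l1normZ ler_wpM2r ?l1norm_ge0//; exact: Ar.
  have cell n : (\int[P]_(w in Dn n) (f (x + W (k :: s) w))%:E <=
     (E * E)%:E * (P D * \int[normal_prob 0 sigma]_(y in A n) (H (x + y *: c k))%:E))%E.
    apply: (@le_trans _ _ (E%:E * (P (Dn n) * (H (x + r n *: c k))%:E))%E).
      apply: (@le_trans _ _ (\int[P]_(w in Dn n) (E%:E * (f (x + r n *: c k + W s w))%:E))%E).
        apply: ge0_le_integral => //.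
        - by move=> w _; rewrite lee_fin.
        - exact: measurable_funTS.
        - by apply: measurable_funTS; apply: emeasurable_funM.
        - move=> w; rewrite DnE => -[_ /= Aw]; rewrite lee_fin.
          apply: (le_trans (logLip_le (x + r n *: c k + W s w) _ hf)).
          rewrite ler_wpM2r// ler_expR.
          rewrite /W big_cons -/(W s w).
          rewrite (_ : _ - _ = (Z k w - r n) *: c k); first exact: dist.
          by rewrite scalerBl addrA opprD addrACA subrr addr0 opprD addrACA subrr add0r.
      rewrite ge0_integralZl//.
      - rewrite lee_wpmul2l ?lee_fin ?expR_ge0//.
        apply: IH => // i si.
        rewrite in_setU1 negb_or sJ ?inE ?si ?orbT// andbT.
        by apply: contraNneq ks => <-.
      - exact: measurable_funTS.
      - by move=> w _; rewrite lee_fin.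
      - by rewrite lee_fin expR_ge0.
    rewrite EFinM -muleA lee_wpmul2l ?lee_fin ?expR_ge0//.
    rewrite PDn muleCA -muleA lee_wpmul2l ?measure_ge0//.
    have -> : (E%:E * \int[normal_prob 0 sigma]_(y in A n) (H (x + y *: c k))%:E =
       \int[normal_prob 0 sigma]_(y in A n) (E%:E * (H (x + y *: c k))%:E))%E.
      rewrite ge0_integralZl//.
      - exact: mA.
      - exact: measurable_funTS.
      - by move=> y _; rewrite lee_fin; exact: logLip_ge0 hH.
      - by rewrite lee_fin expR_ge0.
    rewrite muleC -(integral_cst (normal_prob 0 sigma) (mA n)).
    apply: ge0_le_integral => //.
    - exact: mA.
    - by move=> y _; rewrite lee_fin; exact: logLip_ge0 hH.
    - by apply: measurable_funTS; apply: emeasurable_funM.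
    - move=> y Any; rewrite lee_fin.
      apply: (le_trans (logLip_le (x + y *: c k) _ hH)).
      rewrite ler_wpM2r ?(logLip_ge0 _ hH)// ler_expR -l1normN opprB.
      rewrite (_ : _ - _ = (y - r n) *: c k); first exact: dist.
      by rewrite scalerBl opprD addrACA subrr add0r.
  apply: (@le_trans _ _ (\sum_(n <oo)
     (E * E)%:E * (P D * \int[normal_prob 0 sigma]_(y in A n) (H (x + y *: c k))%:E))%E).
    apply: lee_nneseries => n //.
    by move=> _ _; apply: integral_ge0 => w _; rewrite lee_fin.
  have I0 n : (0 <= \int[normal_prob 0 sigma]_(y in A n) (H (x + y *: c k))%:E)%E.
    by apply: integral_ge0 => y _; rewrite lee_fin; exact: logLip_ge0 hH.
  rewrite PD nneseriesZl; last by move=> n _; rewrite mule_ge0 ?lee_fin.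
  rewrite nneseriesZl; last by [].
  rewrite -ge0_integral_bigcup//; last 2 first.
  - by rewrite UA.
  - by move=> y _; rewrite lee_fin; exact: logLip_ge0 hH.
  rewrite UA E2.
  have := @ge0_integral_normal_affine R 0 sigma _ sigma0
    (@logLip_line_continuous R N L H x (c k) L0 hH) (fun y => logLip_ge0 _ hH) => ->.
  rewrite (EFin_gsmooth _ _ L0 hH) le_eqVlt; apply/orP; left; apply/eqP.
  congr (_ * (_ * _))%E; apply: eq_integral => y _.
  by rewrite add0r scalerA mulrC.
have X0 : (0 <= \int[P]_(w in D) (f (x + W (k :: s) w))%:E)%E.
  by apply: integral_ge0 => w _; rewrite lee_fin.
(* Cells of size 1 already show that the integral is finite; smaller cells then give the sharp
   constant. *)
have := main 1 ltr01; rewrite {1}PD -!EFinM => hfin.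
have Xf : (\int[P]_(w in D) (f (x + W (k :: s) w))%:E)%E \is a fin_num.
  by rewrite ge0_fin_numE// (le_lt_trans hfin)// ltry.
rewrite -(fineK Xf) PD -EFinM lee_fin.
apply: le_expR_mul => [|t t0].
  by rewrite mulr_ge0//; have := logLip_ge0 x (gsmooth_logLip (sigma *: c k) L0 hH).
(* With cells of size t / q the exponent lost is t (q - 1) / q <= t. The summand 1 keeps [q]
   positive. *)
pose q := 2 * (L * l1norm (c k)) + 1.
have q0 : 0 < q by rewrite /q ltr_wpDl// !mulr_ge0// l1norm_ge0.
have := main (t / q) (divr_gt0 t0 q0).
rewrite PD -!EFinM -(fineK Xf) lee_fin => /le_trans; apply.
rewrite ler_wpM2r//.
  by rewrite mulr_ge0//; have := logLip_ge0 x (gsmooth_logLip (sigma *: c k) L0 hH).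
rewrite ler_expR (_ : 2 * _ = t * ((q - 1) / q)); last by rewrite /q; field; rewrite gt_eqF.
by rewrite ler_piMr ?(ltW t0)// ler_pdivrMr// mul1r gerBl.
Qed.

Lemma expectation_le_gsmooths L f : 0 <= L -> logLip L f ->
  (\int[P]_w (f (\sum_i Z i w *: c i))%:E <=
   (gsmooths [seq sigma *: c i | i <- enum I] f 0)%:E)%E.
Proof.
move=> L0 hf.
have := @integral_le_gsmooths L f (enum I) finset.set0 (fun=> setT) 0 L0 hf (enum_uniq I)
  (fun i _ => _) (fun i => measurableT).
rewrite /ev (_ : \bigcap_(i in _) _ = setT); last first.
  by apply/seteqP; split=> // w _ i /=; rewrite inE.
rewrite probability_setT mul1e => h; apply: le_trans (h _); last first.
  by move=> i; rewrite inE.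
rewrite le_eqVlt; apply/orP; left; apply/eqP; apply: eq_integral => w _.
by rewrite /W add0r big_enum.
Qed.

End link.

(** * Tail bound for finitely many pairs of vectors *)

Section tail.
Context {R : realType}.

Definition ip (n : nat) (u w : 'cV[R]_n) : R := \sum_i u i 0 * w i 0.

Lemma ip_CS n (u w : 'cV[R]_n) : ip u u = 1 -> ip w w = 1 -> ip u w <= 1.
Proof.
move=> u1 w1; have : 0 <= \sum_i (u i 0 - w i 0) ^+ 2.
  by apply: sumr_ge0 => i _; rewrite sqr_ge0.
have -> : \sum_i (u i 0 - w i 0) ^+ 2 = ip u u + ip w w - 2 * ip u w.
  by rewrite /ip mulr_sumr -sumrN -!big_split/=; apply: eq_bigr => i _; ring.
by rewrite u1 w1; lra.
Qed.

Lemma big_map_enum (S A : Type) (idx : S) (op : Monoid.com_law idx) (I : finType)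
    (f : I -> A) (F : A -> S) :
  \big[op/idx]_(t <- [seq f i | i <- enum I]) F t = \big[op/idx]_i F (f i).
Proof. by rewrite big_map big_enum. Qed.

Context (d : measure_display) (T : measurableType d) (P : probability T R).
Variables (m n p : nat) (sigma theta : R) (E : 'I_m -> 'I_n -> {RV P >-> R}).
Hypothesis n0 : (0 < n)%N.
Hypothesis p0 : (0 < p)%N.
Hypothesis theta0 : 0 < theta.
Hypothesis sigma0 : 0 < sigma.
Hypothesis indep : mutually_independent (fun ij : 'I_m * 'I_n => E ij.1 ij.2).
Hypothesis law : forall i j, has_normal_law (E i j) 0 sigma.

Definition bilin (u : 'cV[R]_m) (v : 'cV[R]_n) (w : T) : R :=
  \sum_i \sum_j u i 0 * v j 0 * E i j w.

Let rt := Num.sqrt (n%:R : R) + Num.sqrt p%:R.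

Section finite.
Variables (K : nat) (u : 'I_K -> 'cV[R]_m) (v : 'I_K -> 'cV[R]_n) (b : 'I_K -> 'cV[R]_p).
Hypothesis K0 : (0 < K)%N.
Hypothesis v1 : forall i, ip (v i) (v i) = 1.
Hypothesis b1 : forall i, ip (b i) (b i) = 1.
Hypothesis ub : forall i j, ip (u i) (u j) = ip (b i) (b j).

(** The Chernoff parameter: it minimises l^2 / 2 - l * theta * rt, the exponent left after the
    comparison. *)
Let l := theta * rt.

Let rt0 : 0 < rt.
Proof. by rewrite addr_gt0// sqrtr_gt0 ltr0n. Qed.

Let l0 : 0 < l.
Proof. by rewrite mulr_gt0. Qed.

Let cX (st : 'I_m * 'I_n) : 'rV[R]_K := \row_i (u i st.1 0 * v i st.2 0).
(* An additional standard normal direction added to every coordinate of the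
   bilinear process gives it the variances of the decoupled process. *)
Let one : 'rV[R]_K := \row_i 1.

Lemma slepian_mgf (a : R) : 0 < a <= 1 ->
  expR (l ^+ 2 / 2) * gsmooths [seq cX i | i <- enum {: 'I_m * 'I_n}] (soft_max (l / a) a) 0
  <= K%:R `^ a * expR (l * rt + l ^+ 2).
Proof.
move=> /andP[a0 a1].
have a01 : 0 <= a <= 1 by rewrite ltW.
have be0 : 0 <= l / a by rewrite divr_ge0// ltW.
have bea : l / a * a = l by rewrite divfK// gt_eqF.
have L0 := logLip_soft_max_ge0 be0 a01; have hF := logLip_soft_max K0 be0 a01.
(* A shift y along [one] multiplies [soft_max] by exp(l y), since beta * a = l; its normal mean is
   the factor on the left. *)
have shift : gsmooth one (soft_max (l / a) a) = fun x => expR (l ^+ 2 / 2) * soft_max (l / a) a x.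
  apply/funext => x; rewrite /gsmooth.
  transitivity (\int[@gmu R]_y (soft_max (l / a) a x * expR (l * y)))%R.
    congr fine; apply: eq_integral => y _; congr EFin.
    have -> : expR (l * y) = expR (l / a * y) `^ a.
      by rewrite -expRM; congr expR; rewrite [RHS]mulrAC bea.
    rewrite /soft_max -powRM ?expR_ge0//; last first.
      by rewrite ltW// sum_exp_gt0.
    congr (_ `^ a); rewrite /sum_exp mulr_suml; apply: eq_bigr => i _.
    by rewrite -expRD !mxE mulr1 mulrDr.
  rewrite RintegralZl//; last exact: gauss_integrable_exp.
  by rewrite mulrC; congr (_ * _); rewrite /Rintegral gauss_mgf.
rewrite [X in X <= _](_ : _ = gsmooths (one :: [seq cX i | i <- enum {: 'I_m * 'I_n}]) (soft_max (l / a) a) 0); last first.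
  by rewrite /= (gsmooth_gsmooths _ _ L0 hF) shift (gsmoothsZ _ L0 (expR_ge0 _) hF).
have [c1 [c10 lc1 hc1]] := chi_mgf_opt p0 l0.
have [c2 [c20 lc2 hc2]] := chi_mgf_opt n0 l0.
pose B k : 'rV[R]_K := \row_i b i k 0.
pose V k : 'rV[R]_K := \row_i v i k 0.
(* The p + n directions of the process <b_i, g> + <v_i, h>, with the Young weights l / c1 and l / c2
   that are optimal for |g| and |h|. *)
pose acs := [seq (l / c1, B k) | k <- enum 'I_p] ++ [seq (l / c2, V k) | k <- enum 'I_n].
have cYE : map snd acs = [seq B k | k <- enum 'I_p] ++ [seq V k | k <- enum 'I_n].
  by rewrite map_cat -!map_comp.
have covY i j : cov_of (map snd acs) i j = ip (b i) (b j) + ip (v i) (v j).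
  rewrite cYE /cov_of big_cat/= 2!big_map_enum/=.
  by congr (_ + _); apply: eq_bigr => k _; rewrite !mxE.
have covX i j : cov_of (one :: [seq cX i | i <- enum {: 'I_m * 'I_n}]) i j =
    1 + ip (u i) (u j) * ip (v i) (v j).
  rewrite /cov_of big_cons !mxE mulr1 big_map_enum/=; congr (_ + _).
  rewrite /ip mulr_suml -(pair_big xpredT xpredT (fun s t => cX (s, t) 0 i * cX (s, t) 0 j))/=.
  apply: eq_bigr => s _; rewrite mulr_sumr; apply: eq_bigr => t _; rewrite !mxE/=; ring.
apply: (@le_trans _ _ (gsmooths (map snd acs) (soft_max (l / a) a) 0)).
  apply: gauss_slepian => // [i|i j].
    by rewrite covX covY ub !v1 !b1; ring.
  rewrite covX covY ub.
  have h1 := ip_CS (b1 i) (b1 j); have h2 := ip_CS (v1 i) (v1 j).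
  (* The excess of the covariance 1 + <b, b'><v, v'> over <b, b'> + <v, v'> is this product,
     nonnegative by Cauchy-Schwarz. *)
  have : 0 <= (1 - ip (b i) (b j)) * (1 - ip (v i) (v j)).
    by rewrite mulr_ge0// subr_ge0.
  lra.
have lt1 c : 0 < c -> l < c -> 0 < l / c < 1.
  by move=> cc lc; rewrite divr_gt0//= ltr_pdivrMr// mul1r.
have := @gsmooths_soft_max_quad R K (l / a) a K0 be0 a01 acs (l * c1 / 2 + l * c2 / 2).
rewrite bea => h; apply: (le_trans (h _ _)).
- by move=> t; rewrite mem_cat => /orP[] /mapP[k _ ->] /=; apply: lt1.
- move=> i; rewrite big_cat/= 2!big_map_enum/=.
  have e c : 0 < c -> l ^+ 2 / (2 * (l / c)) = l * c / 2.
    by move=> cc; field; rewrite !gt_eqF.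
  rewrite -!mulr_sumr !e//.
  have -> : \sum_k B k 0 i ^+ 2 = ip (b i) (b i).
    by apply: eq_bigr => k _; rewrite mxE.
  have -> : \sum_k V k 0 i ^+ 2 = ip (v i) (v i).
    by apply: eq_bigr => k _; rewrite mxE.
  by rewrite b1 v1 !mulr1.
rewrite -mulrA ler_wpM2l ?powR_ge0//.
rewrite /acs big_cat/= 2!big_map_enum/= !prodr_const !card_ord.
have -> : l * rt + l ^+ 2 = (l * Num.sqrt p%:R + l ^+ 2 / 2) + (l * Num.sqrt n%:R + l ^+ 2 / 2).
  by rewrite /rt; field.
rewrite [X in X * _ <= _]expRD mulrACA [leRHS]expRD; apply: ler_pM; rewrite ?mulr_ge0 ?expR_ge0 ?exprn_ge0 ?invr_ge0 ?sqrtr_ge0//.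
Qed.

Lemma tail_finite :
  (P (\bigcup_(i : 'I_K) [set w | (sigma * (1 + theta) * rt < bilin (u i) (v i) w)%R])
   <= (expR (- (theta ^+ 2 * (n + p)%:R / 2)))%:E)%E.
Proof.
set A := \bigcup_i _.
pose x w := \sum_st E st.1 st.2 w *: (sigma^-1 *: cX st).
have xE w i : x w 0 i = bilin (u i) (v i) w / sigma.
  rewrite /x summxE /bilin mulr_suml.
  rewrite -(pair_big xpredT xpredT (fun s t => (E s t w *: (sigma^-1 *: cX (s, t))) 0 i))/=.
  apply: eq_bigr => s _; rewrite mulr_suml; apply: eq_bigr => t _.
  rewrite !mxE/=; ring.
have mx i : measurable_fun [set: T] (fun w => x w 0 i).
  rewrite (_ : (fun w => _) = (fun w => \sum_st E st.1 st.2 w * (sigma^-1 *: cX st) 0 i)).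
    apply: measurable_sum => j.
    by apply: measurable_funM => //; exact: measurable_funP.
  by apply/funext => w; rewrite /x summxE; apply: eq_bigr => j _; rewrite mxE.
have evE i w : (sigma * (1 + theta) * rt < bilin (u i) (v i) w) = ((1 + theta) * rt < x w 0 i).
  by rewrite xE ltr_pdivlMr// -mulrA mulrC.
have mA : measurable A.
  apply: fin_bigcup_measurable; first exact: finite_finset.
  move=> i _; rewrite (_ : [set w | _] = [set: T] `&` (fun w => x w 0 i) @^-1` `](1 + theta) * rt, +oo[).
    exact: mx.
  by apply/seteqP; split=> w /=; rewrite in_itv/= andbT evE; [split|case].
have PA : P A = (fine (P A))%:E by rewrite fineK// fin_num_measure.
rewrite PA lee_fin; apply: le_expR_mul => [|t t0]; first exact: expR_ge0.
have lnK0 : 0 <= ln (K%:R : R) by rewrite ln_ge0// ler1n.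
have q0 : 0 < ln (K%:R : R) + 1 by rewrite ltr_wpDl.
(* This exponent makes K^a at most exp t; as t > 0 is arbitrary, the number K of pairs leaves no
   trace. *)
pose a := Num.min 1 (t / (ln (K%:R : R) + 1)).
have a0 : 0 < a by rewrite lt_min ltr01 divr_gt0.
have a1 : a <= 1 by rewrite ge_min lexx.
have Ka : K%:R `^ a <= expR t.
  rewrite /powR gt_eqF ?ltr0n// ler_expR.
  apply: (@le_trans _ _ (t / (ln (K%:R : R) + 1) * ln K%:R)).
    by rewrite ler_wpM2r// ge_min lexx orbT.
  rewrite mulrAC ler_pdivrMr// ler_wpM2l ?(ltW t0)//; lra.
have a01 : 0 <= a <= 1 by rewrite ltW.
have be0 : 0 <= l / a by rewrite divr_ge0// ltW.
have bea : l / a * a = l by rewrite divfK// gt_eqF.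
have L0 := logLip_soft_max_ge0 be0 a01; have hF := logLip_soft_max K0 be0 a01.
have := @slepian_mgf a; rewrite a0 a1 => /(_ isT) hmgf.
have := @expectation_le_gsmooths R _ _ P _ (fun ij : 'I_m * 'I_n => E ij.1 ij.2) K
  (fun st => sigma^-1 *: cX st) sigma sigma0 indep (fun ij => law ij.1 ij.2) _ _ L0 hF.
rewrite (eq_map (fun st => _ : sigma *: (sigma^-1 *: cX st) = cX st)); last first.
  by move=> st; rewrite scalerA divff ?scale1r// gt_eqF.
rewrite -/x => hexp.
have markov : ((expR (l * ((1 + theta) * rt)) * fine (P A))%:E <=
    \int[P]_w (soft_max (l / a) a (x w))%:E)%E.
  rewrite EFinM -PA -(integral_cst P mA).
  have mf : measurable_fun [set: T] (fun w => (soft_max (l / a) a (x w))%:E).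
    by apply/measurable_EFinP; apply: (logLip_measurable L0 hF) => i; exact: mx.
  have f0 w : (0 <= (soft_max (l / a) a (x w))%:E)%E by rewrite lee_fin; exact: powR_ge0.
  apply: (@le_trans _ _ (\int[P]_(w in A) (soft_max (l / a) a (x w))%:E)%E).
    apply: ge0_le_integral => //.
    - by move=> w _; rewrite lee_fin expR_ge0.
    - exact: measurable_funTS.
    - move=> w [i _ /= hi]; rewrite lee_fin.
      apply: le_trans (soft_max_ge (l / a) K0 a01 (x w) i).
      by rewrite bea ler_expR ler_wpM2l ?(ltW l0)// ltW// -evE.
  by apply: ge0_subset_integral.
have := le_trans markov hexp; rewrite lee_fin => h.
have h2 : expR (l ^+ 2 / 2) * (expR (l * ((1 + theta) * rt)) * fine (P A)) <=
   expR t * expR (l * rt + l ^+ 2).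
  apply: (le_trans (ler_wpM2l (expR_ge0 _) h)); apply: (le_trans hmgf).
  by rewrite ler_wpM2r// expR_ge0.
have h3 : fine (P A) <= expR t * expR (- (l ^+ 2 / 2)).
  rewrite mulrA -expRD mulrC -ler_pdivlMr ?expR_gt0// in h2.
  apply: (le_trans h2); rewrite le_eqVlt; apply/orP; left; apply/eqP.
  by rewrite -expRN -mulrA -!expRD; congr expR; rewrite /l; field.
(* The exponent is l^2 / 2 with l^2 = theta^2 * rt^2, and rt^2 exceeds n + p by the cross term 2
   sqrt n sqrt p. *)
apply: (le_trans h3); rewrite ler_wpM2l ?expR_ge0// ler_expR lerN2.
rewrite ler_wpM2r// /l exprMn ler_wpM2l ?sqr_ge0// /rt natrD.
have sn : Num.sqrt (n%:R : R) ^+ 2 = n%:R by rewrite sqr_sqrtr.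
have sp : Num.sqrt (p%:R : R) ^+ 2 = p%:R by rewrite sqr_sqrtr.
have : 0 <= Num.sqrt (n%:R : R) * Num.sqrt p%:R by rewrite mulr_ge0// sqrtr_ge0.
by rewrite -[X in X + _ <= _]sn -[X in _ + X <= _]sp; lra.
Qed.

End finite.
End tail.

(** * Uniform noise bound over all pairs of vectors *)

Section noise.
Context {R : realType}.

Lemma ip_ge0 n (u : 'cV[R]_n) : 0 <= ip u u.
Proof. by apply: sumr_ge0 => i _; rewrite -expr2 sqr_ge0. Qed.

Lemma ip_eq0 n (u : 'cV[R]_n) : ip u u = 0 -> u = 0.
Proof.
move=> u0; apply/matrixP => i j; rewrite mxE ord1.
have sq0 k : true -> 0 <= u k 0 * u k 0 by rewrite -expr2 sqr_ge0.
have := @psumr_eq0P _ _ predT (fun k => u k 0 * u k 0) sq0 u0 i isT.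
by move=> /eqP; rewrite mulf_eq0 orbb => /eqP.
Qed.

Lemma ipZ n (s t : R) (u w : 'cV[R]_n) : ip (s *: u) (t *: w) = s * t * ip u w.
Proof. by rewrite /ip mulr_sumr; apply: eq_bigr => i _; rewrite !mxE; ring. Qed.

Lemma ip_mx n (u w : 'cV[R]_n) : ip u w = (u^T *m w) 0 0.
Proof. by rewrite mxE; apply: eq_bigr => i _; rewrite mxE. Qed.

Lemma cvg_sumr (I : Type) (r : seq I) (f : I -> nat -> R) (l : I -> R) :
  (forall i, f i @ \oo --> l i) ->
  (\sum_(i <- r) f i k) @[k --> \oo] --> \sum_(i <- r) l i.
Proof.
move=> h; elim: r => [|i r IH].
  rewrite big_nil; under eq_fun do rewrite big_nil; exact: cvg_cst.
rewrite big_cons; under eq_fun do rewrite big_cons; exact: cvgD.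
Qed.

Lemma rat_cV_approx n (a : 'cV[R]_n) : exists q : nat -> 'cV[rat]_n,
  forall i, map_mx ratr (q k) i 0 @[k --> \oo] --> a i 0.
Proof.
have h k : exists q : 'rV[rat]_n, l1norm (a^T - map_mx ratr q) <= k.+1%:R^-1.
  by apply: l1norm_rat; rewrite invr_gt0.
have [q hq] := choice h; exists (fun k => (q k)^T) => i.
apply/cvgrPdist_le => e e0; near=> k.
have -> : a i 0 - map_mx ratr (q k)^T i 0 = (a^T - map_mx ratr (q k)) ord0 i.
  by rewrite !mxE.
apply: (le_trans (norm_le_l1norm _ _)); apply: (le_trans (hq k)); rewrite ltW//.
by near: k; exact: near_infty_natSinv_lt (PosNum e0).
Unshelve. all: by end_near. Qed.

Context (d : measure_display) (T : measurableType d) (P : probability T R).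
Variables (m n p : nat) (sigma theta : R) (E : 'I_m -> 'I_n -> {RV P >-> R}).
Hypothesis n0 : (0 < n)%N.
Hypothesis p0 : (0 < p)%N.
Hypothesis theta0 : 0 < theta.
Hypothesis sigma0 : 0 < sigma.
Hypothesis indep : mutually_independent (fun ij : 'I_m * 'I_n => E ij.1 ij.2).
Hypothesis law : forall i j, has_normal_law (E i j) 0 sigma.
Variables (X : 'M[R]_(m, p)) (Q : 'M[R]_p).
Hypothesis XQ : X^T *m X = Q^T *m Q.
Hypothesis Xinj : forall a : 'cV[R]_p, X *m a = 0 -> a = 0.

Let C := sigma * (1 + theta) * (Num.sqrt n%:R + Num.sqrt p%:R).
Let nrm k (u : 'cV[R]_k) := Num.sqrt (ip u u).

Let nrm_gt0 k (u : 'cV[R]_k) : u != 0 -> 0 < nrm u.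
Proof.
move=> u0; rewrite sqrtr_gt0 lt_neqAle ip_ge0 andbT eq_sym.
by apply: contraNneq u0 => /ip_eq0 ->.
Qed.

Let ip_nrm k (u : 'cV[R]_k) : u != 0 -> ip ((nrm u)^-1 *: u) ((nrm u)^-1 *: u) = 1.
Proof.
move=> u0; have N0 := nrm_gt0 u0; rewrite ipZ -invfM -expr2 sqr_sqrtr ?ip_ge0//.
by rewrite mulVf// gt_eqF// -sqrtr_gt0.
Qed.

Lemma bilZ (s t : R) (u : 'cV[R]_m) (v : 'cV[R]_n) w :
  bilin E (s *: u) (t *: v) w = s * t * bilin E u v w.
Proof.
rewrite /bilin mulr_sumr; apply: eq_bigr => i _; rewrite mulr_sumr.
by apply: eq_bigr => j _; rewrite !mxE; ring.
Qed.

Lemma measurable_bil u v : measurable_fun [set: T] (bilin E u v).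
Proof.
apply: measurable_sum => i; apply: measurable_sum => j.
by apply: measurable_funM => //; exact: measurable_funP.
Qed.

Let dflt : 'cV[rat]_p * 'cV[rat]_n := (const_mx 1, const_mx 1).

Let good (q : 'cV[rat]_p * 'cV[rat]_n) := (q.1 != 0) && (q.2 != 0).

(** Pairs with a zero component cannot be normalised; they, and the codes of no pair, are sent to a
    fixed nonzero pair so that every index is usable. *)
Let pr (k : nat) : 'cV[rat]_p * 'cV[rat]_n :=
  if unpickle k is Some q then if good q then q else dflt else dflt.

Let good_pr k : good (pr k).
Proof.
have gd : good dflt.
  rewrite /good /dflt/=; apply/andP; split.
    by apply/eqP => /matrixP/(_ (Ordinal p0) 0)/eqP; rewrite !mxE oner_eq0.
  by apply/eqP => /matrixP/(_ (Ordinal n0) 0)/eqP; rewrite !mxE oner_eq0.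
by rewrite /pr; case: unpickle => // q; case: ifP.
Qed.

Let av q : 'cV[R]_p := map_mx ratr (q : 'cV[rat]_p * 'cV[rat]_n).1.
Let vv q : 'cV[R]_n := map_mx ratr (q : 'cV[rat]_p * 'cV[rat]_n).2.

Let good_a q : good q -> X *m av q != 0.
Proof.
move=> /andP[h _]; apply: contraNneq h => /Xinj.
by move=> /eqP; rewrite /av map_mx_eq0.
Qed.

Let good_v q : good q -> vv q != 0.
Proof. by move=> /andP[_ h]; rewrite /vv map_mx_eq0. Qed.

Let un q := (nrm (X *m av q))^-1 *: (X *m av q).
(** [Q] has the Gram matrix of [X] but only p rows, so [bn] has the inner products of [un] while the
    decoupled Gaussian vector lives in dimension p instead of m. *)
Let bn q := (nrm (X *m av q))^-1 *: (Q *m av q).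
Let vn q := (nrm (vv q))^-1 *: vv q.

Let bad k : set T := [set w | C < bilin E (un (pr k)) (vn (pr k)) w].

Let mbad k : measurable (bad k).
Proof.
rewrite (_ : bad k = [set: T] `&` bilin E (un (pr k)) (vn (pr k)) @^-1` `]C, +oo[).
  exact: measurable_bil.
by apply/seteqP; split=> w /=; rewrite /bad/= in_itv/= andbT; [split|case].
Qed.

Let ipXQ a a' : ip (X *m a) (X *m a') = ip (Q *m a) (Q *m a').
Proof. by rewrite !ip_mx !trmx_mul !mulmxA -(mulmxA _ _ X) XQ !mulmxA. Qed.

Let Pbad : (P (\bigcup_k bad k) <= (expR (- (theta ^+ 2 * (n + p)%:R / 2)))%:E)%E.
Proof.
(* The bound for finitely many pairs does not depend on their number, so it passes to the increasing
   union. *)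
pose F N := \bigcup_(i : 'I_N.+1) bad i.
have mF N : measurable (F N).
  by apply: fin_bigcup_measurable; first exact: finite_finset.
have FU : \bigcup_N F N = \bigcup_k bad k.
  apply/seteqP; split=> [w [N _ [i _ hi]]|w [k _ hk]]; first by exists i.
  by exists k => //; exists ord_max.
have ndF : nondecreasing_seq F.
  move=> a b ab; apply/subsetPset => w [i _ hi].
  by exists (widen_ord (leq_ltn_trans ab (ltnSn b) : (a < b.+1)%N) i).
have mU : measurable (\bigcup_N F N) by exact: bigcup_measurable.
rewrite -FU; apply: (cvge_le _ (nondecreasing_cvg_mu mF mU ndF)).
apply: nearW => N /=.
have := @tail_finite R d T P m n p sigma theta E n0 p0 theta0 sigma0 indep law
  N.+1 (fun i => un (pr i)) (fun i => vn (pr i)) (fun i => bn (pr i)) isT.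
apply.
- by move=> i; apply: ip_nrm; exact/good_v/good_pr.
- move=> i; rewrite -(ip_nrm (good_a (good_pr i))) /bn !ipZ; congr (_ * _).
  by rewrite ipXQ.
- by move=> i j; rewrite /un /bn !ipZ ipXQ.
Qed.

Lemma noise_bound : exists G : set T, [/\ measurable G,
  ((1 - expR (- (theta ^+ 2 * (n + p)%:R / 2)))%:E <= P G)%E &
  forall w, G w -> forall (a : 'cV[R]_p) (v : 'cV[R]_n),
    bilin E (X *m a) v w <=
    C * (Num.sqrt (ip (X *m a) (X *m a)) * Num.sqrt (ip v v))].
Proof.
exists (~` \bigcup_k bad k); split.
- by apply: measurableC; exact: bigcup_measurable.
- rewrite probability_setC ?EFinB; last exact: bigcup_measurable.
  by rewrite leeB.
move=> w Gw a v.
have rat_ok (q : 'cV[rat]_p * 'cV[rat]_n) :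
   bilin E (X *m av q) (vv q) w <= C * (nrm (X *m av q) * nrm (vv q)).
  have [gq|] := boolP (good q); last first.
    rewrite negb_and !negbK => /orP[]/eqP q0.
      have -> : av q = 0 by rewrite /av q0 map_mx0.
      rewrite mulmx0 -(scale0r (0 : 'cV[R]_m)) -[X in bilin E _ X]scale1r bilZ.
      by rewrite !mul0r /nrm ipZ !mul0r sqrtr0 mul0r mulr0.
    have -> : vv q = 0 by rewrite /vv q0 map_mx0.
    rewrite -(scale0r (0 : 'cV[R]_n)) -[X in bilin E X]scale1r bilZ.
    by rewrite mulr0 !mul0r [X in _ * (_ * X)]/nrm ipZ !mul0r sqrtr0 !mulr0.
  have := Gw; rewrite leNgt; move=> Gw'; apply/negP => h; apply: Gw'.
  exists (pickle q) => //; rewrite /bad/= /pr pickleK gq /un /vn bilZ.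
  have N1 := nrm_gt0 (good_a gq); have N2 := nrm_gt0 (good_v gq).
  by rewrite -invfM mulrC ltr_pdivlMr// mulr_gt0.
(* Both sides are continuous in (a, v), so rational pairs suffice. *)
have [qa ha] := rat_cV_approx a; have [qv hv] := rat_cV_approx v.
have hX i : (X *m map_mx ratr (qa k)) i 0 @[k --> \oo] --> (X *m a) i 0.
  rewrite mxE; under eq_fun do rewrite mxE.
  by apply: cvg_sumr => j; apply: cvgM; [exact: cvg_cst|exact: ha].
have cip l (f : nat -> 'cV[R]_l) (u : 'cV[R]_l) : (forall i, f k i 0 @[k --> \oo] --> u i 0) ->
    nrm (f k) @[k --> \oo] --> nrm u.
  move=> hf; apply: (@continuous_cvg _ _ _ _ _ (fun k => ip (f k) (f k))
    (@Num.sqrt R) (ip u u)); first exact: sqrt_continuous.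
  by apply: cvg_sumr => i; apply: cvgM.
have hl : bilin E (X *m map_mx ratr (qa k)) (map_mx ratr (qv k)) w @[k --> \oo]
    --> bilin E (X *m a) v w.
  apply: cvg_sumr => i; apply: cvg_sumr => j.
  by apply: cvgM; [apply: cvgM; [exact: hX|exact: hv]|exact: cvg_cst].
have hr : C * (nrm (X *m map_mx ratr (qa k)) * nrm (map_mx ratr (qv k))) @[k --> \oo]
    --> C * (nrm (X *m a) * nrm v).
  apply: cvgM; first exact: cvg_cst.
  by apply: cvgM; apply: cip; [exact: hX|exact: hv].
apply: (ler_cvg_to hl hr); apply: nearW => k; exact: (rat_ok (qa k, qv k)).
Qed.

End noise.

(** * Spectral theorem for symmetric matrices *)

Section spectral.
Context {R : rcfType}.

(** A complex eigenvalue z exists. For an eigenvector v, the number v M v^* equals z |v|^2 and is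
    its own conjugate because M is real and symmetric, so z is real. *)
Lemma symmetric_has_eigenvalue n (M : 'M[R]_n.+1) : M^T = M ->
  exists a, root (char_poly M) a.
Proof.
move=> symM; pose phi := real_complex R; pose MC := map_mx phi M.
have phiJ (x : R) : Num.conj (phi x) = phi x.
  by apply/CrealP/complex_realP; exists x.
have [z] : exists z, root (char_poly MC) z.
  by apply/closed_rootP; rewrite size_char_poly.
rewrite -eigenvalue_root_char => zP.
have [v vM v0] := eigenvalueP zP.
pose s := \sum_i v 0 i * Num.conj (v 0 i).
pose t := \sum_i \sum_j v 0 i * MC i j * Num.conj (v 0 j).
have tE : t = z * s.
  rewrite /t exchange_big /s mulr_sumr; apply: eq_bigr => j _ /=.
  rewrite mulrA -mulr_suml; congr (_ * _).
  by have := congr1 (fun w : 'rV_n.+1 => w 0 j) vM; rewrite !mxE.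
have tJ : Num.conj t = t.
  rewrite /t rmorph_sum [RHS]exchange_big; apply: eq_bigr => i _ /=.
  rewrite rmorph_sum; apply: eq_bigr => j _ /=.
  rewrite !rmorphM/= conjCK !mxE phiJ; rewrite -{1}symM mxE; ring.
have sJ : Num.conj s = s.
  rewrite /s rmorph_sum; apply: eq_bigr => i _ /=.
  by rewrite rmorphM/= conjCK mulrC.
have s0 : s != 0.
  apply: contraNneq v0 => /eqP; rewrite psumr_eq0 => [/allP h|i _]; last first.
    exact: mul_conjC_ge0.
  apply/eqP/matrixP => i j; rewrite ord1 mxE; apply/eqP.
  by have := h j (mem_index_enum j); rewrite /= mul_conjC_eq0.
have : z \is Num.real.
  apply/CrealP; apply: (mulIf s0).
  by rewrite -{1}sJ -rmorphM/= -tE tJ.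
move=> /complex_realP[a za]; exists a.
move: zP; rewrite eigenvalue_root_char za /MC -map_char_poly.
by rewrite -[(a%:C)%C]/(phi a) fmorph_root.
Qed.

Definition orthogonal_mx n (Q : 'M[R]_n) := Q *m Q^T = 1%:M.

Lemma orthogonal_mx_tr n (Q : 'M[R]_n) : orthogonal_mx Q -> Q^T *m Q = 1%:M.
Proof. exact: mulmx1C. Qed.

(** The reflection that negates x - e exchanges the unit vectors x and e. *)
Lemma householder n (x : 'rV[R]_n.+1) : x *m x^T = 1%:M ->
  exists H : 'M[R]_n.+1, [/\ H^T = H, H *m H = 1%:M & delta_mx 0 0 *m H = x].
Proof.
move=> x1; pose e : 'rV[R]_n.+1 := delta_mx 0 0.
have e1 : e *m e^T = 1%:M.
  by apply/matrixP => i j; rewrite !ord1 trmx_delta mul_delta_mx !mxE.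
have [xe|xe] := eqVneq x e.
  by exists 1%:M; rewrite trmx1 !mulmx1 xe.
have [w wE] : exists w, w = x - e by exists (x - e).
pose N := (w *m w^T) 0 0.
have N0 : N != 0.
  apply: contra_neq xe => /eqP; rewrite /N mxE psumr_eq0 => [/allP h|i _]; last first.
    by rewrite [w^T _ _]mxE -expr2 sqr_ge0.
  apply/eqP; rewrite -subr_eq0 -wE; apply/eqP/matrixP => i j; rewrite ord1 [RHS]mxE.
  have := h j (mem_index_enum j); rewrite /= [w^T _ _]mxE mulf_eq0 orbb => /eqP.
  by [].
have wwT : w *m w^T = N%:M by rewrite [LHS]mx11_scalar.
pose H := 1%:M - (2 / N) *: (w^T *m w).
exists H; split.
- by rewrite /H raddfB/= trmx1 linearZ/= trmx_mul trmxK.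
- have AA : w^T *m w *m (w^T *m w) = N *: (w^T *m w).
    by rewrite mulmxA -(mulmxA w^T) wwT mul_mx_scalar -scalemxAl.
  rewrite /H mulmxBl mul1mx mulmxBr mulmx1 -scalemxAl -scalemxAr AA !scalerA.
  rewrite (_ : 2 / N * (2 / N) * N = 2 / N + 2 / N); last by field.
  by rewrite scalerDl opprB addrK subrK.
- have ew : (e *m w^T) 0 0 = - (N / 2).
    have xeE : (x *m e^T) 0 0 = (e *m x^T) 0 0.
      by rewrite -[x *m e^T]trmxK [LHS]mxE trmx_mul trmxK.
    rewrite /N wE linearB/= !mulmxBr !mulmxBl x1 e1.
    move: xeE; rewrite !mxE eqxx/=.
    by set a := \sum_j _; set b := \sum_j _ => ->; field.
  rewrite -/e /H mulmxBr mulmx1 -scalemxAr mulmxA [e *m w^T]mx11_scalar ew.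
  rewrite mul_scalar_mx scalerA (_ : 2 / N * _ = -1) ?scaleN1r ?opprK; last by field.
  by rewrite wE addrC subrK.
Qed.

(** Deflation: a reflection carries a unit eigenvector to the first basis vector, and symmetry
    clears the first row and column beside the eigenvalue; the remaining block is handled by
    induction. *)
Lemma symmetric_diagonalization n (M : 'M[R]_n) : M^T = M ->
  exists Q : 'M[R]_n, exists d : 'rV[R]_n, orthogonal_mx Q /\ M = Q^T *m diag_mx d *m Q.
Proof.
elim: n M => [|n IH] M symM.
  by exists 1%:M, 0; split; [rewrite /orthogonal_mx trmx1 mulmx1|apply/matrixP => -[]].
have [a] := symmetric_has_eigenvalue symM.
rewrite -eigenvalue_root_char => /eigenvalueP[y yM y0].
pose N := (y *m y^T) 0 0.
have N0 : 0 < N.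
  rewrite lt_neqAle eq_sym /N mxE sumr_ge0 ?andbT; last first.
    by move=> i _; rewrite [y^T _ _]mxE -expr2 sqr_ge0.
  apply: contraNneq y0 => /eqP; rewrite psumr_eq0 => [/allP h|i _]; last first.
    by rewrite [y^T _ _]mxE -expr2 sqr_ge0.
  apply/eqP/matrixP => i j; rewrite ord1 [RHS]mxE; apply/eqP.
  by have := h j (mem_index_enum j); rewrite /= [y^T _ _]mxE mulf_eq0 orbb.
pose x := (Num.sqrt N)^-1 *: y.
have x1 : x *m x^T = 1%:M.
  rewrite /x linearZ/= -scalemxAl -scalemxAr scalerA -invfM -expr2 sqr_sqrtr ?ltW//.
  by rewrite [y *m y^T]mx11_scalar -/N scale_scalar_mx mulVf// gt_eqF.
have xM : x *m M = a *: x by rewrite /x -scalemxAl yM scalerA mulrC -scalerA.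
have [H [HT HH eH]] := householder x1.
have [B BH] : exists B, B = H *m M *m H by exists (H *m M *m H).
have symB : B^T = B by rewrite BH !trmx_mul HT symM mulmxA.
have rowB : delta_mx 0 0 *m B = a *: (delta_mx 0 0 : 'rV_n.+1).
  by rewrite BH !mulmxA eH xM -scalemxAl -eH -mulmxA HH mulmx1.
pose B' : 'M[R]_(1 + n) := B.
have urB : ursubmx B' = 0.
  apply/matrixP => i j; rewrite !mxE ord1.
  have := congr1 (fun w : 'rV_n.+1 => w 0 (rshift 1 j)) rowB.
  rewrite -rowE !mxE eqxx/= mulr0 => h; rewrite -[RHS]h.
  by congr (B _ _); apply: val_inj.
have ulB : ulsubmx B' = a%:M.
  apply/matrixP => i j; rewrite !mxE !ord1 eqxx.
  have := congr1 (fun w : 'rV_n.+1 => w 0 0) rowB.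
  rewrite -rowE !mxE eqxx/= mulr1 => h; rewrite -[RHS]h.
  by congr (B _ _); apply: val_inj.
have dlB : dlsubmx B' = 0.
  apply: trmx_inj; rewrite trmx_dlsub [B'^T]symB urB.
  by rewrite trmx0.
have drB : (drsubmx B')^T = drsubmx B' by rewrite trmx_drsub [B'^T]symB.
have [Q' [d' [oQ' dQ']]] := IH _ drB.
pose Q1 : 'M[R]_(1 + n) := block_mx 1%:M 0 0 Q'.
exists (Q1 *m H : 'M[R]_n.+1), (row_mx a%:M d' : 'rV[R]_(1 + n)).
have oQ1 : Q1 *m Q1^T = 1%:M.
  rewrite /Q1 tr_block_mx mulmx_block !trmx0 trmx1 !mulmx0 !mul0mx !addr0 add0r.
  by rewrite mulmx1 oQ' -scalar_mx_block.
split.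
  rewrite /orthogonal_mx trmx_mul HT mulmxA -(mulmxA Q1) HH mulmx1; exact: oQ1.
have BE : B = Q1^T *m diag_mx (row_mx a%:M d') *m Q1 :> 'M[R]_(1 + n).
  rewrite /Q1 diag_mx_row tr_block_mx !mulmx_block !trmx0 trmx1.
  rewrite !(mulmx0, mul0mx, addr0, add0r, mul1mx, mulmx1).
  rewrite -dQ' -[LHS](@submxK _ 1 n 1 n) ulB urB dlB; congr block_mx.
  by apply/matrixP => i j; rewrite !mxE !ord1 !eqxx.
rewrite trmx_mul HT.
have -> : H *m Q1^T *m diag_mx (row_mx a%:M d') *m (Q1 *m H) = H *m B *m H.
  by rewrite BE !mulmxA.
by rewrite BH !mulmxA HH mul1mx -mulmxA HH mulmx1.
Qed.

End spectral.

(** * The ordered list of eigenvalues *)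

Section eig.
Context {R : rcfType}.

Lemma char_poly_orthogonal_mx n (Q M : 'M[R]_n) : orthogonal_mx Q ->
  char_poly (Q^T *m M *m Q) = char_poly M.
Proof.
move=> oQ; pose P := map_mx polyC Q; pose Pt := map_mx polyC Q^T.
have PtP : Pt *m P = 1%:M by rewrite -map_mxM orthogonal_mx_tr// map_mx1.
have E : char_poly_mx (Q^T *m M *m Q) = Pt *m char_poly_mx M *m P.
  rewrite /char_poly_mx mulmxBr mulmxBl !map_mxM; congr (_ - _).
  by rewrite mul_mx_scalar -scalemxAl PtP scalemx1.
rewrite /char_poly E !det_mulmx mulrAC -det_mulmx PtP det1 mul1r//.
Qed.

Lemma char_poly_diag n (d : 'rV[R]_n) :
  char_poly (diag_mx d) = \prod_i ('X - (d 0 i)%:P).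
Proof.
rewrite char_poly_trig; last first.
  by apply/is_trig_mxP => i j; rewrite mxE; case: eqVneq => // ->; rewrite ltnn.
by apply: eq_bigr => i _; rewrite mxE eqxx mulr1n.
Qed.

Lemma mup_prod_XsubC (s : seq R) (x : R) :
  mup x (\prod_(a <- s) ('X - a%:P)) = count_mem x s.
Proof.
elim: s => [|a s IH] /=.
  by rewrite big_nil mupNroot// root1.
rewrite big_cons mupM ?polyXsubC_eq0 ?monic_neq0 ?monic_prod_XsubC// IH.
by rewrite -[X in mup x X]expr1 mup_XsubCX; case: eqVneq.
Qed.

(** Orthogonal conjugation preserves the characteristic polynomial, whose root multiplicities count
    the repetitions on the diagonal. *)
Lemma eigvals_perm n (Q : 'M[R]_n) (d : 'rV[R]_n) : orthogonal_mx Q ->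
  perm_eq (eigvals (Q^T *m diag_mx d *m Q)) [seq d 0 i | i <- enum 'I_n].
Proof.
move=> oQ; set s := [seq _ | i <- _].
have cE : char_poly (Q^T *m diag_mx d *m Q) = \prod_(a <- s) ('X - a%:P).
  by rewrite char_poly_orthogonal_mx// char_poly_diag /s big_map big_enum.
rewrite /eigvals cE; set p := \prod_(a <- s) _.
have p0 : p != 0 by rewrite monic_neq0// monic_prod_XsubC.
have E : [seq nseq (mup x p) x | x <- rev (rootsR p)] =
    [seq nseq (count_mem x s) x | x <- rev (rootsR p)].
  by apply: eq_map => x; rewrite mup_prod_XsubC.
rewrite E; apply: perm_trans (perm_count_undup s).
apply/perm_flatten/perm_map/uniq_perm; rewrite ?undup_uniq ?rev_uniq//.
  exact: (sorted_uniq lt_trans ltxx (sorted_roots _ _ _)).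
move=> x; rewrite mem_rev mem_undup -(roots_on_rootsR p0) in_itv/=.
by rewrite root_prod_XsubC.
Qed.

Lemma sorted_flatten_nseq (f : R -> nat) (s : seq R) : sorted >%R s ->
  sorted >=%R (flatten [seq nseq (f x) x | x <- s]).
Proof.
rewrite (sorted_pairwise (fun x y z xy yz => lt_trans yz xy)).
rewrite (sorted_pairwise (fun x y z xy yz => le_trans yz xy)).
elim: s => //= x s IH /andP[xs ps]; rewrite pairwise_cat IH// andbT; apply/andP; split.
  apply/allrelP => a b /nseqP[-> _] /flatten_mapP[y ys /nseqP[-> _]].
  by rewrite ltW//; exact: (allP xs).
by elim: (f x) => //= k ->; rewrite andbT; apply/allP => y /nseqP[-> _].
Qed.

Lemma eigvals_sorted n (M : 'M[R]_n) : sorted >=%R (eigvals M).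
Proof. by apply: sorted_flatten_nseq; rewrite rev_sorted; exact: sorted_roots. Qed.

Lemma spectral_eigval n (M : 'M[R]_n) : M^T = M ->
  exists Q : 'M[R]_n, [/\ orthogonal_mx Q,
    M = Q^T *m diag_mx (\row_i eigval M i.+1) *m Q &
    forall i j, (i <= j)%N -> (j < n)%N -> eigval M j.+1 <= eigval M i.+1].
Proof.
move=> /symmetric_diagonalization[Q [d [oQ dM]]].
have pe := eigvals_perm d oQ; rewrite -dM in pe.
have sz : size (eigvals M) = n by rewrite (perm_size pe) size_map size_enum_ord.
have /tuple_permP[s hs] : perm_eq (eigvals M) [tuple d 0 i | i < n].
  by rewrite (perm_trans pe)//.
have dE (i : 'I_n) : eigval M i.+1 = d 0 (s i).
  rewrite /eigval/= hs -tnth_nth !tnth_mktuple//.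
exists (row_perm s Q); split.
- have := oQ; rewrite /orthogonal_mx => QQ.
  rewrite row_permE trmx_mul mulmxA -(mulmxA _ Q) QQ mulmx1.
  by rewrite tr_perm_mx -perm_mxM mulgV perm_mx1.
- rewrite {1}dM row_permE trmx_mul -!mulmxA; congr (_ *m _); rewrite !mulmxA.
  congr (_ *m _); rewrite tr_perm_mx.
  apply/matrixP => i j.
  rewrite -row_permE -[X in _ *m perm_mx X]invgK -col_permE !mxE.
  by rewrite dE permKV (inj_eq perm_inj).
- move=> i j ij jn; rewrite /eigval/=.
  have := eigvals_sorted M; rewrite (sorted_pairwise (fun x y z xy yz => le_trans yz xy)).
  case: (ltngtP i j) ij => // [ij _|-> _ _]; last by [].
  move=> /(pairwiseP 0)/(_ i j); apply=> //; rewrite inE sz//.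
  exact: ltn_trans jn.
Qed.

End eig.

(** * Frobenius product, singular values and nuclear norm *)

Section mat.
Context {R : realType}.

Definition fip m n (A B : 'M[R]_(m, n)) : R := \tr (A^T *m B).

Lemma fipE m n (A B : 'M[R]_(m, n)) : fip A B = \sum_i \sum_j A i j * B i j.
Proof.
rewrite /fip /mxtrace exchange_big; apply: eq_bigr => j _ /=.
by rewrite mxE; apply: eq_bigr => i _; rewrite mxE.
Qed.

Lemma fipC m n (A B : 'M[R]_(m, n)) : fip A B = fip B A.
Proof. by rewrite /fip -mxtrace_tr trmx_mul trmxK. Qed.

Lemma fipDl m n (A B C : 'M[R]_(m, n)) : fip (A + B) C = fip A C + fip B C.
Proof. by rewrite /fip linearD/= mulmxDl raddfD. Qed.

Lemma fipBl m n (A B C : 'M[R]_(m, n)) : fip (A - B) C = fip A C - fip B C.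
Proof. by rewrite /fip linearB/= mulmxBl raddfB. Qed.

Lemma fipDr m n (A B C : 'M[R]_(m, n)) : fip A (B + C) = fip A B + fip A C.
Proof. by rewrite /fip mulmxDr raddfD. Qed.

Lemma fipBr m n (A B C : 'M[R]_(m, n)) : fip A (B - C) = fip A B - fip A C.
Proof. by rewrite /fip mulmxBr raddfB. Qed.

Lemma fipZl m n a (A B : 'M[R]_(m, n)) : fip (a *: A) B = a * fip A B.
Proof. by rewrite /fip linearZ/= -scalemxAl mxtraceZ. Qed.

Lemma fipZr m n a (A B : 'M[R]_(m, n)) : fip A (a *: B) = a * fip A B.
Proof. by rewrite fipC fipZl fipC. Qed.

Lemma fip_mull m n k (X : 'M[R]_(m, n)) (A : 'M[R]_(m, k)) (B : 'M[R]_(n, k)) :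
  fip A (X *m B) = fip (X^T *m A) B.
Proof. by rewrite /fip trmx_mul trmxK mulmxA. Qed.

Lemma fip_mulr m n k (X : 'M[R]_(n, k)) (A : 'M[R]_(m, k)) (B : 'M[R]_(m, n)) :
  fip A (B *m X) = fip (A *m X^T) B.
Proof. by rewrite /fip trmx_mul trmxK mulmxA [LHS]mxtrace_mulC mulmxA. Qed.

Lemma ip_fip n (u w : 'cV[R]_n) : ip u w = fip u w.
Proof. by rewrite ip_mx /fip trace_mx11. Qed.

Lemma fip_ge0 m n (A : 'M[R]_(m, n)) : 0 <= fip A A.
Proof. by rewrite fipE; do 2 apply: sumr_ge0 => ? _; rewrite -expr2 sqr_ge0. Qed.

Lemma fnE m n (A : 'M[R]_(m, n)) : frobenius_norm A = Num.sqrt (fip A A).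
Proof.
by congr Num.sqrt; rewrite fipE; do 2 apply: eq_bigr => ? _; rewrite expr2.
Qed.

Lemma fn_ge0 m n (A : 'M[R]_(m, n)) : 0 <= frobenius_norm A.
Proof. exact: sqrtr_ge0. Qed.

Lemma fn2 m n (A : 'M[R]_(m, n)) : frobenius_norm A ^+ 2 = fip A A.
Proof. by rewrite fnE sqr_sqrtr// fip_ge0. Qed.

Lemma fip_eq0 m n (A : 'M[R]_(m, n)) : fip A A = 0 -> A = 0.
Proof.
rewrite fipE => h; apply/matrixP => i j; rewrite mxE.
have h0 k : true -> 0 <= \sum_j A k j * A k j.
  by move=> _; apply: sumr_ge0 => l _; rewrite -expr2 sqr_ge0.
have hi := @psumr_eq0P _ _ predT _ h0 h i isT.
have h1 l : true -> 0 <= A i l * A i l by rewrite -expr2 sqr_ge0.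
have := @psumr_eq0P _ _ predT _ h1 hi j isT.
by move=> /eqP; rewrite mulf_eq0 orbb => /eqP.
Qed.

Lemma fn_eq0 m n (A : 'M[R]_(m, n)) : frobenius_norm A = 0 -> A = 0.
Proof. by move=> h; apply: fip_eq0; rewrite -fn2 h expr0n. Qed.

Lemma fip_CS m n (A B : 'M[R]_(m, n)) :
  fip A B <= frobenius_norm A * frobenius_norm B.
Proof.
set a := frobenius_norm A; set b := frobenius_norm B.
have [a0|a0] := eqVneq a 0.
  by rewrite a0 mul0r (fn_eq0 a0) -(scale0r A) fipZl mul0r.
have [b0|b0] := eqVneq b 0.
  by rewrite b0 mulr0 (fn_eq0 b0) -(scale0r B) fipZr mul0r.
have a1 : 0 < a by rewrite lt_neqAle eq_sym a0 fn_ge0.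
have b1 : 0 < b by rewrite lt_neqAle eq_sym b0 fn_ge0.
have := fip_ge0 (b *: A - a *: B).
rewrite fipBl !fipBr !fipZl !fipZr (fipC B A) -!fn2 -/a -/b => h.
have : 0 <= 2 * (a * b) * (a * b - fip A B) by lra.
by rewrite pmulr_rge0 ?subr_ge0// !mulr_gt0.
Qed.

Lemma fnD m n (A B : 'M[R]_(m, n)) :
  frobenius_norm (A + B) <= frobenius_norm A + frobenius_norm B.
Proof.
rewrite -(@ler_pXn2r _ 2) ?nnegrE ?addr_ge0 ?fn_ge0//.
rewrite fn2 fipDl !fipDr (fipC B A) sqrrD !fn2.
have := fip_CS A B; lra.
Qed.

Lemma fnN m n (A : 'M[R]_(m, n)) : frobenius_norm (- A) = frobenius_norm A.
Proof. by rewrite !fnE -scaleN1r fipZl fipZr mulN1r mulN1r opprK. Qed.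

Lemma fip_col m n k (A : 'M[R]_(m, n)) (C : 'M[R]_(n, k)) (B : 'M[R]_(m, n)) :
  fip (A *m C) (B *m C) = \sum_j fip (A *m col j C) (B *m col j C).
Proof.
rewrite fipE exchange_big; apply: eq_bigr => j _ /=; rewrite fipE.
apply: eq_bigr => i _; rewrite big_ord1 !mxE; congr (_ * _);
  by apply: eq_bigr => l _; rewrite !mxE.
Qed.

Definition contraction m n (W : 'M[R]_(m, n)) :=
  forall x : 'cV[R]_n, fip (W *m x) (W *m x) <= fip x x.

Lemma contraction_mulmx m n k (W : 'M[R]_(m, n)) (C : 'M[R]_(n, k)) : contraction W ->
  fip (W *m C) (W *m C) <= fip C C.
Proof.
move=> hW; rewrite fip_col -[C in leRHS]mul1mx fip_col.
by apply: ler_sum => j _; rewrite !mul1mx.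
Qed.

Lemma contraction_tr m n (W : 'M[R]_(m, n)) : contraction W -> contraction W^T.
Proof.
move=> hW y; set z := W^T *m y.
have h : fip z z <= frobenius_norm y * frobenius_norm z.
  rewrite {1}/z fipC fip_mull trmxK fipC; apply: (le_trans (fip_CS _ _)).
  rewrite ler_wpM2l ?fn_ge0// -(@ler_pXn2r _ 2) ?nnegrE ?fn_ge0// !fn2.
  exact: hW.
have [z0|z0] := eqVneq (frobenius_norm z) 0.
  by rewrite -fn2 z0 expr0n/= fip_ge0.
have z1 : 0 < frobenius_norm z by rewrite lt_neqAle eq_sym z0 fn_ge0.
rewrite -!fn2 lerXn2r ?nnegrE ?fn_ge0//.
by move: h; rewrite -fn2 expr2 ler_pM2r.
Qed.

Lemma contraction_proj m n (W : 'M[R]_(m, n)) (P : 'M[R]_n) : contraction W -> P^T = P ->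
  P *m P = P -> fip (W *m P) (W *m P) <= \tr P.
Proof. by move=> /contraction_mulmx hW PT PP; apply: (le_trans (hW _ _)); rewrite /fip PT PP. Qed.

Lemma orthogonal_mx_conj n (Q M D : 'M[R]_n) : orthogonal_mx Q -> M = Q^T *m D *m Q ->
  Q *m M *m Q^T = D.
Proof.
move=> oQ ->; have QQ : Q *m Q^T = 1%:M := oQ.
by rewrite !mulmxA QQ mul1mx -mulmxA QQ mulmx1.
Qed.

Lemma singvalP m n (C : 'M[R]_(m, n)) : exists Q : 'M[R]_n,
  [/\ orthogonal_mx Q, C^T *m C = Q^T *m diag_mx (\row_i singval C i.+1 ^+ 2) *m Q &
    forall i j, (i <= j)%N -> (j < n)%N -> singval C j.+1 <= singval C i.+1].
Proof.
have sym : (C^T *m C)^T = C^T *m C by rewrite trmx_mul trmxK.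
have [Q [oQ dQ mono]] := spectral_eigval sym.
exists Q; split=> //; last first.
  by move=> i j ij jn; rewrite ler_wsqrtr//; exact: mono.
rewrite {1}dQ; congr (_ *m diag_mx _ *m _); apply/rowP => i; rewrite !mxE.
rewrite sqr_sqrtr//.
have E : (C *m Q^T)^T *m (C *m Q^T) = diag_mx (\row_i eigval (C^T *m C) i.+1).
  by rewrite trmx_mul trmxK mulmxA -(mulmxA Q); exact: orthogonal_mx_conj.
have -> : eigval (C^T *m C) i.+1 = ((C *m Q^T)^T *m (C *m Q^T)) i i.
  by rewrite E !mxE eqxx mulr1n.
by rewrite mxE; apply: sumr_ge0 => k _; rewrite mxE -expr2 sqr_ge0.
Qed.

Lemma singval_ge0 m n (C : 'M[R]_(m, n)) j : 0 <= singval C j.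
Proof. exact: sqrtr_ge0. Qed.

Lemma nuclear_normE m n (C : 'M[R]_(m, n)) :
  nuclear_norm C = \sum_(i < n) singval C i.+1.
Proof. by rewrite /nuclear_norm big_add1 big_mkord. Qed.

(** Otherwise the first k + 1 squared singular values are invertible, and the partial identity of
    rank k + 1 factors through C. *)
Lemma singval_gt_rank m n (C : 'M[R]_(m, n)) k j :
  (\rank C <= k)%N -> (k <= j < n)%N -> singval C j.+1 = 0.
Proof.
move=> rk /andP[kj jn]; have [Q [oQ dQ mono]] := singvalP C.
apply/eqP; apply: contraLR rk => sj; rewrite -ltnNge.
pose dV : 'rV[R]_n := \row_i (singval C i.+1 ^+ 2)^-1.
have pidE : (pid_mx k.+1 : 'M[R]_n) *m diag_mx dV *m
    diag_mx (\row_i singval C i.+1 ^+ 2) = pid_mx k.+1.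
  rewrite -mulmxA mulmx_diag; apply/matrixP => a b.
  rewrite mul_mx_diag !mxE; case: eqVneq => [ab|]; last by rewrite mul0r.
  case: ltnP => ak; last by rewrite mul0r.
  rewrite mul1r mulVf// sqrf_eq0.
  have bj : (b <= j)%N by rewrite -(val_inj ab : a = b); apply: leq_trans kj.
  rewrite gt_eqF// (lt_le_trans _ (mono _ _ bj jn))//.
  by rewrite lt_neqAle eq_sym sj singval_ge0.
have rk1 : \rank (pid_mx k.+1 : 'M[R]_n) = k.+1.
  by rewrite rank_pid_mx// (leq_ltn_trans kj jn).
rewrite -ltnS -[in X in (X <= _)%N]rk1 -pidE ltnS.
apply: (leq_trans (mxrankM_maxr _ _)).
have -> : diag_mx (\row_i singval C i.+1 ^+ 2) = Q *m C^T *m (C *m Q^T).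
  by rewrite mulmxA -(mulmxA Q); apply/esym/orthogonal_mx_conj.
apply: (leq_trans (mxrankM_maxr _ _)); exact: mxrankM_maxl.
Qed.

(** Duality with the operator norm: in the basis of right singular vectors q_j of C the product is a
    sum of <W q_j, C q_j>, with |W q_j| <= 1 and |C q_j| the j-th singular value. *)
Lemma fip_nuclear m n (W C : 'M[R]_(m, n)) : contraction W -> fip W C <= nuclear_norm C.
Proof.
move=> hW; have [Q [oQ dQ _]] := singvalP C.
have -> : fip W C = fip (W *m Q^T) (C *m Q^T).
  by rewrite fip_mulr trmxK -mulmxA orthogonal_mx_tr// mulmx1.
rewrite fip_col nuclear_normE; apply: ler_sum => j _.
apply: (le_trans (fip_CS _ _)).
have q1 : fip (col j Q^T) (col j Q^T) = 1.
  have -> : 1 = (Q *m Q^T) j j by rewrite (oQ : _ = 1%:M) mxE eqxx.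
  by rewrite fipE mxE; apply: eq_bigr => i _; rewrite big_ord1 !mxE.
have -> : frobenius_norm (C *m col j Q^T) = singval C j.+1.
  apply/eqP; rewrite -(@eqrXn2 _ 2) ?fn_ge0 ?singval_ge0// fn2.
  rewrite /fip trmx_mul !mulmxA -(mulmxA _ C^T) dQ.
  have cq : Q *m col j Q^T = delta_mx j 0 by rewrite colE mulmxA oQ mul1mx.
  have cqT : (col j Q^T)^T *m Q^T = delta_mx 0 j.
    by rewrite -trmx_mul cq trmx_delta.
  rewrite !mulmxA cqT -mulmxA cq -rowE -colE trace_mx11 !mxE eqxx//.
rewrite ler_piMl ?singval_ge0// -(@ler_pXn2r _ 2) ?nnegrE ?fn_ge0// fn2 expr1n.
by rewrite -[leRHS]q1; exact: hW.
Qed.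

Lemma orthodiagM n (Q : 'M[R]_n) (a b : 'rV[R]_n) : orthogonal_mx Q ->
  (Q^T *m diag_mx a *m Q) *m (Q^T *m diag_mx b *m Q) =
  Q^T *m diag_mx (\row_i (a 0 i * b 0 i)) *m Q.
Proof.
by move=> oQ; rewrite !mulmxA -(mulmxA _ Q) oQ mulmx1 -mulmx_diag !mulmxA.
Qed.

Lemma orthodiag_tr n (Q : 'M[R]_n) (a : 'rV[R]_n) :
  (Q^T *m diag_mx a *m Q)^T = Q^T *m diag_mx a *m Q.
Proof. by rewrite !trmx_mul trmxK tr_diag_mx mulmxA. Qed.

Lemma mxtrace_orthodiag n (Q : 'M[R]_n) (a : 'rV[R]_n) : orthogonal_mx Q ->
  \tr (Q^T *m diag_mx a *m Q) = \sum_i a 0 i.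
Proof. by move=> oQ; rewrite mxtrace_mulC mulmxA oQ mul1mx mxtrace_diag. Qed.

(** [W] is the partial isometry of the polar decomposition of B, and [P] projects onto the row space
    of B; its trace is the number of nonzero singular values. *)
Lemma polar_factor m n (B : 'M[R]_(m, n)) k : (\rank B <= k)%N ->
  exists W : 'M[R]_(m, n), exists P : 'M[R]_n,
  [/\ fip W B = nuclear_norm B, W^T *m W = P, P^T = P & [/\ P *m P = P,
    W *m P = W, B *m P = B & \tr P <= k%:R]].
Proof.
move=> rk; have [Q [oQ dQ _]] := singvalP B; have Qo := orthogonal_mx_tr oQ.
pose s : 'rV[R]_n := \row_i singval B i.+1.
(* Since 0^-1 = 0, these entries give the pseudo-inverse of (B^T B)^(1/2). *)
pose sV : 'rV[R]_n := \row_i (singval B i.+1)^-1.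
pose e : 'rV[R]_n := \row_i (singval B i.+1 != 0)%:R.
have DD a b := orthodiagM a b oQ; have DT := orthodiag_tr Q.
have Dtr a := mxtrace_orthodiag a oQ.
pose S := Q^T *m diag_mx sV *m Q; pose P := Q^T *m diag_mx e *m Q.
have BB : B^T *m B = Q^T *m diag_mx (\row_i singval B i.+1 ^+ 2) *m Q by [].
have eqD (a b : 'rV[R]_n) : (forall i, a 0 i = b 0 i) -> Q^T *m diag_mx a *m Q =
    Q^T *m diag_mx b *m Q by move=> h; congr (_ *m diag_mx _ *m _); apply/rowP.
have PP : P *m P = P.
  by rewrite DD; apply: eqD => i; rewrite !mxE; case: eqP; rewrite ?mulr0 ?mulr1.
have SP : S *m P = S.
  rewrite DD; apply: eqD => i; rewrite !mxE; case: eqVneq => [->|]; rewrite ?mulr1//.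
  by rewrite invr0 mulr0.
exists (B *m S), P; split.
- rewrite /fip trmx_mul DT -(mulmxA _ B^T) BB DD Dtr nuclear_normE; apply: eq_bigr => i _.
  rewrite !mxE; have [->|s0] := eqVneq (singval B i.+1) 0; first by rewrite expr0n mulr0.
  by rewrite expr2 mulKf.
- rewrite trmx_mul DT mulmxA -(mulmxA S) BB DD DD; apply: eqD => i; rewrite !mxE.
  have [->|s0] := eqVneq (singval B i.+1) 0; first by rewrite invr0 !mul0r.
  by rewrite expr2 mulKf// mulfV.
- exact: DT.
split=> //.
- by rewrite -mulmxA SP.
- have : fip (B *m (1%:M - P)) (B *m (1%:M - P)) = 0.
    have P1 : (1%:M - P)^T = 1%:M - P by rewrite linearB/= trmx1 DT.
    rewrite /fip trmx_mul P1 mulmxA -(mulmxA _ B^T) BB.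
    rewrite -mulmxA (_ : _ *m (1%:M - P) = 0) ?mulmx0 ?linear0//.
    rewrite mulmxBr mulmx1 DD; apply/eqP; rewrite subr_eq0; apply/eqP; apply: eqD => i.
    rewrite !mxE; case: eqVneq => [->|]; rewrite ?mulr1//.
    by rewrite expr0n mulr0.
  by move=> /fip_eq0; rewrite mulmxBr mulmx1 => /eqP; rewrite subr_eq0 => /eqP <-.
- rewrite Dtr.
  apply: (@le_trans _ _ (\sum_(i < n) ((i < k)%N%:R : R))).
    apply: ler_sum => i _; rewrite mxE; case: ltnP => ik; first by case: eqP; rewrite ?ler01.
    by rewrite (singval_gt_rank rk)// ?ik//= eqxx.
  have -> : \sum_(i < n) ((i < k)%N%:R : R) = (\sum_(i < n | (i < k)%N) 1)%N%:R.
    by rewrite natr_sum [RHS]big_mkcond; apply: eq_bigr => i _; case: ifP.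
  rewrite ler_nat; have [kn|nk] := leqP k n.
    by rewrite (big_ord_narrow kn) sum1_card card_ord.
  rewrite sum1_card; apply: leq_trans (ltnW nk).
  by rewrite -[X in (_ <= X)%N]card_ord max_card.
Qed.

(* W is the subgradient of the nuclear norm at B that agrees with N off the row
   and column spaces of B; N - W then has rank at most 3 k. *)
Lemma subgradient_gap m n k (B N D : 'M[R]_(m, n)) : (\rank B <= k)%N -> contraction N ->
  exists W, [/\ contraction W, fip W B = nuclear_norm B &
    fip (N - W) D <= 3 * Num.sqrt k%:R * frobenius_norm D].
Proof.
move=> rk hN; have [U [P [UB UU PT [PP UP BP trP]]]] := polar_factor rk.
(* [L] projects onto the column space of B, as [P] does onto its row space. *)
pose L := U *m U^T.
have LT : L^T = L by rewrite /L trmx_mul trmxK.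
have logLip : L *m L = L by rewrite /L mulmxA -(mulmxA U) UU UP.
have trL : \tr L <= k%:R by rewrite /L mxtrace_mulC UU.
have UL : U^T *m L = U^T by rewrite /L mulmxA UU -[P]PT -trmx_mul UP.
pose V := (1%:M - L) *m N *m (1%:M - P).
have L1T : (1%:M - L)^T = 1%:M - L by rewrite linearB/= trmx1 LT.
have L1L : (1%:M - L) *m (1%:M - L) = 1%:M - L.
  by rewrite mulmxBr mulmx1 mulmxBl mul1mx logLip subrr subr0.
have P1T : (1%:M - P)^T = 1%:M - P by rewrite linearB/= trmx1 PT.
have P1P : (1%:M - P) *m (1%:M - P) = 1%:M - P.
  by rewrite mulmxBr mulmx1 mulmxBl mul1mx PP subrr subr0.
have L1le q (y : 'M[R]_(m, q)) : fip ((1%:M - L) *m y) ((1%:M - L) *m y) <= fip y y.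
  rewrite fip_mull L1T mulmxA L1L mulmxBl mul1mx fipBl gerBl.
  by rewrite fipC /L -mulmxA fip_mull fip_ge0.
exists (U + V); split.
- move=> x; rewrite mulmxDl fipDl !fipDr.
  (* [U] and [V] have orthogonal ranges, and they act on the complementary components P x and (1 -
     P) x; hence the squared lengths add up to at most |x|^2. *)
  have cross : fip (U *m x) (V *m x) = 0.
    have : U^T *m V = 0 by rewrite /V !mulmxA (mulmxBr U^T) mulmx1 UL subrr !mul0mx.
    by move=> h; rewrite fipC fip_mull mulmxA h mul0mx -(scale0r x) fipZl mul0r.
  rewrite (fipC (V *m x)) cross addr0 add0r.
  have h1 : fip (U *m x) (U *m x) = fip x (P *m x).
    by rewrite fip_mull mulmxA UU fipC.
  have h2 : fip (V *m x) (V *m x) <= fip x ((1%:M - P) *m x).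
    rewrite /V -!mulmxA; apply: (le_trans (L1le _ _)); apply: (le_trans (hN _)).
    by rewrite [leLHS]fip_mull P1T mulmxA P1P fipC.
  rewrite h1; apply: (le_trans (lerD (lexx _) h2)).
  by rewrite -fipDr mulmxBl mul1mx addrC subrK.
- rewrite fipDl UB /V -{2}BP fip_mulr PT -(mulmxA _ (1%:M - P)) (mulmxBl _ _ P) mul1mx PP subrr mulmx0.
  by rewrite -(scale0r B) fipZl mul0r addr0.
(* Each of the three summands carries a projection of trace at most k and has Frobenius norm at most
   sqrt k, which gives the 3. *)
- have -> : N - (U + V) = L *m N + ((1%:M - L) *m N *m P - U).
    have zm (a l x u : 'M[R]_(m, n)) : a - (u + (a - l - x)) = l + (x - u).
      by apply/matrixP => i j; rewrite !mxE; ring.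
    by rewrite -(zm N); congr (_ - (_ + _)); rewrite /V mulmxBr mulmx1 mulmxBl mul1mx.
  have nk (q1 q2 : nat) (H : 'M[R]_(q1, q2)) : fip H H <= k%:R ->
      frobenius_norm H <= Num.sqrt k%:R.
    by rewrite fnE => h; rewrite ler_wsqrtr.
  have b1 : frobenius_norm (L *m N) <= Num.sqrt k%:R.
    apply: nk; apply: le_trans trL.
    have := contraction_proj (contraction_tr hN) LT logLip.
    by rewrite /fip trmx_mul trmxK mxtrace_mulC LT trmx_mul LT.
  have b2 : frobenius_norm ((1%:M - L) *m N *m P) <= Num.sqrt k%:R.
    apply: nk; apply: le_trans trP; apply: contraction_proj => // x.
    by rewrite -mulmxA; apply: le_trans (L1le _ _) (hN x).
  have b3 : frobenius_norm U <= Num.sqrt k%:R by apply: nk; rewrite /fip UU.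
  apply: (le_trans (fip_CS _ _)); rewrite ler_wpM2r ?fn_ge0//.
  apply: (le_trans (fnD _ _)); apply: (le_trans (lerD b1 (fnD _ _))).
  rewrite fnN; lra.
Qed.
End mat.

(** * Deterministic oracle inequality *)

Section oracle.
Context {R : realType}.

Lemma eigvals_size n (M : 'M[R]_n) : M^T = M -> size (eigvals M) = n.
Proof.
move=> /spectral_eigval[Q [oQ -> _]].
by rewrite (perm_size (eigvals_perm _ oQ)) size_map size_enum_ord.
Qed.

Lemma basic_rearrange (a2 b2 f1 f2 f3 e w1 w2 w3 : R) :
  a2 - 2 * (f1 - f3) + e + w1 <= b2 - 2 * (f2 - f3) + e + w2 -> w3 <= w1 ->
  a2 <= b2 + (2 * f1 - 2 * f2 - (w3 - w2)).
Proof. lra. Qed.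

(** Twice the hypothesis together with (a - 2 c)^2 + 2 (b - c)^2 >= 0. *)
Lemma quadratic_absorb (a b c : R) : a ^+ 2 <= b ^+ 2 + 2 * c * (a + b) ->
  a ^+ 2 <= 4 * b ^+ 2 + 6 * c ^+ 2.
Proof. by have := sqr_ge0 (a - 2 * c); have := sqr_ge0 (b - c); lra. Qed.

Section gram.
Variables (m p : nat) (X : 'M[R]_(m, p)).
Local Notation M := (X^T *m X).

Lemma gram_sym : M^T = M. Proof. by rewrite trmx_mul trmxK. Qed.

Lemma gram_bounds n (D : 'M[R]_(p, n)) :
  eigval M p * fip D D <= fip (X *m D) (X *m D) <= eigval M 1 * fip D D.
Proof.
have [Q [oQ dQ mono]] := spectral_eigval gram_sym.
move: (eigval M) dQ mono => f dQ mono.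
have -> : fip (X *m D) (X *m D) = \sum_(i < p) \sum_(j < n) f i.+1 * (Q *m D) i j ^+ 2.
  rewrite fip_mull mulmxA dQ -!mulmxA fipC fip_mull trmxK fipE.
  apply: eq_bigr => i _; apply: eq_bigr => j _.
  by rewrite mul_diag_mx; set Y := Q *m D; rewrite !mxE; ring.
have -> : fip D D = \sum_(i < p) \sum_(j < n) (Q *m D) i j ^+ 2.
  rewrite -[D in fip D _]mul1mx -(orthogonal_mx_tr oQ) -mulmxA fipC fip_mull trmxK fipE.
  by do 2 apply: eq_bigr => ? _; rewrite expr2.
rewrite !mulr_sumr; apply/andP; split; apply: ler_sum => i _; rewrite mulr_sumr;
  apply: ler_sum => j _; apply: ler_wpM2r; rewrite ?sqr_ge0//.
- rewrite -[p in f p](prednK (leq_ltn_trans (leq0n _) (ltn_ord i))).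
  have p0 := leq_ltn_trans (leq0n _) (ltn_ord i).
  by apply: mono; rewrite -ltnS prednK.
- exact: mono.
Qed.

Hypothesis lam0 : 0 < eigval M p.

Lemma gram_gt0 : (0 < p)%N.
Proof.
(* For p = 0 the list of eigenvalues is empty and [eigval] returns its default 0, against [lam0]. *)
rewrite lt0n; apply: contraTneq lam0 => p0.
by rewrite -leNgt /eigval nth_default// eigvals_size ?gram_sym// p0.
Qed.

Lemma gram_inj n (D : 'M[R]_(p, n)) : X *m D = 0 -> D = 0.
Proof.
move=> h; apply: fip_eq0; apply/eqP; rewrite eq_le fip_ge0 andbT.
have /andP[+ _] := gram_bounds D.
by rewrite h -(scale0r (0 : 'M[R]_(m, n))) fipZl mul0r pmulr_rle0.
Qed.

Lemma gram_rank : \rank X = p.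
Proof.
rewrite -mxrank_tr; apply/eqP; apply: inj_row_free => v h.
by apply: trmx_inj; rewrite trmx0; apply: gram_inj; rewrite -[X]trmxK -trmx_mul h trmx0.
Qed.

Lemma eigval1_gt0 : 0 < eigval M 1.
Proof.
have [Q [_ _ mono]] := spectral_eigval gram_sym.
apply: (lt_le_trans lam0); have p0 := gram_gt0.
by rewrite -[p in eigval _ p](prednK p0); apply: mono; rewrite // prednK.
Qed.

(** Apply the noise bound to a = y, where y is the image of x: since |X y| <= d_1(X) |y|, it gives
    |y|^2 <= |y| |x|. *)
Lemma contraction_noise n (C : R) (E : 'M[R]_(m, n)) : 0 < C ->
  (forall (a : 'cV_p) (v : 'cV_n), fip (X *m a) (E *m v) <=
    C * (frobenius_norm (X *m a) * frobenius_norm v)) ->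
  contraction ((C * singval X 1)^-1 *: (X^T *m E)).
Proof.
move=> C0 hE x; have l1 := eigval1_gt0.
have d0 : 0 < singval X 1 by rewrite sqrtr_gt0.
have t0 : 0 < C * singval X 1 by rewrite mulr_gt0.
set y := _ *m x.
have Xy : frobenius_norm (X *m y) <= singval X 1 * frobenius_norm y.
  rewrite -(@ler_pXn2r _ 2) ?nnegrE ?mulr_ge0 ?fn_ge0 ?(ltW d0)//.
  rewrite exprMn !fn2 /singval sqr_sqrtr ?(ltW l1)//.
  by have /andP[] := gram_bounds y.
have h : fip y y <= frobenius_norm y * frobenius_norm x.
  rewrite {2}/y -scalemxAl fipZr -mulmxA fip_mull trmxK.
  rewrite ler_pdivrMl//; apply: (le_trans (hE _ _)).
  rewrite -mulrA ler_pM2l// mulrA ler_wpM2r ?fn_ge0//.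
have [y0|y0] := eqVneq (frobenius_norm y) 0.
  by rewrite -fn2 y0 expr0n/= fip_ge0.
have y1 : 0 < frobenius_norm y by rewrite lt_neqAle eq_sym y0 fn_ge0.
rewrite -!fn2 lerXn2r ?nnegrE ?fn_ge0//.
by move: h; rewrite -fn2 expr2 ler_pM2l.
Qed.

Lemma oracle_ineq n k (C : R) (E : 'M[R]_(m, n)) (A B At : 'M[R]_(p, n)) :
  0 < C -> (forall (a : 'cV_p) (v : 'cV_n), fip (X *m a) (E *m v) <=
    C * (frobenius_norm (X *m a) * frobenius_norm v)) ->
  nuclear_objective (X *m A + E) X (C * singval X 1) At <=
    nuclear_objective (X *m A + E) X (C * singval X 1) B ->
  (\rank B <= k)%N ->
  fip (X *m (At - A)) (X *m (At - A)) <= 4 * fip (X *m (A - B)) (X *m (A - B)) +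
    54 * (condition_number M * k%:R * C ^+ 2).
Proof.
move=> C0 hE hmin rk; have l1 := eigval1_gt0.
have hN := contraction_noise C0 hE.
have [W [W1 WB WD]] := subgradient_gap (At - B) rk hN.
have d0 : 0 < singval X 1 by rewrite sqrtr_gt0.
have [t [tE t0]] : exists t, t = C * singval X 1 /\ 0 < t.
  by eexists; split; [reflexivity|rewrite mulr_gt0].
rewrite -tE in hN WD hmin.
have At1 := fip_nuclear At W1.
have [a aE] : exists a, a = frobenius_norm (X *m (At - A)) by eexists.
have [b bE] : exists b, b = frobenius_norm (X *m (A - B)) by eexists.
have a0 : 0 <= a by rewrite aE fn_ge0.
have b0 : 0 <= b by rewrite bE fn_ge0.
have basic : a ^+ 2 <= b ^+ 2 + 2 * t * fip (t^-1 *: (X^T *m E) - W) (At - B).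
  move: hmin; rewrite /nuclear_objective !fn2.
  have obj (Z : 'M[R]_(p, n)) : fip (X *m A + E - X *m Z) (X *m A + E - X *m Z) =
      fip (X *m (Z - A)) (X *m (Z - A)) - 2 * fip (X^T *m E) (Z - A) + fip E E.
    have -> : X *m A + E - X *m Z = E - X *m (Z - A).
      by rewrite mulmxBr opprB addrA [E + _]addrC.
    rewrite fipBl !fipBr (fipC (X *m _) E) (fip_mull X E); ring.
  have bE' : fip (X *m (B - A)) (X *m (B - A)) = b ^+ 2.
    by rewrite bE -fn2 -opprB mulmxN fnN.
  rewrite !obj bE' -fn2 -aE -WB => h.
  have tV : 2 * t * (t^-1 * fip (X^T *m E) (At - B)) = 2 * fip (X^T *m E) (At - B).
    by field; rewrite gt_eqF.
  rewrite fipBl fipZl mulrBr tV; move: h; rewrite !fipBr => h.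
  have : 2 * t * fip W At <= 2 * t * nuclear_norm At.
    by rewrite ler_wpM2l// mulr_ge0 ?(ltW t0).
  by rewrite !mulrBr; exact: basic_rearrange h.
have [l [lE l0]] : exists l, l = eigval M p /\ 0 < l by eexists.
have [s [s0 sE]] : exists s, 0 < s /\ s ^+ 2 = l.
  by exists (Num.sqrt l); rewrite sqrtr_gt0 sqr_sqrtr ?(ltW l0).
have [g [g0 gE]] : exists g, 0 <= g /\ g ^+ 2 = k%:R :> R.
  by exists (Num.sqrt k%:R); rewrite sqrtr_ge0 sqr_sqrtr.
have D1 : frobenius_norm (At - B) <= (a + b) / s.
  rewrite ler_pdivlMr//; apply: (@le_trans _ _ (frobenius_norm (X *m (At - B)))).
    rewrite -(@ler_pXn2r _ 2) ?nnegrE ?mulr_ge0 ?fn_ge0 ?(ltW s0)//.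
    rewrite exprMn !fn2 sE mulrC lE; by have /andP[] := gram_bounds (At - B).
  have -> : At - B = (At - A) + (A - B) by rewrite addrA subrK.
  by rewrite mulmxDr aE bE fnD.
have gS : Num.sqrt k%:R = g by rewrite -gE sqrtr_sqr ger0_norm.
rewrite gS in WD.
set c := 3 * t * g / s.
have c0 : 0 <= c by rewrite /c !mulr_ge0 ?invr_ge0 ?(ltW t0) ?(ltW s0).
have h : a ^+ 2 <= b ^+ 2 + 2 * c * (a + b).
  apply: (le_trans basic); rewrite lerD2l.
  have -> : 2 * c * (a + b) = 2 * t * (3 * g * ((a + b) / s)) by rewrite /c; ring.
  rewrite ler_wpM2l ?mulr_ge0 ?(ltW t0)//; apply: (le_trans WD).
  by rewrite ler_wpM2l// mulr_ge0.
(* The 54 is 6 * 3^2: the 3 comes from the subgradient gap, and t^2 / lambda_p = C^2 * lambda_1 /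
   lambda_p produces the condition number. *)
have -> : 54 * (condition_number M * k%:R * C ^+ 2) = 6 * c ^+ 2.
  rewrite /condition_number -lE -sE -gE.
  have -> : eigval M 1 = singval X 1 ^+ 2 by rewrite sqr_sqrtr// ltW.
  by rewrite /c tE; field; rewrite gt_eqF.
rewrite -!fn2 -aE -bE.
exact: quadratic_absorb h.
Qed.
End gram.
End oracle.

(** * Truncations and the two error bounds *)

Section final.
Context {R : realType}.

(** [P] projects onto the first k right singular vectors. Acting on the right, it commutes with
    multiplication by X on the left, so a truncation of X A is also one of A. *)
Lemma rank_truncation m n (Z : 'M[R]_(m, n)) k r : (k <= r)%N -> (r <= n)%N ->
  (\rank Z <= r)%N -> exists P : 'M[R]_n, (\rank P <= k)%N /\
    fip (Z - Z *m P) (Z - Z *m P) = \sum_(k.+1 <= j < r.+1) singval Z j ^+ 2.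
Proof.
move=> kr rn rk; have [Q [oQ dQ _]] := singvalP Z.
have kn := leq_trans kr rn.
pose e : 'rV[R]_n := \row_i (i < k)%N%:R; pose f : 'rV[R]_n := \row_i (k <= i)%N%:R.
exists (Q^T *m diag_mx e *m Q); split.
  have -> : diag_mx e = pid_mx k.
    by apply/matrixP => i j; rewrite !mxE -val_eqE /=; case: eqP.
  apply: (leq_trans (mxrankM_maxl _ _)); apply: (leq_trans (mxrankM_maxr _ _)).
  by rewrite rank_pid_mx.
have -> : Z - Z *m (Q^T *m diag_mx e *m Q) = Z *m (Q^T *m diag_mx f *m Q).
  rewrite -[Z in Z - _]mulmx1 -(orthogonal_mx_tr oQ) -mulmxBr; congr (_ *m _).
  rewrite -[X in _^T *m X - _]mul1mx mulmxA -mulmxBl -mulmxBr; congr (_ *m _ *m _).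
  apply/matrixP => i j; rewrite !mxE; case: eqVneq => [->|]; rewrite ?subrr//=.
  by case: leqP; rewrite ?subr0 ?subrr.
rewrite /fip trmx_mul orthodiag_tr mulmxA -(mulmxA _ Z^T) dQ.
rewrite !(orthodiagM _ _ oQ) mxtrace_orthodiag// big_add1/=.
transitivity (\sum_(k <= i < n) singval Z i.+1 ^+ 2).
  rewrite big_geq_mkord [RHS]big_mkcond; apply: eq_bigr => i _; rewrite !mxE.
  by case: (k <= i)%N; rewrite /= ?mul0r// mul1r mulr1.
rewrite (big_cat_nat kr rn)/= [X in _ + X]big_nat [X in _ + X]big1 ?addr0// => i ir.
by rewrite (singval_gt_rank rk ir) expr0n.
Qed.

Lemma bigmin_ge k (C x : R) (f : nat -> R) :
  (forall i, (i < k)%N -> x <= C * f i) -> x <= C * f 0%N ->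
  x <= C * \big[Num.min/f 0%N]_(i < k) f i.
Proof.
move=> h h0; elim/big_ind: _ => // [a b ha hb|i _]; last exact: h.
by case: (leP a b).
Qed.

Lemma nuclear_penalty_bounds m n p (theta sigma : R) (X : 'M[R]_(m, p))
    (E : 'M[R]_(m, n)) (A At : 'M[R]_(p, n)) :
  let M := X^T *m X in
  let K := sigma * (1 + theta) * (Num.sqrt n%:R + Num.sqrt p%:R) in
  0 < theta -> 0 < sigma -> 0 < eigval M p ->
  (forall (a : 'cV_p) (v : 'cV_n), fip (X *m a) (E *m v) <=
    K * (frobenius_norm (X *m a) * frobenius_norm v)) ->
  (forall B, nuclear_objective (X *m A + E) X (K * singval X 1) At <=
    nuclear_objective (X *m A + E) X (K * singval X 1) B) ->
  forall k, (k <= \rank A)%N ->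
  frobenius_norm (X *m At - X *m A) ^+ 2 <= 108 * (1 + theta) ^+ 2 *
    (\sum_(k.+1 <= j < (\rank A).+1) singval (X *m A) j ^+ 2 +
     condition_number M * k%:R * sigma ^+ 2 * (n + p)%:R) /\
  frobenius_norm (At - A) ^+ 2 <= 108 * (1 + theta) ^+ 2 *
    (condition_number M * \sum_(k.+1 <= j < (\rank A).+1) singval A j ^+ 2 +
     condition_number M / eigval M p * k%:R * sigma ^+ 2 * (n + p)%:R).
Proof.
move=> M K th0 s0 lam0 hE hmin k kr; have p0 := gram_gt0 lam0.
have K0 : 0 < K.
  have : 0 < Num.sqrt n%:R + Num.sqrt p%:R :> R.
    by rewrite ltr_wpDl ?sqrtr_ge0// sqrtr_gt0 ltr0n.
  by move=> np; rewrite /K !mulr_gt0// addr_gt0.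
have l1 := eigval1_gt0 lam0.
have c0 : 0 <= condition_number M by rewrite divr_ge0// ltW.
(* The 2 comes from (x + y)^2 <= 2 (x^2 + y^2); with the 54 of [oracle_ineq] it makes 108. *)
have K2 : K ^+ 2 <= 2 * (1 + theta) ^+ 2 * sigma ^+ 2 * (n + p)%:R.
  have [x [x0 xE]] : exists x, 0 <= x /\ x ^+ 2 = n%:R :> R.
    by exists (Num.sqrt n%:R); rewrite sqrtr_ge0 sqr_sqrtr.
  have [y [y0 yE]] : exists y, 0 <= y /\ y ^+ 2 = p%:R :> R.
    by exists (Num.sqrt p%:R); rewrite sqrtr_ge0 sqr_sqrtr.
  rewrite /K natrD -xE -yE !sqrtr_sqr !ger0_norm//.
  have -> : (sigma * (1 + theta) * (x + y)) ^+ 2 =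
     (1 + theta) ^+ 2 * sigma ^+ 2 * (x + y) ^+ 2 by ring.
  have -> : 2 * (1 + theta) ^+ 2 * sigma ^+ 2 * (x ^+ 2 + y ^+ 2) =
     (1 + theta) ^+ 2 * sigma ^+ 2 * (2 * (x ^+ 2 + y ^+ 2)) by ring.
  apply: ler_wpM2l; first by rewrite mulr_ge0 ?sqr_ge0.
  rewrite -subr_ge0.
  have -> : 2 * (x ^+ 2 + y ^+ 2) - (x + y) ^+ 2 = (x - y) ^+ 2 by ring.
  exact: sqr_ge0.
have th4 : 4 <= 108 * (1 + theta) ^+ 2.
  have : 1 <= (1 + theta) ^+ 2 by rewrite expr_ge1 ?lerDl ?addr_ge0 ?ltW.
  by lra.
have main (P : 'M[R]_n) : (\rank P <= k)%N ->
    fip (X *m (At - A)) (X *m (At - A)) <=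
    108 * (1 + theta) ^+ 2 * (fip (X *m (A - A *m P)) (X *m (A - A *m P)) +
      condition_number M * k%:R * sigma ^+ 2 * (n + p)%:R).
  move=> rP; have rB : (\rank (A *m P) <= k)%N.
    exact: leq_trans (mxrankM_maxr _ _) rP.
  apply: (le_trans (oracle_ineq lam0 K0 hE (hmin (A *m P)) rB)).
  rewrite mulrDr lerD// ?ler_wpM2r ?fip_ge0//.
  have -> : 108 * (1 + theta) ^+ 2 *
     (condition_number M * k%:R * sigma ^+ 2 * (n + p)%:R) =
     54 * (condition_number M * k%:R *
       (2 * (1 + theta) ^+ 2 * sigma ^+ 2 * (n + p)%:R)) by ring.
  by rewrite ler_wpM2l// ler_wpM2l// mulr_ge0.
have rn := rank_leq_col A.
split.
  have [P [rP PE]] := rank_truncation kr rn (mxrankM_maxr X A).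
  have := main P rP; rewrite mulmxBr [in X in _ <= X]mulmxBr mulmxA PE.
  by rewrite fn2.
have [P [rP PE]] := rank_truncation kr rn (leqnn _).
(* After multiplication by lambda_p the left side is controlled by the prediction error; on the
   right, lambda_p times the condition number is lambda_1, which bounds |X (A - A P)|^2 by |A - A
   P|^2. *)
rewrite fn2 -(ler_pM2l lam0).
have /andP[h _] := gram_bounds X (At - A).
apply: (le_trans h); apply: (le_trans (main P rP)).
rewrite [leRHS]mulrCA ler_pM2l; last by apply: lt_le_trans th4.
have /andP[_ h2] := gram_bounds X (A - A *m P).
rewrite PE in h2; apply: (le_trans (lerD h2 (lexx _))).
rewrite le_eqVlt; apply/orP; left; apply/eqP; rewrite /condition_number -/M.
by field; rewrite gt_eqF.
Qed.
End final.

(** * The noise event and the conclusion *)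

Lemma bil_random_matrix (R : realType) (d : measure_display) (T : measurableType d)
    (P : probability T R) m n (E : 'I_m -> 'I_n -> {RV P >-> R}) u v w :
  bilin E u v w = fip u (random_matrix E w *m v).
Proof.
rewrite fipE; apply: eq_bigr => i _; rewrite big_ord1 mxE mulr_sumr.
by apply: eq_bigr => j _; rewrite mxE; ring.
Qed.

Lemma noise_event (R : realType) (d : measure_display) (T : measurableType d)
    (P : probability T R) m n p (theta sigma : R)
    (E : 'I_m -> 'I_n -> {RV P >-> R}) (X : 'M[R]_(m, p)) :
  0 < theta -> 0 < sigma ->
  mutually_independent (fun ij : 'I_m * 'I_n => E ij.1 ij.2) ->
  (forall i j, has_normal_law (E i j) 0 sigma) -> 0 < eigval (X^T *m X) p ->
  exists G : set T, [/\ measurable G,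
    ((1 - expR (- (theta ^+ 2 * (n + p)%:R / 2)))%:E <= P G)%E &
    forall w, G w -> forall (a : 'cV_p) (v : 'cV_n),
      fip (X *m a) (random_matrix E w *m v) <=
      sigma * (1 + theta) * (Num.sqrt n%:R + Num.sqrt p%:R) *
      (frobenius_norm (X *m a) * frobenius_norm v)].
Proof.
move=> th0 s0 indep law lam0.
(* The comparison requires a nonempty index set of columns. Without columns v = 0 and both sides
   vanish on the whole space. *)
have [n0|n0] := posnP n.
  exists setT; split; first exact: measurableT.
    by rewrite probability_setT lee_fin gerBl expR_ge0.
  move=> w _ a v; have -> : v = 0 by apply/matrixP => i; have := ltn_ord i; rewrite [X in (_ < X)%N]n0.
  have f0 q : frobenius_norm (0 : 'cV[R]_q) = 0.
    by rewrite fnE -(scale0r (0 : 'cV[R]_q)) fipZl mul0r sqrtr0.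
  rewrite mulmx0 f0 !mulr0 -(scale0r (X *m a)) fipZr mul0r //.
have p0 := gram_gt0 lam0; have [Q [oQ dQ _]] := singvalP X.
(* A square factor of the Gram matrix, read off from the right singular vectors of X; it provides
   the p-dimensional copies of the vectors X a. *)
pose S := diag_mx (\row_i singval X i.+1) *m Q.
have XS : X^T *m X = S^T *m S.
  rewrite /S trmx_mul tr_diag_mx mulmxA -(mulmxA Q^T) mulmx_diag dQ.
  congr (_ *m diag_mx _ *m _); apply/rowP => i; rewrite !mxE; ring.
have [G [mG PG hG]] := noise_bound n0 p0 th0 s0 indep law XS (@gram_inj _ _ _ X lam0 1%N).
exists G; split=> // w Gw a v.
by have := hG w Gw a v; rewrite bil_random_matrix !ip_fip -!fnE.
Qed.

Theorem theorem12 (R : realType) :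
  exists C : R -> R,
  forall theta : R, 0 < theta ->
  forall (d : measure_display) (T : measurableType d) (P : probability T R)
    (m n p : nat) (X : 'M[R]_(m, p)) (A : 'M[R]_(p, n))
    (sigma : R) (E : 'I_m -> 'I_n -> {RV P >-> R})
    (Atilde : T -> 'M[R]_(p, n)),
  let Y := fun w : T => X *m A + random_matrix E w in
  let M := X^T *m X in
  let q := \rank X in
  let r := \rank A in
  let tau := (1 + theta) * singval X 1 * sigma *
             (Num.sqrt n%:R + Num.sqrt q%:R) in
  0 < sigma ->
  mutually_independent (fun ij : 'I_m * 'I_n => E ij.1 ij.2) ->
  (forall (i : 'I_m) (j : 'I_n), has_normal_law (E i j) 0 sigma) ->
  0 < eigval M p ->
  (forall (w : T) (B : 'M[R]_(p, n)),
     nuclear_objective (Y w) X tau (Atilde w)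
     <= nuclear_objective (Y w) X tau B) ->
  exists G : set T,
    [/\ measurable G,
        ((1 - expR (- (theta ^+ 2 * (n + q)%:R / 2)))%:E <= P G)%E &
        forall w : T, G w ->
          let pred_bound := fun k : nat =>
            \sum_(k.+1 <= j < r.+1) singval (X *m A) j ^+ 2
            + condition_number M * k%:R * sigma ^+ 2 * (n + q)%:R in
          frobenius_norm (X *m Atilde w - X *m A) ^+ 2
            <= C theta *
               \big[Num.min/pred_bound 0%N]_(k < r.+1) pred_bound k
          /\
          (forall k : nat, (k <= r)%N ->
             frobenius_norm (Atilde w - A) ^+ 2
             <= C theta *
                (condition_number M * \sum_(k.+1 <= j < r.+1) singval A j ^+ 2
                 + condition_number M / eigval M p
                   * k%:R * sigma ^+ 2 * (n + q)%:R))].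
Proof.
exists (fun theta => 108 * (1 + theta) ^+ 2).
move=> theta th0 d T P m n p X A sigma E At Y M q r tau s0 indep law lam0 hmin.
(* A positive smallest eigenvalue of M makes X injective, so its rank is p and the Gaussian
   dimension p is the q of the statement. *)
have qE : q = p by exact: gram_rank.
have [G [mG PG hG]] := noise_event th0 s0 indep law lam0.
exists G; split=> //; first by rewrite qE.
move=> w Gw pred_bound.
have tauE : tau = sigma * (1 + theta) * (Num.sqrt n%:R + Num.sqrt p%:R) * singval X 1.
  by rewrite /tau qE; ring.
have hm := hmin w; rewrite tauE in hm.
have key := nuclear_penalty_bounds th0 s0 lam0 (hG w Gw) hm.
split; last by move=> k /key[_]; rewrite qE.
(* The default of the iterated minimum is the value at k = 0, so it obeys the same bound. *)
apply: (@bigmin_ge _ _ _ _ pred_bound) => [k kr|]; rewrite /pred_bound qE.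
  by have [] := key k kr.
by have [] := key 0%N (leq0n _).
Qed.
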